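(* Let $\varepsilon_0 = (e-1)(1-\log(e-1))$ and $S_{\varepsilon_0} = \{(r,s) \in \mathbb{N}\times\mathbb{N} : \varepsilon_0 \le s/r \le 1/\varepsilon_0\}$. Let $f:\mathbb{R}^+\to\mathbb{R}^+$, $f(t) = \frac{(1-e^t)\log(1-e^{-t})}{t}$ (this is a bijection). For $(r,s) \in S_{\varepsilon_0}$ put $x = x(r,s) = f^{-1}(s/r)$ and $y = y(r,s) = f^{-1}(r/s)$, and let $$Q(x,y) = xy e^{-x-y}\left[ y e^{-y} + x e^{-x} - xy(e^{-y}+e^{-x})\right].$$ Then, uniformly as $r,s \to \infty$ with $(r,s) \in S_{\varepsilon_0}$, $$[b^{r-1}a^s] = s!\, r! \left(e^{-y} + O(s^{-1/2})\right) \frac{1}{\sqrt{2\pi}} x^{-r} y^{-s} \sqrt{\frac{y e^{-y}}{s\,Q(x,y)}},$$ where the implied constant in $O(s^{-1/2})$ is uniform over $S_{\varepsilon_0}$.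
   Context: For $n\ge1$, $S_n$ is the set of permutations of $[n]$. For non-negative integers $p+q=n-1$, $[b^p a^q]$ denotes the number of permutations $\pi \in S_n$ such that, for $i \in [n-1]$, $\pi(i) > i$ holds if and only if $i \in \{1,\dots,p\}$. Here $\mathbb{N}$ denotes the positive integers (so $r\ge 1$ and $[b^{r-1}a^s]$ concerns permutations of $[r+s]$). *)

(* Defs.v *)
From HB Require Import structures.
From mathcomp Require Import all_boot all_order all_algebra all_fingroup.
From mathcomp Require Import all_classical all_reals all_analysis.
Set Implicit Arguments. Unset Strict Implicit. Unset Printing Implicit Defensive.
Import Order.TTheory GRing.Theory Num.Theory.
Local Open Scope ring_scope.

(* [b^p a^q] with p + q = n - 1: permutations sigma of [n] (here 0-indexed
   as 'I_n) such that for i in [n-1] (0-indexed: i.+1 < n),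
   sigma(i) > i  iff  i in {1..p} (0-indexed: i < p).
   ba_count p q counts permutations of 'I_(p+q+1). *)
Definition ba_count (p q : nat) : nat :=
  #|[set sigma : 'S_(p + q).+1 |
      [forall i : 'I_(p + q).+1,
         (i.+1 < (p + q).+1)%N ==> ((i < sigma i)%N == (i < p)%N)]]|.

Definition eps0 (R : realType) : R :=
  (expR 1 - 1) * (1 - ln (expR 1 - 1)).

Definition inS (R : realType) (r s : nat) : Prop :=
  (0 < r)%N /\ (0 < s)%N /\
  eps0 R <= s%:R / r%:R /\ s%:R / r%:R <= (eps0 R)^-1.

Definition fP (R : realType) (t : R) : R :=
  (1 - expR t) * ln (1 - expR (- t)) / t.

(* f^{-1} : the (unique, f being a bijection R^+ -> R^+) t > 0 with f t = u *)
Definition fPinv (R : realType) (u : R) : R :=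
  xget 0 [set t : R | 0 < t /\ fP t = u].

Definition Qxy (R : realType) (x y : R) : R :=
  x * y * expR (- x - y) *
  (y * expR (- y) + x * expR (- x) - x * y * (expR (- y) + expR (- x))).

(* Main.v *)
(* Removing the largest value from a permutation shows that the number of
   permutations of [p + q + 1] whose i-th value is constrained only from one side is
   a product; inclusion-exclusion over the first [p] positions then turns the
   count [b^p a^q] into the positive sum over [k <= p] of the k-th difference of
   [j^p] at 0 times the k-th difference of [j^(q+1)] at 1.

   Each difference is a Fourier coefficient on a circle.  For [x, y] with
   (e^x - 1) (e^y - 1) = 1, which is what [x = fPinv (s/r)], [y = fPinv (r/s)]
   satisfy, the exponential factors in [k] cancel and the count becomes
   p! (q+1)! x^-p y^-(q+1) e^y sum_k P(S_k = p) P(T_k + N = q + 1), where [S_k] and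
   [T_k] are sums of [k] zero-truncated Poisson variables of parameters [x] and
   [y], and [N] is Poisson(y).  A local limit theorem with error O(1/k), uniform for
   [x, y] in [[1/3, 1]], replaces both probabilities by Gaussian densities; the
   parameters are tuned so that both are centred at the same [kap] proportional to
   [r].  The terms with 12 k <= p are exponentially small, and the remaining
   Gaussian sum is compared with its integral. *)
Require Import Defs.
From HB Require Import structures.
From mathcomp Require Import all_boot all_order all_algebra all_fingroup.
From mathcomp Require Import all_classical all_reals all_analysis.
From mathcomp Require Import ring lra.
Set Implicit Arguments. Unset Strict Implicit. Unset Printing Implicit Defensive.
Import Order.TTheory GRing.Theory Num.Theory.
Local Open Scope ring_scope.

(** The alternating sum given by inclusion-exclusion is open to cancellation; expanded in forward
    differences it has nonnegative terms, and a termwise approximation is enough. The accuracy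
    required is modest: both probabilities are Gaussian densities of height about kap^(-1/2), so the
    sum has that order, whereas an error O(1/kap) in one factor is summed against a total mass O(1)
    of the other. The resulting O(1/kap) is a relative error O(s^(-1/2)). Uniformity comes from
    explicit numerical bounds. Since [eps0] is the value of f at 1 and f takes reciprocal values at
    x and y when e^(-x) + e^(-y) = 1, the condition on s/r confines x and y to the interval from
    [conj_root 1] to 1, and [conj_root 1] is at least 1/3. There the mean of the truncated Poisson
    law is at least 1 + 1/36, which keeps the centre [kap] a fixed proportion below the end k = p of
    the sum, and its variance stays away from 0. Small k are treated apart because an error O(1/k)
    says nothing about them. *)

(** * Forward differences and surjection numbers *)

Fixpoint fdiff (V : zmodType) (g : nat -> V) (k n : nat) : V :=
  if k is k'.+1 then fdiff g k' n.+1 - fdiff g k' n else g n.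

Lemma eq_fdiff (V : zmodType) (g h : nat -> V) (k n : nat) :
  g =1 h -> fdiff g k n = fdiff h k n.
Proof. by move=> gh; elim: k n => [|k IH] n //=; rewrite !IH. Qed.

Lemma fdiff_shift (V : zmodType) (g : nat -> V) (k n : nat) :
  fdiff (fun j => g j.+1) k n = fdiff g k n.+1.
Proof. by elim: k n => [|k IH] n //=; rewrite !IH. Qed.

Lemma fdiffD (V : zmodType) (g h : nat -> V) (k n : nat) :
  fdiff (fun j => g j + h j) k n = fdiff g k n + fdiff h k n.
Proof. by elim: k n => [|k IH] n //=; rewrite !IH opprD addrACA. Qed.

Lemma fdiffB (V : zmodType) (g h : nat -> V) (k n : nat) :
  fdiff (fun j => g j - h j) k n = fdiff g k n - fdiff h k n.
Proof. by elim: k n => [|k IH] n //=; rewrite !IH !opprD !opprK addrACA. Qed.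

Lemma fdiff_diff (V : zmodType) (g : nat -> V) (k n : nat) :
  fdiff (fun j => g j.+1 - g j) k n = fdiff g k.+1 n.
Proof. by elim: k n => [|k IH] n //=; rewrite !IH. Qed.

(** Leibniz rule with the identity function, whose second difference vanishes. For k = 0 the
    truncated [k.-1] is harmless, its coefficient being 0. *)
Lemma fdiff_natM (A : comNzRingType) (g : nat -> A) (k n : nat) :
  fdiff (fun j => j%:R * g j) k n =
  n%:R * fdiff g k n + k%:R * fdiff g k.-1 n.+1.
Proof.
elim: k n => [|k IH] n /=; first by rewrite mul0r addr0.
rewrite !IH; case: k {IH} => [|k] /=; rewrite -!natr1; ring.
Qed.

(* This equals k! S(l,k), the number of surjections from [l] onto [k]. *)
Definition surjn (A : comNzRingType) (l k : nat) : A := fdiff (fun j => j%:R ^+ l) k 0.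

Lemma surjn0 (A : comNzRingType) (k : nat) : surjn A 0 k = (k == 0)%N%:R.
Proof.
rewrite /surjn (@eq_fdiff _ _ (fun=> 1)); last by move=> j; rewrite expr0.
case: k => [|k]; first by [].
suff fd1 n : fdiff (fun=> 1 : A) k.+1 n = 0 by rewrite fd1.
elim: k n => [|k IH] n; first by rewrite /= subrr.
by rewrite -[LHS]/(fdiff _ k.+1 n.+1 - fdiff _ k.+1 n) !IH subrr.
Qed.

Lemma surjnS0 (A : comNzRingType) (l : nat) : surjn A l.+1 0 = 0.
Proof. by rewrite /surjn /= expr0n. Qed.

Lemma surjnSS (A : comNzRingType) (l k : nat) :
  surjn A l.+1 k.+1 = k.+1%:R * (surjn A l k + surjn A l k.+1).
Proof.
rewrite /surjn (@eq_fdiff _ _ (fun j => j%:R * j%:R ^+ l)).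
  by rewrite fdiff_natM mul0r add0r [in RHS]/= addrC subrK.
by move=> j; rewrite exprS.
Qed.

Lemma surjn_small (A : comNzRingType) (l k : nat) : (l < k)%N -> surjn A l k = 0.
Proof.
elim: l k => [|l IH] [|k]//; first by rewrite surjn0.
by rewrite ltnS surjnSS => lk; rewrite !IH ?addr0 ?mulr0// ltnW.
Qed.

(** This is [T^l h] at 0 for the operator (T h) j = (j + 1)(h (j + 1) - h j), as [newton_sumS]
    shows. Each new excedance condition in [exc_countE] applies T once. *)
Definition newton_sum (A : comNzRingType) (l : nat) (h : nat -> A) : A :=
  \sum_(k < l.+1) surjn A l k * fdiff h k 0.

Lemma newton_sumS (A : comNzRingType) (l : nat) (h : nat -> A) :
  newton_sum l.+1 h = newton_sum l (fun j => j.+1%:R * (h j.+1 - h j)).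
Proof.
rewrite /newton_sum big_ord_recl surjnS0 mul0r add0r.
under eq_bigr do rewrite lift0 surjnSS [X in X * _]mulrDr mulrDl.
rewrite big_split /= addrC.
(* Shift of the summation index: the new top term contains [surjn A l l.+1 = 0], the new bottom term
   a factor 0. *)
have -> : \sum_(i < l.+1) i.+1%:R * surjn A l i.+1 * (fdiff h i 1 - fdiff h i 0) =
          \sum_(i < l.+1) i%:R * surjn A l i * fdiff h i 0.
  rewrite big_ord_recr /= surjn_small// mulr0 mul0r addr0.
  by rewrite [RHS]big_ord_recl mul0r mul0r add0r; apply: eq_bigr => i _.
rewrite -big_split; apply: eq_bigr => i _ /=.
rewrite [in RHS](@eq_fdiff _ _ (fun j => j%:R * (h j.+1 - h j) + (h j.+1 - h j))); last first.
  by move=> j; rewrite -natr1 mulrDl mul1r.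
rewrite fdiffD fdiff_natM mul0r add0r !fdiff_diff.
case: (nat_of_ord i) => [|k] /=; rewrite ?fdiff_diff; [|rewrite /= -[k.+2%:R]natr1]; ring.
Qed.

(** * Permutations with constraints on the positions of excedances *)

(** [tau] marks the unconstrained positions. It is a predicate on [nat], so that the same one serves
    every n in the recursion. *)
Definition below_count (tau : nat -> bool) (n : nat) : nat :=
  #|[set s : 'S_n | [forall i : 'I_n, tau i || (s i <= i)%N]]|.

(** The pair (i, s) records the position i of the largest value; exchanging the entries at i and at
    the last position and then dropping the last leaves s. Injectivity suffices, both sides having
    (n + 1)! elements. *)
Lemma perm_lift_bij (n : nat) :
  bijective (fun u : 'I_n.+1 * 'S_n =>
    (tperm u.1 ord_max * lift_perm ord_max ord_max u.2)%g).
Proof.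
apply: inj_card_bij; last first.
  by rewrite card_prod !card_Sn card_ord factS.
move=> [i s] [j t] /= E.
have ij : i = j.
  have : (tperm i ord_max * lift_perm ord_max ord_max s)%g i = ord_max.
    by rewrite permM tpermL lift_perm_id.
  rewrite E permM.
  rewrite -[X in _ = X -> _](lift_perm_id ord_max ord_max t) => /perm_inj.
  by move=> /(canRL (tpermK _ _)); rewrite tpermR.
subst j; congr pair; move/mulgI : E => E.
apply/permP => k; apply: (@lift_inj _ ord_max).
by rewrite -!(lift_perm_lift ord_max) E.
Qed.

(** The largest value can only stand last or at a free position. Removing it moves the last entry to
    its place, where nothing is required, and the constraint at the last position is vacuous. *)
Lemma below_countS (tau : nat -> bool) (n : nat) :
  below_count tau n.+1 = ((count tau (iota 0 n)).+1 * below_count tau n)%N.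
Proof.
rewrite /below_count -sum1_card (reindex _ (onW_bij _ (perm_lift_bij n))) /=.
have P (i : 'I_n.+1) (s : 'S_n) :
    [forall j : 'I_n.+1, tau j || ((tperm i ord_max * lift_perm ord_max ord_max s)%g j <= j)%N]
    = ((i == ord_max) || tau i) && [forall j : 'I_n, tau j || (s j <= j)%N].
  apply/forallP/andP => [H|[H1 /forallP H2] j].
    split.
      have [//|ni] := eqVneq i ord_max; have := H i.
      rewrite permM tpermL lift_perm_id /= => /orP[->//|].
      by move=> ni'; case/eqP: ni; apply/val_inj/eqP; rewrite eqn_leq -ltnS ltn_ord.
    apply/forallP => j; have := H (lift ord_max j).
    rewrite permM lift_max; have [ij|ij] := eqVneq (lift ord_max j) i.
      move=> _; have := H i; rewrite permM tpermL lift_perm_id /= -ij lift_max.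
      by rewrite leqNgt ltn_ord orbF => ->.
    by rewrite tpermD ?neq_lift ?[i == _]eq_sym // lift_perm_lift lift_max.
  case: (unliftP ord_max j) => [k|] -> ; last first.
    by rewrite -ltnS ltn_ord orbT.
  rewrite permM lift_max; have [ij|ij] := eqVneq (lift ord_max k) i.
    by move: H1; rewrite -ij eq_sym (negPf (neq_lift _ _)) orFb lift_max => ->.
  by rewrite tpermD ?neq_lift ?[i == _]eq_sym // lift_perm_lift lift_max.
under eq_bigl do rewrite inE P.
rewrite -(pair_big (fun i : 'I_n.+1 => (i == ord_max) || tau i)
  (fun s : 'S_n => [forall j : 'I_n, tau j || (s j <= j)%N]) (fun _ _ => 1%N)) /=.
rewrite sum_nat_const cardsE sum1_card; congr (_ * _)%N.
rewrite -sum1_card big_mkcond big_ord_recr /= unfold_in /= eqxx addn1; congr _.+1.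
rewrite -sum1_count -[n in iota 0 n]subn0 -/(index_iota 0 n) big_mkord [RHS]big_mkcond.
apply: eq_bigr => j _; rewrite unfold_in /=.
suff -> : (widen_ord (leqnSn n) j == ord_max) = false by [].
by apply/negbTE; rewrite -val_eqE /= neq_ltn ltn_ord.
Qed.

Lemma below_countE (tau : nat -> bool) (n : nat) :
  below_count tau n = (\prod_(i < n) (count tau (iota 0 i)).+1)%N.
Proof.
elim: n => [|n IH]; last by rewrite below_countS IH big_ord_recr mulnC.
rewrite big_ord0 /below_count; apply/eqP/cards1P; exists 1%g.
by apply/setP => s; rewrite !inE [s]permS0 eqxx; apply/forallP => -[].
Qed.

(** Interpolates between [below_count], at l = 0, and [ba_count p q], at l = p with [tau] false. *)
Definition exc_count (l : nat) (tau : nat -> bool) (n : nat) : nat :=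
  #|[set s : 'S_n | [forall i : 'I_n,
      if (i < l)%N then (i < s i)%N else tau i || (s i <= i)%N]]|.

(** One step of inclusion-exclusion: if position l is free, its entry either exceeds l or does
    not. *)
Lemma exc_countS (l : nat) (tau : nat -> bool) (n : nat) : (l < n)%N ->
  (exc_count l.+1 tau n + exc_count l (fun i => if i == l then false else tau i) n =
   exc_count l (fun i => if i == l then true else tau i) n)%N.
Proof.
move=> ln; pose i0 := Ordinal ln.
have D1 (F : 'I_n -> bool) :
    [forall i, F i] = F i0 && [forall i, (i != i0) ==> F i].
  apply/forallP/andP => [H|[H0 /forallP H] i]; last first.
    by have [->//|ni] := eqVneq i i0; move/implyP: (H i); apply.
  by split=> //; apply/forallP => i; apply/implyP.
rewrite /exc_count -!sum1_card [X in (X + _)%N]big_mkcond [X in (_ + X)%N]big_mkcond.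
rewrite [RHS]big_mkcond -big_split.
pose G (s : 'S_n) := [forall i : 'I_n, (i != i0) ==>
  (if (i < l)%N then (i < s i)%N else tau i || (s i <= i)%N)].
have nl (i : 'I_n) : i != i0 -> (i == l :> nat) = false.
  by move=> ni; apply/negbTE; move: ni; rewrite -val_eqE.
have E1 (s : 'S_n) : [forall i : 'I_n,
    if (i < l.+1)%N then (i < s i)%N else tau i || (s i <= i)%N] = (l < s i0)%N && G s.
  rewrite D1 /= ltnSn; congr (_ && _); apply: eq_forallb => i.
  by have [//|/nl ni] := eqVneq i i0; rewrite ltnS leq_eqVlt ni.
have E2 (s : 'S_n) : [forall i : 'I_n, if (i < l)%N then (i < s i)%N else
    (if i == l :> nat then false else tau i) || (s i <= i)%N] = (s i0 <= l)%N && G s.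
  rewrite D1 /= ltnn eqxx; congr (_ && _); apply: eq_forallb => i.
  by have [//|/nl ni] := eqVneq i i0; rewrite ni.
have E3 (s : 'S_n) : [forall i : 'I_n, if (i < l)%N then (i < s i)%N else
    (if i == l :> nat then true else tau i) || (s i <= i)%N] = G s.
  rewrite D1 /= ltnn eqxx /=; apply: eq_forallb => i.
  by have [//|/nl ni] := eqVneq i i0; rewrite ni.
apply: eq_bigr => s _; rewrite !inE E1 E2 E3.
by case: (G s); rewrite ?andbF// !andbT ltnNge; case: (s i0 <= l)%N.
Qed.

(** The argument k of the product counts the free positions among the first l. An excedance at l is
    the case l free minus the case l bound: both products have the factor k + 1 at i = l, and the
    later factors see k + 1 and k free positions respectively. This is the operator behind
    [newton_sum]. *)
Lemma exc_countE (A : comNzRingType) (l : nat) (tau : nat -> bool) (n : nat) :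
  (l <= n)%N ->
  (exc_count l tau n)%:R = newton_sum l
    (fun k => \prod_(l <= i < n) (k + count tau (iota l (i - l))).+1%:R) :> A.
Proof.
elim: l tau => [|l IH] tau ln.
  rewrite (_ : exc_count 0 tau n = below_count tau n) // below_countE.
  rewrite /newton_sum big_ord1 surjn0 mul1r /=.
  rewrite big_mkord natr_prod; apply: eq_bigr => i _.
  by rewrite add0n subn0.
rewrite newton_sumS.
have /(congr1 (fun m => m%:R : A)) := exc_countS tau ln.
rewrite natrD => /(canRL (addrK _)) ->.
rewrite !IH 1?ltnW// /newton_sum -sumrB; apply: eq_bigr => k _.
rewrite -mulrBr; congr (_ * _).
rewrite -fdiffB; apply: eq_fdiff => j.
have cnt (b : bool) (i : nat) : (l < i)%N ->
    count (fun i => if i == l then b else tau i) (iota l (i - l)) =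
    (b + count tau (iota l.+1 (i - l.+1)))%N.
  move=> li; rewrite -[(i - l)%N]prednK ?subn_gt0// -subnS /= eqxx; congr addn.
  by apply: eq_in_count => m; rewrite mem_iota => /andP[lm _]; rewrite gtn_eqF.
have prodE (b : bool) : \prod_(l <= i < n)
    (j + count (fun i => if i == l then b else tau i) (iota l (i - l))).+1%:R =
    j.+1%:R * \prod_(l.+1 <= i < n) ((j + b) + count tau (iota l.+1 (i - l.+1))).+1%:R :> A.
  rewrite big_ltn// subnn /= addn0; congr (_ * _).
  by apply: eq_big_nat => i /andP[li _]; rewrite cnt// addnA.
rewrite (prodE true) (prodE false) -mulrBr; congr (_ * (_ - _));
  by apply: eq_bigr => i _; rewrite ?addn1 ?addn0.
Qed.

Lemma ba_countE (A : comNzRingType) (p q : nat) :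
  (ba_count p q)%:R =
  \sum_(k < p.+1) surjn A p k * fdiff (fun j => j%:R ^+ q.+1) k 1.
Proof.
have -> : ba_count p q = exc_count p (fun=> false) (p + q).+1.
  apply: eq_card => s; rewrite !inE; apply: eq_forallb => i.
  have [_|] := ltnP i.+1 (p + q).+1 => /=.
    by case: (ltnP i p) => _; rewrite ?eqb_id // eqbF_neg -leqNgt.
  (* At the last position, on which [ba_count] imposes nothing, [s i <= i] holds for every
     permutation. *)
  rewrite ltnS => pqi; have pi := leq_trans (leq_addr q p) pqi.
  by rewrite ltnNge pi /= (leq_trans _ pqi)// -ltnS ltn_ord.
rewrite exc_countE; last by rewrite leqW// leq_addr.
(* The product at j is (j + 1)^(q + 1), hence differences of a pure power taken at 1 rather than at
   0. *)
apply: eq_bigr => k _; congr (_ * _); rewrite -fdiff_shift; apply: eq_fdiff => j.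
under eq_bigr => i _ do rewrite (_ : count _ _ = 0%N) ?addn0 ?count_pred0//.
by rewrite prodr_const_nat -addnS addKn.
Qed.

From mathcomp Require Import complex.
Import numFieldNormedType.Exports.
Local Open Scope classical_set_scope.
Local Open Scope complex_scope.

(** * Continuity of composite real functions *)

Section ContinuousFun.
Context {R : realType}.
Implicit Types f g : R -> R.

Lemma cont_cst (c : R) : continuous (fun _ : R => c).
Proof. by move=> t; exact: cvg_cst. Qed.

Lemma cont_id : continuous (fun t : R => t).
Proof. by move=> t; exact: cvg_id. Qed.

Lemma contD f g : continuous f -> continuous g -> continuous (fun t => f t + g t).
Proof. by move=> cf cg t; apply: cvgD; [exact: cf|exact: cg]. Qed.

Lemma contN f : continuous f -> continuous (fun t => - f t).
Proof. by move=> cf t; apply: cvgN; exact: cf. Qed.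

Lemma contM f g : continuous f -> continuous g -> continuous (fun t => f t * g t).
Proof. by move=> cf cg t; apply: cvgM; [exact: cf|exact: cg]. Qed.

Lemma contX f n : continuous f -> continuous (fun t => f t ^+ n).
Proof.
move=> cf; elim: n => [|n IH]; first exact: cont_cst.
by under eq_fun do rewrite exprS; apply: contM.
Qed.

Lemma cont_norm f : continuous f -> continuous (fun t => `|f t|).
Proof. by move=> cf t; apply: cvg_norm; exact: cf. Qed.

Lemma cont_comp (h : R -> R) f : continuous h -> continuous f ->
  continuous (fun t => h (f t)).
Proof. by move=> ch cf t; apply: (continuous_comp (cf t)); exact: ch. Qed.

Lemma is_derive_continuous f (f' : R -> R) :
  (forall t : R, is_derive t (1 : R) f (f' t)) -> continuous f.
Proof.
by move=> df t; apply: differentiable_continuous; apply/derivable1_diffP; case: (df t).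
Qed.

End ContinuousFun.

Ltac cont :=
  lazymatch goal with
  | |- continuous (fun _ => ?c) => exact: cont_cst
  | |- continuous (fun x => x) => exact: cont_id
  | |- continuous (fun x => - (@?f x)) => apply: (@contN _ f); cont
  | |- continuous (fun x => @?f x + @?g x) => apply: (@contD _ f g); cont
  | |- continuous (fun x => @?f x * @?g x) => apply: (@contM _ f g); cont
  | |- continuous (fun x => @?f x ^+ ?n) => apply: (@contX _ f n); cont
  | |- continuous (fun x => `|@?f x|) => apply: (@cont_norm _ f); cont
  | |- continuous (fun x => cos (@?f x)) =>
      apply: (@cont_comp _ _ f (@continuous_cos _)); cont
  | |- continuous (fun x => sin (@?f x)) =>
      apply: (@cont_comp _ _ f (@continuous_sin _)); cont
  | |- continuous (fun x => expR (@?f x)) =>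
      apply: (@cont_comp _ _ f (@continuous_expR _)); cont
  | |- _ => try assumption
  end.

(** * Integrals over the circle *)

Section IntegralPi.
Context {R : realType}.
Implicit Types f g : R -> R.

Definition intpi f : R := (\int[@lebesgue_measure R]_(t in `[(- pi)%R, pi]) f t)%R.

Lemma integrable_pi f : continuous f ->
  (@lebesgue_measure R).-integrable `[(- pi)%R, pi] (EFin \o f).
Proof.
move=> cf; apply: continuous_compact_integrable; first exact: segment_compact.
exact: continuous_subspaceT.
Qed.

Lemma intpiD f g : continuous f -> continuous g ->
  intpi (fun t => f t + g t) = intpi f + intpi g.
Proof. by move=> cf cg; apply: RintegralD => //; exact: integrable_pi. Qed.

Lemma intpiB f g : continuous f -> continuous g ->
  intpi (fun t => f t - g t) = intpi f - intpi g.
Proof. by move=> cf cg; apply: RintegralB => //; exact: integrable_pi. Qed.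

Lemma intpiZ (a : R) f : continuous f -> intpi (fun t => a * f t) = a * intpi f.
Proof. by move=> cf; apply: RintegralZl => //; exact: integrable_pi. Qed.

Lemma le_intpi f g : continuous f -> continuous g ->
  (forall t, - pi <= t <= pi -> f t <= g t) -> intpi f <= intpi g.
Proof.
move=> cf cg fg.
rewrite /intpi; apply: (le_Rintegral _ (integrable_pi cf) (integrable_pi cg)) => //.
Qed.

Lemma eq_intpi f g : (forall t, f t = g t) -> intpi f = intpi g.
Proof. by move=> fg; congr intpi; apply/funext. Qed.

Lemma norm_intpi_le f g : continuous f -> continuous g ->
  (forall t, - pi <= t <= pi -> `|f t| <= g t) -> `|intpi f| <= intpi g.
Proof.
move=> cf cg fg; rewrite ler_norml -mulN1r -intpiZ//.
apply/andP; split; apply: le_intpi => //.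
- by cont.
- by move=> t /fg; rewrite ler_norml mulN1r => /andP[].
- by move=> t /fg; rewrite ler_norml => /andP[].
Qed.

Lemma intpi_FTC (F f : R -> R) : continuous f ->
  (forall t : R, is_derive t (1 : R) F (f t)) -> intpi f = F pi - F (- pi).
Proof.
move=> cf dF; rewrite /intpi /Rintegral (@continuous_FTC2 _ f F) //.
- have := pi_gt0 R; lra.
- exact: continuous_subspaceT.
- have cF := is_derive_continuous dF.
  split; [by move=> t _; have [] := dF t|apply: cvg_at_right_filter; exact: cF|
    apply: cvg_at_left_filter; exact: cF].
- by move=> t _; rewrite derive1E; have [] := dF t.
Qed.

Lemma intpi_cst (c : R) : intpi (fun=> c) = (pi *+ 2) * c.
Proof.
have dF (t : R) : is_derive t (1 : R) (fun t => c * t) c.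
  by apply: is_derive_eq; rewrite /GRing.scale/=; ring.
rewrite (intpi_FTC _ dF); last by cont.
by rewrite mulr2n; ring.
Qed.

End IntegralPi.

(* Opaque to type class search, unlike [is_derive]. *)
Definition has_deriv (R : realType) (f : R -> R) (t a : R) : Prop := is_derive t (1 : R) f a.

(** * Derivatives and mean value estimates *)

Section Derivatives.
Context {R : realType}.
Implicit Types (f g : R -> R) (t a b : R).
Notation deriv := (@has_deriv R).

Lemma der_cst (c : R) t : deriv (fun=> c) t 0.
Proof. exact: is_derive_cst. Qed.

Lemma der_id t : deriv (fun x => x) t 1.
Proof. exact: is_derive_id. Qed.

Lemma derD f g t a b : deriv f t a -> deriv g t b -> deriv (fun x => f x + g x) t (a + b).
Proof. by move=> df dg; apply: is_deriveD. Qed.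

Lemma derN f t a : deriv f t a -> deriv (fun x => - f x) t (- a).
Proof. by move=> df; apply: is_deriveN. Qed.

Lemma derM f g t a b : deriv f t a -> deriv g t b ->
  deriv (fun x => f x * g x) t (a * g t + f t * b).
Proof.
move=> df dg; apply: is_derive_eq; first exact: is_deriveM df dg.
by rewrite /GRing.scale/= addrC [g t * a]mulrC.
Qed.

Lemma der_comp (h : R -> R) f t a b : deriv h (f t) b -> deriv f t a ->
  deriv (fun x => h (f x)) t (b * a).
Proof. by move=> dh df; apply: (@is_derive1_comp _ h f). Qed.

Lemma der_eq f t a b : deriv f t a -> a = b -> deriv f t b.
Proof. by move=> ? <-. Qed.

Lemma derX f n t a : deriv f t a ->
  deriv (fun x => f x ^+ n.+1) t (n.+1%:R * f t ^+ n * a).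
Proof.
move=> df; elim: n => [|n IH].
  by apply: der_eq; [exact: df|rewrite expr0; ring].
under eq_fun do rewrite exprS.
by apply: der_eq; [exact: derM df IH|rewrite -[n.+2%:R]natr1 !exprS; ring].
Qed.

Lemma derV f t a : f t != 0 -> deriv f t a -> deriv (fun x => (f x)^-1) t (- a / f t ^+ 2).
Proof.
move=> ft df; apply: (is_derive_eq (is_deriveV ft df)).
by rewrite /GRing.scale /= !mulNr mulrC.
Qed.

Lemma der_ln f t a : 0 < f t -> deriv f t a -> deriv (fun x => ln (f x)) t (a / f t).
Proof.
by move=> ft df; rewrite mulrC; apply: der_comp df; apply: is_derive1_ln.
Qed.

Lemma der_expR f t a : deriv f t a -> deriv (fun x => expR (f x)) t (expR (f t) * a).
Proof. by apply: der_comp; exact: is_derive_expR. Qed.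

Lemma der_cos f t a : deriv f t a -> deriv (fun x => cos (f x)) t (- sin (f t) * a).
Proof. by apply: der_comp; exact: is_derive_cos. Qed.

Lemma der_sin f t a : deriv f t a -> deriv (fun x => sin (f x)) t (cos (f t) * a).
Proof. by apply: der_comp; exact: is_derive_sin. Qed.

Lemma mean_value f (f' : R -> R) a b : a <= b ->
  (forall x, a <= x <= b -> deriv f x (f' x)) ->
  exists2 c, a <= c <= b & f b - f a = f' c * (b - a).
Proof.
move=> ab df; have [|c|c] := MVT_segment ab (df := f') (f := f).
- by move=> x; rewrite in_itv/= => /andP[ax xb]; apply: df; rewrite !ltW.
- apply: continuous_in_subspaceT => x; rewrite inE/= in_itv/= => /df dx.
  by apply: differentiable_continuous; apply/derivable1_diffP; case: dx.
- by rewrite in_itv/= => cab fab; exists c.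
Qed.

Lemma mean_value_norm f (f' : R -> R) (a b M : R) :
  (forall x, `|x - a| <= `|b - a| -> deriv f x (f' x)) ->
  (forall x, `|x - a| <= `|b - a| -> `|f' x| <= M) ->
  `|f b - f a| <= M * `|b - a|.
Proof.
move=> df fM; have [ab|ba] := leP a b.
  have [||c /andP[ac cb] ->] := @mean_value f f' a b => //.
    by move=> x /andP[ax xb]; apply: df; rewrite !ger0_norm ?subr_ge0//; lra.
  rewrite normrM ler_wpM2r//; apply: fM.
  by rewrite !ger0_norm ?subr_ge0//; lra.
have [||c /andP[ac cb] E] := @mean_value f f' b a.
- exact: ltW.
- by move=> x /andP[ax xb]; apply: df; rewrite !ler0_norm ?subr_le0//; lra.
rewrite distrC [`|b - a|]distrC E normrM ler_wpM2r//; apply: fM.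
by rewrite !ler0_norm ?subr_le0//; lra.
Qed.

(** Raises the order of a Taylor bound by one. Iterated, it gives remainder bounds with cruder
    constants than the factorials, which do not matter here. *)
Lemma mean_value_pow f (f' : R -> R) (M B : R) n : 0 <= M -> f 0 = 0 ->
  (forall t, deriv f t (f' t)) ->
  (forall t, `|t| <= B -> `|f' t| <= M * `|t| ^+ n) ->
  forall t, `|t| <= B -> `|f t| <= M * `|t| ^+ n.+1.
Proof.
move=> M0 f0 df fM t tB; rewrite -[f t]subr0 -f0 exprSr mulrA.
rewrite -[X in _ <= _ * `|X|]subr0; apply: (@mean_value_norm _ f') => // x; rewrite !subr0 => xt.
apply: le_trans (fM _ (le_trans xt tB)) _.
by rewrite ler_wpM2l// lerXn2r ?nnegrE.
Qed.

End Derivatives.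

Ltac der :=
  lazymatch goal with
  | |- has_deriv (fun _ => ?c) _ _ => exact: der_cst
  | |- has_deriv (fun x => x) _ _ => exact: der_id
  | |- has_deriv (fun x => - (@?f x)) _ _ => apply: (@derN _ f); der
  | |- has_deriv (fun x => @?f x + @?g x) _ _ => apply: (@derD _ f g); der
  | |- has_deriv (fun x => @?f x * @?g x) _ _ => apply: (@derM _ f g); der
  | |- has_deriv (fun x => @?f x ^+ (S ?n)) _ _ => apply: (@derX _ f n); der
  | |- has_deriv (fun x => @?f x ^-1) _ _ => apply: (@derV _ f); [|der]
  | |- has_deriv (fun x => cos (@?f x)) _ _ => apply: (@der_cos _ f); der
  | |- has_deriv (fun x => sin (@?f x)) _ _ => apply: (@der_sin _ f); der
  | |- has_deriv (fun x => expR (@?f x)) _ _ => apply: (@der_expR _ f); der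
  | |- has_deriv (fun x => ln (@?f x)) _ _ => apply: (@der_ln _ f); [|der]
  | |- _ => try eassumption
  end.

Ltac der_to := apply: der_eq; [der | rewrite /=].

(** * Taylor remainders of cos, sin and exp *)

Section Taylor.
Context {R : realType}.
Implicit Types t B : R.

Lemma norm_cosB1_le t : `|cos t - 1| <= `|t|.
Proof.
rewrite -[X in `|_ - X|]cos0.
rewrite -[X in _ <= X]mul1r -[X in _ <= _ * `|X|]subr0.
apply: (@mean_value_norm _ cos (fun t => - sin t)) => x _; last by rewrite normrN sin_max.
exact: is_derive_cos.
Qed.

Lemma norm_sin_le t : `|sin t| <= `|t|.
Proof.
rewrite -[sin t]subr0 -[X in `|_ - X|]sin0 -[X in _ <= X]mul1r -[X in _ <= _ * `|X|]subr0.
apply: (@mean_value_norm _ sin cos) => x _; last by rewrite cos_max.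
exact: is_derive_sin.
Qed.

Lemma norm_sin1_le t : `|sin t - t| <= `|t| ^+ 2.
Proof.
rewrite -[_ ^+ 2]mul1r.
apply: (@mean_value_pow _ (fun t => sin t - t) (fun t => cos t - 1) 1 `|t| 1) => //.
- by rewrite sin0 subr0.
- by move=> x; der_to; ring.
- by move=> x _; rewrite mul1r norm_cosB1_le.
Qed.

Lemma norm_cos2_le t : `|cos t - 1 + t ^+ 2 / 2| <= `|t| ^+ 3.
Proof.
rewrite -[_ ^+ 3]mul1r.
apply: (@mean_value_pow _ (fun t => cos t - 1 + t ^+ 2 / 2) (fun t => t - sin t) 1 `|t| 2) => //.
- by rewrite cos0 subrr expr0n mul0r addr0.
- by move=> x; der_to; field.
- by move=> x _; rewrite mul1r distrC norm_sin1_le.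
Qed.

Lemma norm_cos1_le t : `|cos t - 1| <= `|t| ^+ 2.
Proof.
rewrite -[_ ^+ 2]mul1r.
apply: (@mean_value_pow _ (fun t => cos t - 1) (fun t => - sin t) 1 `|t| 1) => //.
- by rewrite cos0 subrr.
- by move=> x; der_to; ring.
- by move=> x _; rewrite mul1r normrN norm_sin_le.
Qed.

Lemma norm_sin3_le t : `|sin t - t| <= `|t| ^+ 3.
Proof.
rewrite -[_ ^+ 3]mul1r.
apply: (@mean_value_pow _ (fun t => sin t - t) (fun t => cos t - 1) 1 `|t| 2) => //.
- by rewrite sin0 subr0.
- by move=> x; der_to; ring.
- by move=> x _; rewrite mul1r norm_cos1_le.
Qed.

Lemma norm_expR1_le B t : `|t| <= B -> `|expR t - 1| <= expR B * `|t|.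
Proof.
move=> tB; rewrite -[`|t|]expr1.
apply: (@mean_value_pow _ (fun t => expR t - 1) expR (expR B) B 0) => //.
- by rewrite expR0 subrr.
- by move=> x; der_to; ring.
- by move=> x xB; rewrite expr0 mulr1 ger0_norm ?expR_ge0// ler_expR (le_trans (ler_norm _)).
Qed.

Lemma norm_expR2_le B t : `|t| <= B -> `|expR t - 1 - t| <= expR B * `|t| ^+ 2.
Proof.
apply: (@mean_value_pow _ (fun t => expR t - 1 - t) (fun t => expR t - 1) (expR B) B 1).
- by rewrite expR_ge0.
- by rewrite expR0 subrr subr0.
- by move=> x; der_to; ring.
- by move=> x xB; rewrite expr1 norm_expR1_le.
Qed.

Lemma norm_expR3_le B t : `|t| <= B ->
  `|expR t - 1 - t - t ^+ 2 / 2| <= expR B * `|t| ^+ 3.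
Proof.
apply: (@mean_value_pow _ (fun t => expR t - 1 - t - t ^+ 2 / 2) (fun t => expR t - 1 - t) (expR B) B 2).
- by rewrite expR_ge0.
- by rewrite expR0 expr0n /=; ring.
- by move=> x; der_to; field.
- exact: norm_expR2_le.
Qed.

End Taylor.

(** * The complex exponential and its Taylor remainders *)

Section ComplexExp.
Context {R : realType}.
Implicit Types (z w : R[i]) (a b B t : R).
Import Normc.

Definition cexp z : R[i] := (expR (Re z) * cos (Im z)) +i* (expR (Re z) * sin (Im z)).

Lemma cexpD z w : cexp (z + w) = cexp z * cexp w.
Proof.
case: z w => [a b] [c d]; apply/eqP; rewrite eq_complex /= expRD cosD sinD.
by apply/andP; split; apply/eqP; ring.
Qed.

Lemma cexp0 : cexp 0 = 1.
Proof. by rewrite /cexp /= expR0 cos0 sin0 mulr0 mulr1. Qed.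

Lemma cexpMn z n : cexp (z *+ n) = cexp z ^+ n.
Proof.
by elim: n => [|n IH]; rewrite ?mulr0n ?cexp0 ?expr0// mulrS exprS cexpD IH.
Qed.

Lemma normcX z n : normc (z ^+ n) = normc z ^+ n.
Proof. by elim: n => [|n IH]; rewrite ?expr0 ?normc1// !exprS normcM IH. Qed.

Lemma normc_ge0 z : 0 <= normc z.
Proof. by case: z => a b; exact: sqrtr_ge0. Qed.

Lemma normc_Re z : `|Re z| <= normc z.
Proof. by case: z => a b /=; rewrite -sqrtr_sqr ler_sqrt ?addr_ge0 ?sqr_ge0// lerDl sqr_ge0. Qed.

Lemma normc_Im z : `|Im z| <= normc z.
Proof. by case: z => a b /=; rewrite -sqrtr_sqr ler_sqrt ?addr_ge0 ?sqr_ge0// lerDr sqr_ge0. Qed.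

Lemma sqr_normc z : normc z ^+ 2 = Re z ^+ 2 + Im z ^+ 2.
Proof. by case: z => a b /=; rewrite sqr_sqrtr// addr_ge0 ?sqr_ge0. Qed.

Lemma normc_le_ReIm z : normc z <= `|Re z| + `|Im z|.
Proof.
rewrite -(@ler_pXn2r _ 2)// ?nnegrE ?addr_ge0 ?normc_ge0//.
rewrite sqr_normc sqrrD !real_normK ?num_real// lerD2r lerDl.
by rewrite mulrn_wge0// mulr_ge0.
Qed.

Lemma normc_realC a : normc (a%:C) = `|a|.
Proof. by rewrite /= expr0n addr0 sqrtr_sqr. Qed.

Lemma normc_cexp z : normc (cexp z) = expR (Re z).
Proof.
rewrite /cexp /= !exprMn -mulrDr cos2Dsin2 mulr1 sqrtr_sqr ger0_norm//.
Qed.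

Lemma ReB z w : Re (z - w) = Re z - Re w. Proof. by case: z w => [? ?] [? ?]. Qed.
Lemma ImB z w : Im (z - w) = Im z - Im w. Proof. by case: z w => [? ?] [? ?]. Qed.
Lemma ReD z w : Re (z + w) = Re z + Re w. Proof. by case: z w => [? ?] [? ?]. Qed.
Lemma ImD z w : Im (z + w) = Im z + Im w. Proof. by case: z w => [? ?] [? ?]. Qed.
Lemma ReM z w : Re (z * w) = Re z * Re w - Im z * Im w.
Proof. by case: z w => [? ?] [? ?]. Qed.
Lemma ImM z w : Im (z * w) = Re z * Im w + Im z * Re w.
Proof. by case: z w => [? ?] [? ?]. Qed.

Lemma normc_cexp1_le z B : normc z <= B ->
  normc (cexp z - 1) <= 3 * expR B * normc z.
Proof.
move=> zB; apply: le_trans (normc_le_ReIm _) _; rewrite ReB ImB /= subr0.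
case: z zB => a b; set n := normc _ => nB /=.
have an : `|a| <= n by apply: (normc_Re (a +i* b)).
have bn : `|b| <= n by apply: (normc_Im (a +i* b)).
have aB := le_trans an nB; have e0 := expR_gt0 B.
have ea : expR a <= expR B by rewrite ler_expR (le_trans (ler_norm _)).
have h1 : `|expR a * (cos b - 1)| <= expR B * n.
  by rewrite normrM ler_pM// ?(ger0_norm (expR_ge0 _))// (le_trans (norm_cosB1_le _)).
have h2 : `|expR a - 1| <= expR B * n.
  by apply: le_trans (norm_expR1_le aB) _; rewrite ler_pM2l.
have h3 : `|expR a * sin b| <= expR B * n.
  by rewrite normrM ler_pM// ?(ger0_norm (expR_ge0 _))// (le_trans (norm_sin_le _)).
rewrite (_ : _ - 1 = expR a * (cos b - 1) + (expR a - 1)); last by ring.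
by have := ler_normD (expR a * (cos b - 1)) (expR a - 1); lra.
Qed.

Lemma normc_cexp2_le z B : normc z <= B ->
  normc (cexp z - 1 - z) <= 4 * expR B * normc z ^+ 2.
Proof.
move=> zB; apply: le_trans (normc_le_ReIm _) _; rewrite !ReB !ImB /= subr0.
case: z zB => a b; set n := normc _ => nB /=.
have an : `|a| <= n by apply: (normc_Re (a +i* b)).
have bn : `|b| <= n by apply: (normc_Im (a +i* b)).
have aB := le_trans an nB; have e0 := expR_gt0 B.
have a2 : `|a| ^+ 2 <= n ^+ 2 by apply: lerXn2r; rewrite ?nnegrE ?normc_ge0.
have b2 : `|b| ^+ 2 <= n ^+ 2 by apply: lerXn2r; rewrite ?nnegrE ?normc_ge0.
have ea : expR a <= expR B by rewrite ler_expR (le_trans (ler_norm _)).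
have h1 : `|expR a * (cos b - 1)| <= expR B * n ^+ 2.
  by rewrite normrM ler_pM// ?(ger0_norm (expR_ge0 _))// (le_trans (norm_cos1_le _)).
have h2 : `|expR a - 1 - a| <= expR B * n ^+ 2.
  by apply: le_trans (norm_expR2_le aB) _; rewrite ler_pM2l.
have h3 : `|expR a * (sin b - b)| <= expR B * n ^+ 2.
  by rewrite normrM ler_pM// ?(ger0_norm (expR_ge0 _))// (le_trans (norm_sin1_le _)).
have h4 : `|(expR a - 1) * b| <= expR B * n ^+ 2.
  rewrite normrM expr2 mulrA ler_pM//.
  by apply: le_trans (norm_expR1_le aB) _; rewrite ler_pM2l.
rewrite (_ : _ - 1 - a = expR a * (cos b - 1) + (expR a - 1 - a)); last by ring.
rewrite (_ : _ - b = expR a * (sin b - b) + (expR a - 1) * b); last by ring.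
have := ler_normD (expR a * (cos b - 1)) (expR a - 1 - a).
have := ler_normD (expR a * (sin b - b)) ((expR a - 1) * b); lra.
Qed.

Lemma normc_cexp3_le z B : normc z <= B ->
  normc (cexp z - 1 - z - z ^+ 2 / 2) <= 5 * expR B * normc z ^+ 3.
Proof.
move=> zB; apply: le_trans (normc_le_ReIm _) _.
have -> : z ^+ 2 / 2 = (2^-1)%:C * z ^+ 2 by rewrite fmorphV rmorph_nat mulrC.
rewrite !ReB !ImB expr2 !ReM !ImM /= subr0 !mul0r subr0 addr0.
case: z zB => a b; set n := normc _ => nB /=.
have an : `|a| <= n by apply: (normc_Re (a +i* b)).
have bn : `|b| <= n by apply: (normc_Im (a +i* b)).
have aB := le_trans an nB; have e0 := expR_gt0 B.
have le_pow k (c : R) : `|c| <= n -> `|c| ^+ k <= n ^+ k.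
  by move=> cn; apply: lerXn2r; rewrite ?nnegrE ?normc_ge0.
have ea : expR a <= expR B by rewrite ler_expR (le_trans (ler_norm _)).
have h1 : `|expR a * (cos b - 1 + b ^+ 2 / 2)| <= expR B * n ^+ 3.
  rewrite normrM ler_pM// ?(ger0_norm (expR_ge0 _))//.
  by apply: le_trans (norm_cos2_le _) _; exact: le_pow.
have h2 : `|expR a - 1 - a - a ^+ 2 / 2| <= expR B * n ^+ 3.
  by apply: le_trans (norm_expR3_le aB) _; rewrite ler_pM2l// le_pow.
have h3 : `|expR a * (sin b - b)| <= expR B * n ^+ 3.
  rewrite normrM ler_pM// ?(ger0_norm (expR_ge0 _))//.
  by apply: le_trans (norm_sin3_le _) _; exact: le_pow.
have h4 : `|(expR a - 1) * b ^+ 2| <= expR B * n ^+ 3.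
  rewrite normrM normrX (_ : expR B * _ = (expR B * n) * n ^+ 2); last by ring.
  rewrite ler_pM// ?exprn_ge0// ?le_pow//.
  by apply: le_trans (norm_expR1_le aB) _; rewrite ler_pM2l.
have h5 : `|(expR a - 1 - a) * b| <= expR B * n ^+ 3.
  rewrite normrM (_ : expR B * _ = (expR B * n ^+ 2) * n); last by ring.
  rewrite ler_pM//.
  by apply: le_trans (norm_expR2_le aB) _; rewrite ler_pM2l// le_pow.
(* Real and imaginary parts are regrouped into products of one-variable remainders, each of total
   order three. *)
set X := `|_|; set Y := `|_|.
have -> : X = `|expR a * (cos b - 1 + b ^+ 2 / 2) + (expR a - 1 - a - a ^+ 2 / 2)
   - (expR a - 1) * b ^+ 2 / 2| by congr `|_|; field.
have -> : Y = `|expR a * (sin b - b) + (expR a - 1 - a) * b| by congr `|_|; field.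
have := ler_normD (expR a * (sin b - b)) ((expR a - 1 - a) * b).
have := ler_normB (expR a * (cos b - 1 + b ^+ 2 / 2) + (expR a - 1 - a - a ^+ 2 / 2))
  ((expR a - 1) * b ^+ 2 / 2).
have := ler_normD (expR a * (cos b - 1 + b ^+ 2 / 2)) (expR a - 1 - a - a ^+ 2 / 2).
rewrite [`|_ / 2|]normrM [`|2^-1|]ger0_norm ?invr_ge0//.
have := mulr_ge0 (ltW e0) (exprn_ge0 3 (normc_ge0 (a +i* b))); rewrite -/n.
lra.
Qed.

End ComplexExp.

(** * Fourier coefficients of the exponential on a circle *)

Section Fourier.
Context {R : realType}.
Implicit Types (c t x : R) (m n k : nat).
Import Normc.

(** A quadratic remainder is the form of differentiability that survives integration over a
    parameter. *)
Lemma has_deriv_quad (f : R -> R) (t a M : R) :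
  (forall h, `|h| <= 1 -> `|f (t + h) - f t - h * a| <= M * h ^+ 2) ->
  has_deriv f t a.
Proof.
move=> fM.
have M0 : 0 <= M.
  by have := fM 1; rewrite normr1 expr1n mulr1 => /(_ (lexx _)); apply: le_trans.
have lim : h^-1 *: (f (h *: (1 : R) + t) - f t) @[h --> 0^'] --> a.
  apply/cvgrPdist_le => e e0; near=> h.
  have h0 : h != 0 by near: h; exact: nbhs_dnbhs_neq.
  have h1 : `|h| <= 1 by near: h; apply: dnbhs0_le.
  have hM : `|h| <= e / (M + 1).
    by near: h; apply: dnbhs0_le; rewrite divr_gt0// ltr_wpDl.
  rewrite /GRing.scale /= mulr1 [h + t]addrC distrC.
  rewrite (_ : _ - a = h^-1 * (f (t + h) - f t - h * a)); last by field.
  rewrite normrM normfV ler_pdivrMl ?normr_gt0//.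
  apply: le_trans (fM _ h1) _.
  rewrite -real_normK ?num_real// expr2 mulrCA ler_wpM2l//.
  have := ler_wpM2r (_ : 0 <= M + 1) hM; rewrite mulfVK; last by apply: lt0r_neq0; lra.
  move=> /(_ _); have := mulr_ge0 M0 (normr_ge0 h); have := normr_ge0 h.
  by move=> ? ? H; have := H (ltac:(lra)); lra.
by apply: DeriveDef; [apply/cvg_ex; exists a|apply/cvg_lim].
Unshelve. all: end_near. Qed.

(** Differentiation under the integral sign, by a uniform quadratic remainder instead of dominated
    convergence. *)
Lemma intpi_deriv (F G : R -> R -> R) (t M : R) :
  (forall s, continuous (F s)) -> continuous (G t) ->
  (forall h u, `|h| <= 1 -> - pi <= u <= pi ->
    `|F (t + h) u - F t u - h * G t u| <= M * h ^+ 2) ->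
  has_deriv (fun s => intpi (F s)) t (intpi (G t)).
Proof.
move=> cF cG FG; apply: (@has_deriv_quad _ _ _ (pi *+ 2 * M)) => h h1.
have -> : intpi (F (t + h)) - intpi (F t) - h * intpi (G t) =
    intpi (fun u => F (t + h) u - F t u - h * G t u).
  rewrite intpiB ?intpiB ?intpiZ//; first exact: (contD (cF _) (contN (cF _))).
  by apply: contM => //; exact: cont_cst.
rewrite -mulrA -intpi_cst; apply: norm_intpi_le; last by move=> u; exact: FG.
  apply: contD; first exact: (contD (cF _) (contN (cF _))).
  by apply: contN; apply: contM => //; exact: cont_cst.
exact: cont_cst.
Qed.

Lemma sin_natpi m : sin (m%:R * pi) = 0 :> R.
Proof.
elim: m => [|m IH]; first by rewrite mul0r sin0.
by rewrite -natr1 mulrDl mul1r sinD IH sinpi mul0r mulr0 addr0.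
Qed.

(** The integral of exp(c e^(it)) e^(-imt), reduced to its real part: 2 pi times the coefficient of
    z^m in exp(c z). *)
Definition fourier_exp c m : R := intpi (fun t => expR (c * cos t) * cos (c * sin t - m%:R * t)).

(** Integration by parts: the difference of the two integrands is the derivative of a function that
    vanishes at both ends. *)
Lemma fourier_expS c m : m.+1%:R * fourier_exp c m.+1 = c * fourier_exp c m.
Proof.
rewrite /fourier_exp -!intpiZ; [|by cont..].
apply/eqP; rewrite eq_sym -subr_eq0 -intpiB; [|by cont..].
have dF t : is_derive t (1 : R)
    (fun t => expR (c * cos t) * sin (c * sin t - m.+1%:R * t))
    (c * (expR (c * cos t) * cos (c * sin t - m%:R * t)) -
     m.+1%:R * (expR (c * cos t) * cos (c * sin t - m.+1%:R * t))).
  apply: der_eq; [der|rewrite /=].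
  rewrite (_ : c * sin t - m%:R * t = (c * sin t - m.+1%:R * t) + t); last first.
    by rewrite -natr1; ring.
  by rewrite (cosD (c * sin t - m.+1%:R * t) t); ring.
rewrite (intpi_FTC _ dF); last by cont.
rewrite sinN sinpi cosN oppr0 mulr0 !mulrN opprK !add0r sinN sin_natpi.
by rewrite oppr0 !mulr0 subrr.
Qed.

Lemma intpi_expcos0 c : intpi (fun t => expR (c * cos t) * cos (c * sin t + t)) = 0.
Proof.
have [->|c0] := eqVneq c 0.
  have dF t : is_derive t (1 : R) sin (expR (0 * cos t) * cos (0 * sin t + t)).
    by rewrite !mul0r expR0 mul1r add0r; exact: is_derive_sin.
  by rewrite (intpi_FTC _ dF); [rewrite sinN sinpi oppr0 subr0|cont].
apply: (mulfI c0); rewrite mulr0 -intpiZ; last by cont.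
have dF t : is_derive t (1 : R) (fun t => expR (c * cos t) * sin (c * sin t))
    (c * (expR (c * cos t) * cos (c * sin t + t))).
  by apply: der_eq; [der|rewrite /= cosD; ring].
rewrite (intpi_FTC _ dF); last by cont.
by rewrite sinN sinpi oppr0 mulr0 sin0 !mulr0 subrr.
Qed.

(** Cauchy's formula through the parameter c: the derivative in c is the coefficient of index -1,
    which is 0 by [intpi_expcos0], and at c = 0 the integrand is 1. *)
Lemma fourier_exp0 c : fourier_exp c 0 = pi *+ 2.
Proof.
rewrite -[RHS]mulr1 -intpi_cst.
have d0 s : has_deriv (fourier_exp ^~ 0) s 0.
  rewrite -(intpi_expcos0 s) /fourier_exp.
  apply: (@intpi_deriv _ (fun s t => expR (s * cos t) * cos (s * sin t + t)) s
    (expR `|s| * (4 * expR 1))).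
  - by move=> s'; cont.
  - by cont.
  move=> h u h1 _; rewrite !mul0r !subr0.
  pose w : R[i] := cos u +i* sin u.
  have nw : normc w = 1 by rewrite /= cos2Dsin2 sqrtr1.
  rewrite [X in `|X|](_ : _ = Re (cexp (s%:C * w) * (cexp (h%:C * w) - 1 - h%:C * w))).
    apply: le_trans (normc_Re _) _; rewrite normcM normc_cexp -mulrA ler_pM//.
    - exact: normc_ge0.
    - rewrite ler_expR /= mul0r subr0 (le_trans (ler_norm _))// normrM.
      by rewrite ler_piMr// cos_max.
    - apply: le_trans (@normc_cexp2_le _ _ 1 _) _.
        by rewrite normcM normc_realC nw mulr1.
      by rewrite normcM normc_realC nw mulr1 real_normK ?num_real// mulrC.
  rewrite !mulrBr mulr1 -cexpD !ReB.
  rewrite !ReM ImM /= !mul0r !subr0 !addr0 mulrDl mulrDl cosD.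
  by rewrite [cos (_ + u)]cosD; ring.
rewrite (_ : intpi _ = fourier_exp 0 0); last first.
  by apply: eq_intpi => t; rewrite !mul0r subrr cos0 expR0 mulr1.
exact: (is_derive_0_is_cst _ _ d0).
Qed.

Lemma fourier_expE c m : fourier_exp c m = pi *+ 2 * (c ^+ m / m`!%:R).
Proof.
elim: m => [|m IH]; first by rewrite fourier_exp0 expr0 divr1 mulr1.
have m0 : m.+1%:R != 0 :> R by rewrite pnatr_eq0.
apply: (mulfI m0); rewrite fourier_expS IH exprS factS natrM.
have : m`!%:R != 0 :> R by rewrite pnatr_eq0 -lt0n fact_gt0.
by move=> ?; field; apply/andP.
Qed.

End Fourier.

(** * Generating functions of finite differences on a circle *)

Section ComplexFourier.
Context {R : realType}.
Implicit Types (F G : R -> R[i]) (x t : R) (m n k p : nat).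
Import Normc.

Definition ccont F : Prop :=
  continuous (fun t => Re (F t)) /\ continuous (fun t => Im (F t)).

Lemma ccont_cst (z : R[i]) : ccont (fun=> z).
Proof. by split; exact: cont_cst. Qed.

Lemma ccontD F G : ccont F -> ccont G -> ccont (fun t => F t + G t).
Proof.
move=> [rF iF] [rG iG]; split; under eq_fun do rewrite ?ReD ?ImD; exact: contD.
Qed.

Lemma ccontB F G : ccont F -> ccont G -> ccont (fun t => F t - G t).
Proof.
move=> [rF iF] [rG iG].
by split; under eq_fun do rewrite ?ReB ?ImB; apply: contD => //; exact: contN.
Qed.

Lemma ccontM F G : ccont F -> ccont G -> ccont (fun t => F t * G t).
Proof.
move=> [rF iF] [rG iG]; split; under eq_fun do rewrite ?ReM ?ImM.
  by apply: contD; [exact: contM|apply: contN; exact: contM].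
by apply: contD; exact: contM.
Qed.

Lemma ccontX F n : ccont F -> ccont (fun t => F t ^+ n).
Proof.
move=> cF; elim: n => [|n IH]; first exact: ccont_cst.
by under eq_fun do rewrite exprS; exact: ccontM.
Qed.

Lemma ccont_cexp F : ccont F -> ccont (fun t => cexp (F t)).
Proof. by move=> [rF iF]; split; rewrite /cexp /=; cont. Qed.

Lemma ccont_pair (f g : R -> R) :
  continuous f -> continuous g -> ccont (fun t => f t +i* g t).
Proof. by []. Qed.

Lemma normc_intpi_le F (g : R -> R) : ccont F -> continuous g ->
  (forall t, - pi <= t <= pi -> normc (F t) <= g t) ->
  `|intpi (fun t => Re (F t))| <= intpi g.
Proof.
move=> [cF _] cg Fg; apply: norm_intpi_le => // t /Fg; apply: le_trans.
exact: normc_Re.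
Qed.

Definition cis t : R[i] := cos t +i* sin t.

Lemma cisE t : cis t = cexp (0 +i* t).
Proof. by rewrite /cexp /= expR0 !mul1r. Qed.

Lemma normc_cis t : normc (cis t) = 1.
Proof. by rewrite cisE normc_cexp /= expR0. Qed.

Lemma cisD (s t : R) : cis (s + t) = cis s * cis t.
Proof. by rewrite !cisE -cexpD; congr cexp; apply/eqP; rewrite eq_complex /= addr0 !eqxx. Qed.

Definition expcis x t : R[i] := cexp (x%:C * cis t).

Lemma expcisE x t : expcis x t =
  (expR (x * cos t) * cos (x * sin t)) +i* (expR (x * cos t) * sin (x * sin t)).
Proof. by rewrite /expcis /cexp /= !mul0r subr0 addr0. Qed.

Lemma normc_expcis x t : normc (expcis x t) = expR (x * cos t).
Proof. by rewrite normc_cexp /= mul0r subr0. Qed.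

Lemma ccont_cis (f : R -> R) : continuous f -> ccont (fun t => cis (f t)).
Proof. by move=> cf; apply: ccont_pair; cont. Qed.

Lemma ccont_expcis x : ccont (expcis x).
Proof. by apply: ccont_cexp; apply: ccontM; [exact: ccont_cst|apply: ccont_cis; cont]. Qed.

Lemma fourier_fdiff x p k n :
  intpi (fun t => Re (expcis x t ^+ n * (expcis x t - 1) ^+ k * cis (- (p%:R * t)))) =
  pi *+ 2 * (x ^+ p / p`!%:R) * fdiff (fun j => j%:R ^+ p) k n.
Proof.
elim: k n => [|k IH] n /=.
  transitivity (fourier_exp (n%:R * x) p); last first.
    by rewrite fourier_expE exprMn -!mulrA; congr (_ * _); rewrite [RHS]mulrA mulrC.
  apply: eq_intpi => t; rewrite expr0 mulr1 /expcis -cexpMn [cis (- _)]cisE -cexpD.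
  rewrite -[_ * cis t *+ n]mulr_natl mulrA -(rmorph_nat (real_complex R)) -rmorphM.
  by rewrite /cexp /= !mul0r !addr0 subr0.
have cc q : ccont (fun t => expcis x t ^+ q * (expcis x t - 1) ^+ k * cis (- (p%:R * t))).
  apply: ccontM; last by apply: ccont_cis; cont.
  apply: ccontM; first by apply: ccontX; exact: ccont_expcis.
  by apply: ccontX; apply: ccontB; [exact: ccont_expcis|exact: ccont_cst].
rewrite mulrBr -!IH -intpiB; [|exact: (cc _).1..].
by apply: eq_intpi => t; rewrite -ReB; congr Re; rewrite !exprS; ring.
Qed.

End ComplexFourier.

Ltac ccont :=
  lazymatch goal with
  | |- ccont (fun _ => ?c) => exact: ccont_cst
  | |- ccont (fun x => @?f x - @?g x) => apply: (@ccontB _ f g); ccont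
  | |- ccont (fun x => @?f x + @?g x) => apply: (@ccontD _ f g); ccont
  | |- ccont (fun x => @?f x * @?g x) => apply: (@ccontM _ f g); ccont
  | |- ccont (fun x => @?f x ^+ ?n) => apply: (@ccontX _ f n); ccont
  | |- ccont (fun x => cexp (@?f x)) => apply: (@ccont_cexp _ f); ccont
  | |- ccont (fun x => cis (@?f x)) => apply: (@ccont_cis _ f); cont
  | |- ccont (fun x => expcis ?a x) => exact: ccont_expcis
  | |- ccont (expcis ?a) => exact: ccont_expcis
  | |- ccont (fun x => @?f x +i* @?g x) => apply: (@ccont_pair _ f g); cont
  | |- _ => try assumption
  end.

(** * A primitive of the Gaussian *)

Section GaussPrimitive.
Context {R : realType}.
Implicit Types (t : R).
Import gauss_integral_proof.

(** A primitive with an explicit tail replaces improper integrals below. The tail bound holds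
    because E + 1/t decreases, by exp(-c^2) <= 1/c^2. *)
Lemma gauss_primitive : exists E : R -> R,
  [/\ forall t, has_deriv E t (expR (- t ^+ 2)), forall t, E (- t) = - E t &
      forall t, 0 < t -> 0 <= Num.sqrt pi / 2 - E t <= t^-1].
Proof.
pose F (t : R) : R := (\int[@lebesgue_measure R]_(u in `]-oo, t]) gauss_fun u)%R.
have dF t : has_deriv F t (expR (- t ^+ 2)).
  have itg : (@lebesgue_measure R).-integrable `]-oo, (t + 1)%R] (EFin \o @gauss_fun R).
    by apply: integrableS integrableT_gauss => //.
  have [dF F't] : derivable F t 1 /\ F^`() t = gauss_fun t.
    apply: (continuous_FTC1 _ itg); first by rewrite ltrDl.
      by rewrite ltNyr.
    exact: continuous_gauss_fun.
  by rewrite /has_deriv; split; [exact: dF|rewrite -derive1E F't].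
clearbody F.
pose E t := F t - F 0.
have dE t : has_deriv E t (expR (- t ^+ 2)).
  by apply: der_eq; [apply: derD; [exact: dF|exact: der_cst]|rewrite addr0].
have E0 : E 0 = 0 by rewrite /E subrr.
have oddE t : E (- t) = - E t.
  apply/eqP; rewrite -addr_eq0; apply/eqP.
  have d0 s : is_derive s (1 : R) (fun s => E (- s) + E s) 0.
    apply: der_eq; first by apply: derD; [apply: (@der_comp _ E); [exact: dE|apply: derN; exact: der_id]|exact: dE].
    by rewrite sqrrN; ring.
  by rewrite (is_derive_0_is_cst t 0 d0) oppr0 E0 addr0.
have homoE s t : s <= t -> E s <= E t.
  move=> st; have [c _] := @mean_value _ E _ _ _ st (fun x _ => dE x).
  by rewrite -subr_ge0 => ->; rewrite mulr_ge0 ?subr_ge0// expR_ge0.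
have tail s t : 0 < s -> s <= t -> E t - E s <= s^-1.
  move=> s0 st.
  have [||c /andP[sc ct]] := @mean_value _ (fun x => E x + x^-1)
     (fun x => expR (- x ^+ 2) - x^-2) s t => //.
    move=> x /andP[sx xt]; apply: derD; first exact: dE.
    apply: der_eq; first by apply: derV; [apply: lt0r_neq0; lra|exact: der_id].
    by rewrite mulNr mul1r.
  have c0 : 0 < c by lra.
  have ce : expR (- c ^+ 2) - c ^- 2 <= 0.
    rewrite subr_le0 expRN lef_pV2 ?posrE ?expR_gt0 ?exprn_gt0//.
    by apply: le_trans (expR_ge1Dx _); rewrite lerDr.
  move=> H; have : E t + t^-1 - (E s + s^-1) <= 0.
    by rewrite H mulr_le0_ge0// subr_ge0.
  have : 0 < t^-1 by rewrite invr_gt0; lra.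
  lra.
have EI t : 0 < t -> integral0_gauss t = E t.
  move=> t0; rewrite /integral0_gauss /Rintegral (@continuous_FTC2 _ _ E) //.
  - by rewrite E0 /= subr0.
  - by apply: continuous_subspaceT; exact: continuous_gauss_fun.
  - have cE := is_derive_continuous dE.
    split; [by move=> x _; case: (dE x)|apply: cvg_at_right_filter; exact: cE|
      apply: cvg_at_left_filter; exact: cE].
  - by move=> x _; rewrite derive1E; case: (dE x).
have limE : E t @[t --> +oo] --> Num.sqrt pi / 2.
  have : Num.sqrt (@integral0_gauss R x ^+ 2) @[x --> +oo] --> Num.sqrt (pi / 4).
    apply: continuous_cvg => //;
      [exact: sqrt_continuous|exact: cvg_integral0_gauss_sqr].
  rewrite sqrtrM ?pi_ge0// sqrtrV// (_ : 4 = 2 ^+ 2); last by rewrite expr2 -natrM.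
  rewrite sqrtr_sqr ger0_norm//; apply: cvg_trans; apply: near_eq_cvg.
  near=> t; have t0 : 0 < t by near: t; apply: nbhs_pinfty_gt; rewrite num_real.
  by rewrite sqrtr_sqr EI// ger0_norm// -E0 homoE// ltW.
exists E; split=> // t t0; apply/andP; split.
  rewrite subr_ge0; apply: (cvgr_to_ge limE).
  by near=> s; apply: homoE; near: s; apply: nbhs_pinfty_ge; rewrite num_real.
rewrite lerBlDr; apply: (cvgr_to_le limE); near=> s.
by rewrite -lerBlDr; apply: tail => //; near: s; apply: nbhs_pinfty_ge; rewrite num_real.
Unshelve. all: end_near. Qed.

End GaussPrimitive.

(** * Truncated Gaussian integrals, moments and Fourier transform *)

Section GaussIntegrals.
Context {R : realType}.
Implicit Types (a b t s u : R).

Lemma pi_le4 : pi <= 4 :> R.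
Proof. by have := @pihalf_lt2 R; lra. Qed.

Lemma intpi_gauss b : 0 < b ->
  intpi (fun t => expR (- (b * t ^+ 2))) <= 2 / Num.sqrt b /\
  `|intpi (fun t => expR (- (b * t ^+ 2))) - Num.sqrt (pi / b)| <= b^-1.
Proof.
move=> b0; have [E [dE oddE tailE]] := @gauss_primitive R.
have sb0 : 0 < Num.sqrt b by rewrite sqrtr_gt0.
have bsb : Num.sqrt b ^+ 2 = b by rewrite sqr_sqrtr// ltW.
set sb := Num.sqrt b in sb0 bsb *.
have dF t : is_derive t (1 : R) (fun t => sb^-1 * E (sb * t)) (expR (- (b * t ^+ 2))).
  apply: der_eq.
    apply: derM; [der|apply: (@der_comp _ E); [exact: dE|apply: derM; der]].
  by rewrite /= exprMn bsb; field; apply: lt0r_neq0.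
rewrite (intpi_FTC _ dF); last by cont.
have pi0 := pi_gt0 R; have pi2 := pi_ge2 R; have pi4 := pi_le4.
have /andP[t1 t2] := tailE (sb * pi) (mulr_gt0 sb0 pi0).
have spi : Num.sqrt pi <= 2 :> R.
  by rewrite -[leRHS]ger0_norm// -sqrtr_sqr ler_sqrt// expr2; lra.
rewrite mulrN oddE sqrtrM ?(ltW pi0)// sqrtrV ?(ltW b0)// -/sb.
have isb : 0 < sb^-1 by rewrite invr_gt0.
split.
  by rewrite -mulrBr mulrC ler_wpM2r//; [exact: ltW|lra].
rewrite (_ : _ - _ - _ = - (2 * (Num.sqrt pi / 2 - E (sb * pi))) * sb^-1); last by field; apply: lt0r_neq0.
have X0 : 0 <= 2 * (Num.sqrt pi / 2 - E (sb * pi)) by lra.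
rewrite mulNr normrN ger0_norm ?mulr_ge0 ?(ltW isb)//.
rewrite -bsb expr2 invfM ler_pM2r//.
move: t2; rewrite invfM => t2; have : 2 * (sb^-1 / pi) <= sb^-1; last by lra.
by rewrite mulrCA ler_piMr ?(ltW isb)// ler_pdivrMr// mul1r.
Qed.

Lemma le_expR_sqr u : u <= expR (u ^+ 2 / 4).
Proof.
apply: le_trans (expR_ge1Dx _); have := sqr_ge0 (u / 2 - 1); rewrite expr2; lra.
Qed.

(** Half of the exponent pays for the powers of |t|: with v = sqrt(a) |t| one has v <= e^(v^2/4) and
    v^2 <= 4 e^(v^2/4), and exp(-a t^2 / 2) remains to be integrated. *)
Lemma intpi_gauss_moments a : 0 < a ->
  intpi (fun t => `|t| * expR (- (a * t ^+ 2))) <= 4 / a /\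
  intpi (fun t => `|t| ^+ 3 * expR (- (a * t ^+ 2))) <= 16 / a ^+ 2.
Proof.
move=> a0; have sa0 : 0 < Num.sqrt a by rewrite sqrtr_gt0.
have asa : Num.sqrt a ^+ 2 = a by rewrite sqr_sqrtr// ltW.
set sa := Num.sqrt a in sa0 asa *.
have [I1 _] := @intpi_gauss (a / 2) ltac:(lra).
set J := intpi (fun t => expR (- (a / 2 * t ^+ 2))) in I1.
have J4 : J <= 4 / sa.
  apply: le_trans I1 _; rewrite sqrtrM ?(ltW a0)// -/sa sqrtrV//.
  have s20 : 0 < Num.sqrt 2 :> R by rewrite sqrtr_gt0.
  rewrite (_ : 2 / _ = 2 * Num.sqrt 2 / sa); last first.
    by field; rewrite !lt0r_neq0.
  rewrite ler_pM2r ?invr_gt0//.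
  have : Num.sqrt 2 <= 2 :> R by rewrite -[leRHS]ger0_norm// -sqrtr_sqr ler_sqrt// expr2; lra.
  lra.
have sa1 : 0 < sa^-1 by rewrite invr_gt0.
have spl t : expR (- (a * t ^+ 2)) * (expR ((sa * `|t|) ^+ 2 / 4) * expR ((sa * `|t|) ^+ 2 / 4)) = expR (- (a / 2 * t ^+ 2)).
  by rewrite -!expRD; congr expR; rewrite exprMn asa real_normK ?num_real//; field.
have q1 t : 1 <= expR ((sa * `|t|) ^+ 2 / 4).
  by apply: le_trans (expR_ge1Dx _); have := sqr_ge0 (sa * `|t|); lra.
split.
  apply: le_trans (_ : sa^-1 * J <= _); last first.
    rewrite -asa expr2 invfM mulrCA ler_wpM2l// ltW//; lra.
  rewrite -intpiZ; last by cont.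
  apply: le_intpi; [by cont|by cont|move=> t _].
  rewrite -spl [leLHS]mulrC [leRHS]mulrCA ler_wpM2l ?expR_ge0//.
  rewrite ler_pdivlMl//.
  apply: le_trans (le_expR_sqr _) _; rewrite ler_peMr ?expR_ge0//.
apply: le_trans (_ : 4 * sa^-1 ^+ 3 * J <= _); last first.
  apply: le_trans (_ : 4 * sa^-1 ^+ 3 * (4 / sa) <= _).
    by rewrite ler_wpM2l// mulr_ge0// exprn_ge0// ltW.
  by rewrite -asa le_eqVlt; apply/orP; left; apply/eqP; field; apply: lt0r_neq0.
rewrite -intpiZ; last by cont.
apply: le_intpi; [by cont|by cont|move=> t _].
rewrite -spl [leLHS]mulrC [leRHS]mulrCA ler_wpM2l ?expR_ge0//.
rewrite -mulrA mulrCA exprVn ler_pdivlMl ?exprn_gt0// -exprMn.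
set v := sa * _; rewrite exprS; have v0 : 0 <= v by rewrite mulr_ge0// ltW.
rewrite [leRHS]mulrCA ler_pM ?sqr_ge0 ?le_expR_sqr//.
by have := expR_ge1Dx (v ^+ 2 / 4); lra.
Qed.

(** The truncated transform I satisfies 2 b I' = - s I plus a boundary term at -pi and pi. Hence
    exp(s^2 / (4b)) I has a derivative made of that term alone, and its increment from 0 to s is the
    error. *)
Lemma gauss_fourier_aux b s : 0 < b ->
  `|intpi (fun t => expR (- (b * t ^+ 2)) * cos (s * t)) -
    expR (- (s ^+ 2 / (4 * b))) * intpi (fun t => expR (- (b * t ^+ 2)))|
  <= `|s| * expR (- (b * pi ^+ 2)) / b.
Proof.
move=> b0; pose I s := intpi (fun t => expR (- (b * t ^+ 2)) * cos (s * t)).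
have dI u : has_deriv I u ((2 * expR (- (b * pi ^+ 2)) * sin (u * pi) - u * I u) / (2 * b)).
  have -> : (2 * expR (- (b * pi ^+ 2)) * sin (u * pi) - u * I u) / (2 * b) =
     intpi (fun t => - t * expR (- (b * t ^+ 2)) * sin (u * t)).
    have dF t : is_derive t (1 : R) (fun t => expR (- (b * t ^+ 2)) * sin (u * t))
       (2 * b * (- t * expR (- (b * t ^+ 2)) * sin (u * t)) +
        u * (expR (- (b * t ^+ 2)) * cos (u * t))).
      by apply: der_eq; [der|rewrite /=; ring].
    have H0 := fun c => intpi_FTC c dF.
    have := H0 ltac:(cont); rewrite intpiD ?intpiZ; [|by cont..].
    move=> H; apply: (canLR (mulfK _)); first by apply: lt0r_neq0; lra.
    by move: H; rewrite sqrrN mulrN sinN /I; lra.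
  (* 32 bounds 2 t^2, as |t| <= pi <= 4. *)
  apply: (@intpi_deriv _ (fun s t => expR (- (b * t ^+ 2)) * cos (s * t))
    (fun s t => - t * expR (- (b * t ^+ 2)) * sin (s * t)) u 32).
  - by move=> s'; cont.
  - by cont.
  move=> h t _ tpi.
  have -> : expR (- (b * t ^+ 2)) * cos ((u + h) * t) - expR (- (b * t ^+ 2)) * cos (u * t)
    - h * (- t * expR (- (b * t ^+ 2)) * sin (u * t)) =
    expR (- (b * t ^+ 2)) * (cos (u * t) * (cos (h * t) - 1) - sin (u * t) * (sin (h * t) - h * t)).
    by rewrite mulrDl cosD; ring.
  rewrite normrM ger0_norm ?expR_ge0//.
  have e1 : expR (- (b * t ^+ 2)) <= 1 by rewrite expR_le1 oppr_le0 mulr_ge0 ?sqr_ge0// ltW.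
  apply: le_trans (_ : 1 * (2 * `|h * t| ^+ 2) <= _).
    rewrite ler_pM ?expR_ge0//; apply: le_trans (ler_normB _ _) _.
    rewrite !normrM [leRHS](_ : _ = 1 * (`|h| * `|t|) ^+ 2 + 1 * (`|h| * `|t|) ^+ 2); last by ring.
    by rewrite -[`|h| * `|t|]normrM lerD// ler_pM ?cos_max ?sin_max ?norm_cos1_le ?norm_sin1_le.
  rewrite mul1r real_normK ?num_real// (_ : 2 * _ = (2 * t ^+ 2) * h ^+ 2); last by ring.
  rewrite ler_wpM2r ?sqr_ge0//.
  have : t ^+ 2 <= 4 ^+ 2.
    have := pi_le4; have := pi_ge2 R => p2 p4; move: tpi => /andP[t1 t2].
    by rewrite -[t ^+ 2]real_normK ?num_real// lerXn2r ?nnegrE// ler_norml; lra.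
  by rewrite expr2; lra.
have e0 := expR_gt0 (- (s ^+ 2 / (4 * b))).
have bN : b != 0 by apply: lt0r_neq0.
rewrite -[intpi _]/(I s) (_ : I s - _ = expR (- (s ^+ 2 / (4 * b))) *
    (expR (s ^+ 2 / (4 * b)) * I s - intpi (fun t => expR (- (b * t ^+ 2))))); last first.
  by rewrite mulrBr mulrA [expR (- _) * expR _]mulrC expRxMexpNx_1 mul1r.
rewrite normrM gtr0_norm//.
rewrite -ler_pdivlMl// -expRN opprK.
have -> : intpi (fun t => expR (- (b * t ^+ 2))) = expR (0 ^+ 2 / (4 * b)) * I 0.
  rewrite expr0n /= mul0r expR0 mul1r; apply: eq_intpi => t.
  by rewrite mul0r cos0 mulr1.
rewrite [leRHS](_ : _ = expR (s ^+ 2 / (4 * b)) * expR (- (b * pi ^+ 2)) / b * `|s|); last by ring.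
rewrite -[X in _ <= _ * `|X|]subr0.
apply: (@mean_value_norm _ (fun s => expR (s ^+ 2 / (4 * b)) * I s)
   (fun s => expR (s ^+ 2 / (4 * b)) * expR (- (b * pi ^+ 2)) / b * sin (s * pi))).
  move=> x _; apply: der_eq; first by apply: derM; [der|exact: dI].
  by rewrite /=; field.
move=> x; rewrite !subr0 => xs; rewrite normrM ger0_norm; last first.
  by rewrite divr_ge0 ?(ltW b0)// mulr_ge0// expR_ge0.
apply: le_trans (ler_piMr _ (sin_max _)) _.
  by rewrite divr_ge0 ?(ltW b0)// mulr_ge0// expR_ge0.
rewrite ler_wpM2r ?invr_ge0 ?(ltW b0)// ler_wpM2r ?expR_ge0// ler_expR.
rewrite ler_wpM2r ?invr_ge0 ?mulr_ge0 ?(ltW b0)//.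
by rewrite -[x ^+ 2]real_normK ?num_real// -[s ^+ 2]real_normK ?num_real// lerXn2r.
Qed.

(** The bound on s brings the boundary term below L / b, because b exp(-b pi^2) <= 1. *)
Lemma gauss_fourier (L b s : R) : 0 < b -> `|s| <= L * b ->
  `|intpi (fun t => expR (- (b * t ^+ 2)) * cos (s * t)) -
    Num.sqrt (pi / b) * expR (- (s ^+ 2 / (4 * b)))| <= (L + 1) / b.
Proof.
move=> b0 sL; have [_ I0] := intpi_gauss b0; have If := gauss_fourier_aux s b0.
set e := expR (- (s ^+ 2 / (4 * b))) in If *.
have e1 : e <= 1.
  by rewrite expR_le1 oppr_le0 mulr_ge0 ?sqr_ge0// invr_ge0 mulr_ge0// ltW.
have e0 : 0 <= e by exact: expR_ge0.
set I := intpi _ in If *; set J := intpi _ in I0 If.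
rewrite (_ : _ - _ = (I - e * J) + e * (J - Num.sqrt (pi / b))); last by ring.
apply: le_trans (ler_normD _ _) _; rewrite [leRHS]mulrDl; apply: lerD.
  apply: le_trans If _; rewrite ler_wpM2r ?invr_ge0 ?(ltW b0)//.
  have L0 : 0 <= L by rewrite -(pmulr_lge0 _ b0); exact: le_trans sL.
  apply: le_trans (ler_wpM2r (expR_ge0 _) sL) _; rewrite -mulrA ler_piMr//.
  rewrite expRN ler_pdivrMr ?expR_gt0// mul1r; apply: le_trans (expR_ge1Dx _).
  have := pi_ge2 R => p2; have : 1 <= pi ^+ 2 :> R by rewrite expr_ge1//; lra.
  by move=> /(ler_wpM2l (ltW b0)); lra.
rewrite normrM (ger0_norm e0) div1r.
by apply: le_trans I0; rewrite ler_piMl.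
Qed.

End GaussIntegrals.

(** * Elementary bounds for exp, sin and cos *)

Section SmallBounds.
Context {R : realType}.
Implicit Types (t u x a b : R).

Lemma expR_geD_sqr a : - 2 <= a -> 1 + a + a ^+ 2 / 4 <= expR a.
Proof.
move=> a2; rewrite (_ : 1 + a + _ = (1 + a / 2) ^+ 2); last by field.
rewrite (_ : expR a = expR (a / 2) ^+ 2); last first.
  by rewrite expr2 -expRD; congr expR; field.
by rewrite lerXn2r ?nnegrE ?expR_ge0 ?expR_ge1Dx//; lra.
Qed.

Lemma expR1_le4 : expR 1 <= 4 :> R.
Proof.
have := @expR_geD_sqr (-1) ltac:(lra); have := expRxMexpNx_1 (1 : R).
have := expR_gt0 (1 : R); rewrite sqrrN expr1n; nra.
Qed.

Lemma cos_half_sin b : cos b = 1 - 2 * sin (b / 2) ^+ 2.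
Proof.
have -> : cos b = cos (b / 2 + b / 2) by congr cos; field.
by rewrite cosD -!expr2 cos2sin2; ring.
Qed.

Lemma cos_ge1Bsqr b : 1 - b ^+ 2 / 2 <= cos b.
Proof.
rewrite cos_half_sin.
have : sin (b / 2) ^+ 2 <= (b / 2) ^+ 2.
  by rewrite -real_normK ?num_real// -[leRHS]real_normK ?num_real// lerXn2r ?norm_sin_le.
by lra.
Qed.

(** From sin u >= u - u^3/6 and u^2 <= 4. *)
Lemma sin_ge_third u : 0 <= u <= 2 -> u / 3 <= sin u.
Proof.
move=> /andP[u0 u2].
have [x _|c _] := @mean_value _ (fun u => sin u - u + u ^+ 3 / 6)
  (fun u => cos u - 1 + u ^+ 2 / 2) 0 u u0; first by der_to; field.
rewrite sin0 expr0n /= => H.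
have : 0 <= sin u - u + u ^+ 3 / 6.
  move: H; rewrite mul0r !subr0 add0r subr0 => ->.
  by rewrite mulr_ge0//; have := cos_ge1Bsqr c; lra.
have : u ^+ 3 <= 4 * u.
  by rewrite exprSr ler_wpM2r// expr2; nra.
lra.
Qed.

Lemma cos_le1Bsqr t : - pi <= t <= pi -> cos t <= 1 - t ^+ 2 / 18.
Proof.
move=> tpi; have pi4 := @pi_le4 R.
rewrite -cos_norm cos_half_sin.
have t4 : `|t| <= 4 by rewrite ler_norml; lra.
have := @sin_ge_third (`|t| / 2); rewrite divr_ge0//= => /(_ ltac:(lra)) H.
have : (`|t| / 2 / 3) ^+ 2 <= sin (`|t| / 2) ^+ 2.
  by rewrite lerXn2r ?nnegrE ?divr_ge0// (le_trans _ H)// !divr_ge0.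
by rewrite !exprMn real_normK ?num_real//; lra.
Qed.

End SmallBounds.

(** * The zero-truncated Poisson law *)

Section TruncatedPoisson.
Context {R : realType}.
Implicit Types (t x : R) (k : nat).
Import Normc.

(* Characteristic function, mean and variance of the zero-truncated Poisson law. *)
Definition ztp_char x t : R[i] := ((expR x - 1)^-1)%:C * (expcis x t - 1).
Definition ztp_mean x : R := x / (1 - expR (- x)).
Definition ztp_var x : R := ztp_mean x * (1 + x - ztp_mean x).

(** The margin above 1 is what later separates the centre [kap] of the Gaussian from the upper end
    of the sum. *)
Lemma ztp_mean_bounds x : 3^-1 <= x <= 1 -> 1 + 36^-1 <= ztp_mean x <= 2.
Proof.
move=> /andP[x1 x2]; rewrite /ztp_mean.
have e1 := @expR_geD_sqr _ (- x) ltac:(lra).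
have e2 := expR_ge1Dx x; have e3 := expRxMexpNx_1 x.
have e4 := expR_gt0 (- x).
have d0 : 0 < 1 - expR (- x) by rewrite subr_gt0 expR_lt1; lra.
rewrite ler_pdivlMr// ler_pdivrMr//; move: e1; rewrite sqrrN => e1.
apply/andP; split; nra.
Qed.

(** The factor 1 + x - [ztp_mean x] is positive exactly when (1 + x) e^(-x) < 1, and x >= 1/3 makes
    this quantitative. *)
Lemma ztp_var_bounds x : 3^-1 <= x <= 1 -> 90^-1 <= ztp_var x <= 4.
Proof.
move=> x12; have /andP[m1 m2] := ztp_mean_bounds x12.
have /andP[x1 x2] := x12.
have e2 := @expR_geD_sqr _ x ltac:(lra).
have e3 := expRxMexpNx_1 x; have e4 := expR_gt0 (- x).
have d0 : 0 < 1 - expR (- x) by rewrite subr_gt0 expR_lt1; lra.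
have H : 90^-1 <= 1 + x - ztp_mean x.
  suff : ztp_mean x <= 1 + x - 90^-1 by lra.
  rewrite /ztp_mean ler_pdivrMr//.
  have : (1 + x) * expR (- x) <= 1 - 90^-1; last by nra.
  have : expR (- x) * (1 + x + x ^+ 2 / 4) <= 1.
    by have := ler_wpM2l (ltW e4) e2; rewrite [_ * expR x]mulrC e3.
  have : 9^-1 <= x ^+ 2 by rewrite expr2; nra.
  have : 4^-1 <= expR (- x).
    have := @expR_geD_sqr _ (- x) ltac:(lra); rewrite sqrrN; nra.
  nra.
rewrite /ztp_var; apply/andP; split; nra.
Qed.

(* Any constant below 1/(2 * 9 * 72 * 54) would do. *)
Definition ztp_rate : R := 300^-1 * 300^-1.

Lemma ztp_rate_bounds : [/\ 0 < ztp_rate, ztp_rate <= 300^-1 & 9 * (72 * 54) * (2 * ztp_rate) <= 1].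
Proof. by rewrite /ztp_rate; split; lra. Qed.

(** Put a = x cos t and b = x sin t. By cos b >= 1 - b^2/2, the square of |exp(x e^(it)) - 1| is at
    most h(a) = (e^a - 1)^2 + e^a (x^2 - a^2). On [-x, x] the slope of h is at least 1/72, and h(x)
    = (e^x - 1)^2, so the loss is at least (x - a)/72 with x - a = x (1 - cos t) >= t^2/54. *)
Lemma ztp_char_sqr_le x t : 3^-1 <= x <= 1 -> - pi <= t <= pi ->
  normc (ztp_char x t) ^+ 2 <= 1 - 2 * ztp_rate * t ^+ 2.
Proof.
move=> /andP[x1 x2] tpi; rewrite /ztp_char normcM normc_realC exprMn.
have e1 : 3^-1 <= expR x - 1 by have := expR_ge1Dx x; lra.
have e3 : expR x - 1 <= 3.
  have ex1 : expR x <= expR 1 by rewrite ler_expR.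
  by have := @expR1_le4 R; lra.
rewrite real_normK ?num_real// exprVn ler_pdivrMl; last by rewrite exprn_gt0; lra.
set a := x * cos t; set b := x * sin t.
have ab : a ^+ 2 + b ^+ 2 = x ^+ 2 by rewrite !exprMn -mulrDr cos2Dsin2 mulr1.
have sq : normc (expcis x t - 1) ^+ 2 <= (expR a - 1) ^+ 2 + expR a * (x ^+ 2 - a ^+ 2).
  rewrite sqr_normc expcisE /= subr0 -/a -/b.
  have -> : (expR a * cos b - 1) ^+ 2 + (expR a * sin b) ^+ 2 =
     expR a ^+ 2 * (cos b ^+ 2 + sin b ^+ 2) - 2 * (expR a * cos b) + 1 by ring.
  rewrite cos2Dsin2 -ab.
  have := ler_wpM2l (expR_ge0 a) (cos_ge1Bsqr b).
  by rewrite !expr2; lra.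
have [xa ax] : - x <= a /\ a <= x.
  by have /andP[] : - 1 <= cos t <= 1; [rewrite cos_geN1 cos_le1|rewrite /a; nra].
have [c|c /andP[ac cx] H] := @mean_value _ (fun a => (expR a - 1) ^+ 2 + expR a * (x ^+ 2 - a ^+ 2))
  (fun a => expR a * (2 * (expR a - 1 - a) + (x ^+ 2 - a ^+ 2))) a x ax.
  by move=> _; der_to; ring.
(* 72 = 4 * 18: e^c >= 1/4, and the bracket is at least x^2 - c^2/2 >= x^2/2 >= 1/18. *)
have hc : 72^-1 <= expR c * (2 * (expR c - 1 - c) + (x ^+ 2 - c ^+ 2)).
  have := @expR_geD_sqr _ c ltac:(lra) => h1.
  have c2 : c ^+ 2 <= x ^+ 2 by rewrite !expr2; nra.
  have h2 : 18^-1 <= 2 * (expR c - 1 - c) + (x ^+ 2 - c ^+ 2).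
    by have : 9^-1 <= x ^+ 2; [rewrite expr2; nra|lra].
  have h3 : 4^-1 <= expR c.
    have := @expR_geD_sqr _ (-1) ltac:(lra); rewrite sqrrN expr1n => h3.
    have ec : expR (-1) <= expR c by rewrite ler_expR; lra.
    by lra.
  by have := ler_pM (ltac:(lra) : 0 <= 4^-1 :> R) (ltac:(lra) : 0 <= 18^-1 :> R) h3 h2; lra.
have cost := cos_le1Bsqr tpi.
have xa' : t ^+ 2 / 54 <= x - a by rewrite /a; have := sqr_ge0 t; nra.
have gap : t ^+ 2 / (72 * 54) <= expR c * (2 * (expR c - 1 - c) + (x ^+ 2 - c ^+ 2)) * (x - a).
  have t20 : 0 <= t ^+ 2 / 54 by rewrite divr_ge0 ?sqr_ge0.
  by rewrite invfM; have := ler_pM (ltac:(lra) : 0 <= 72^-1 :> R) t20 hc xa'; lra.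
apply: le_trans sq _; move: H; rewrite subrr mulr0 addr0 => H.
have : (expR x - 1) ^+ 2 * t ^+ 2 <= 9 * t ^+ 2.
  by rewrite ler_wpM2r ?sqr_ge0// expr2; nra.
move=> h9; have [r0 _ r1] := ztp_rate_bounds.
have : 2 * ztp_rate * ((expR x - 1) ^+ 2 * t ^+ 2) <= t ^+ 2 / (72 * 54).
  have r2 : 0 <= 2 * ztp_rate by rewrite mulr_ge0// ltW.
  apply: le_trans (ler_wpM2l r2 h9) _.
  by rewrite ler_pdivlMr//; have := ler_wpM2r (sqr_ge0 t) r1; lra.
by move: gap; rewrite -H; lra.
Qed.

Lemma ztp_char_le x t : 3^-1 <= x <= 1 -> - pi <= t <= pi ->
  normc (ztp_char x t) <= expR (- (ztp_rate * t ^+ 2)).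
Proof.
move=> x12 tpi; rewrite -(@ler_pXn2r _ 2)// ?nnegrE ?normc_ge0 ?expR_ge0//.
apply: le_trans (ztp_char_sqr_le x12 tpi) _.
rewrite [leRHS]expr2 -expRD; apply: le_trans (expR_ge1Dx _); lra.
Qed.

(** Characteristic function of the normal law with the same mean and variance. *)
Definition gauss_char x t : R[i] :=
  cexp ((- (ztp_var x / 2 * t ^+ 2)) +i* (ztp_mean x * t)).

Lemma gauss_char_le x t : 3^-1 <= x <= 1 ->
  normc (gauss_char x t) <= expR (- (ztp_rate * t ^+ 2)).
Proof.
move=> /ztp_var_bounds/andP[v1 _]; rewrite normc_cexp ler_expR /= lerN2.
by rewrite ler_wpM2r ?sqr_ge0//; have [] := ztp_rate_bounds; lra.
Qed.

Lemma normc_exprB_le (a b : R[i]) (M : R) k : normc a <= M -> normc b <= M ->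
  normc (a ^+ k.+1 - b ^+ k.+1) <= k.+1%:R * normc (a - b) * M ^+ k.
Proof.
move=> aM bM; have M0 := le_trans (normc_ge0 a) aM.
elim: k => [|k IH]; first by rewrite !expr1 expr0 mulr1 mul1r.
have -> : a ^+ k.+2 - b ^+ k.+2 = a ^+ k.+1 * (a - b) + (a ^+ k.+1 - b ^+ k.+1) * b.
  by rewrite !(exprS _ k.+1); ring.
apply: le_trans (le_normcD _ _) _; rewrite !normcM normcX.
rewrite -[k.+2%:R]natr1 !mulrDl mul1r addrC lerD//.
  by rewrite [M ^+ _]exprSr mulrA ler_pM ?mulr_ge0 ?normc_ge0// exprn_ge0.
by rewrite mulrC ler_wpM2l ?normc_ge0// lerXn2r ?nnegrE ?normc_ge0.
Qed.
End TruncatedPoisson.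

(** * Third-order comparison of the two characteristic functions *)

Section CharacteristicExpansion.
Context {R : realType}.
Implicit Types (t x : R) (k : nat).
Import Normc.

Lemma normc_imag t : normc (0 +i* t) = `|t|.
Proof. by rewrite /= expr0n add0r sqrtr_sqr. Qed.

Lemma normc_cis_taylor t : - pi <= t <= pi ->
  [/\ normc (cis t - 1) <= 3 * expR 4 * `|t|,
      normc (cis t - 1 - (0 +i* t)) <= 4 * expR 4 * `|t| ^+ 2 &
      normc (cis t - 1 - (0 +i* t) - (0 +i* t) ^+ 2 / 2) <= 5 * expR 4 * `|t| ^+ 3].
Proof.
move=> tpi; have t4 : normc (0 +i* t) <= 4.
  by rewrite normc_imag ler_norml; have := @pi_le4 R; lra.
rewrite cisE; have := normc_cexp1_le t4; have := normc_cexp2_le t4.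
by have := normc_cexp3_le t4; rewrite normc_imag => ? ? ?; split.
Qed.

(** Starts from [ztp_char x t] = 1 + q (e^w - 1). Matching mean and variance cancel everything of
    order below three in t; each term left is visibly of order at least three, [sigma] being of
    order two and [rho] of order three. *)
Lemma ztp_char_gauss_char (x t : R) (u := 0 +i* t) (w := x%:C * (cis t - 1))
    (v := (- (ztp_var x / 2 * t ^+ 2)) +i* (ztp_mean x * t))
    (rho := cis t - 1 - u - u ^+ 2 / 2) (sigma := cis t - 1 - u)
    (q := (1 - expR (- x))^-1) : x != 0 ->
  ztp_char x t - gauss_char x t =
  q%:C * (cexp w - 1 - w - w ^+ 2 / 2) - (cexp v - 1 - v - v ^+ 2 / 2)
  + (x * q)%:C * rho + (q * x ^+ 2 / 2)%:C * (2 * u * sigma + sigma ^+ 2)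
  - ((x * q * ztp_var x / 2)%:C * u ^+ 3 + (ztp_var x ^+ 2 / 8)%:C * u ^+ 4).
Proof.
move=> x0; have ex1 : 1 - expR (- x) != 0.
  by rewrite subr_eq0 eq_sym -[X in _ != X]expR0 (inj_eq (@expR_inj _)) oppr_eq0.
have E0 : expR x != 0 by rewrite gt_eqF// expR_gt0.
have E1 : expR x - 1 != 0.
  by apply: contra ex1 => /eqP E; rewrite expRN subr_eq0 -(subr0 (expR x)) -E opprB addrC subrK invr1.
have qE : q = expR x * (expR x - 1)^-1.
  rewrite /q expRN; field; apply/andP; split=> //.
have phiE : ztp_char x t = q%:C * (cexp w - 1) + 1.
  have -> : ztp_char x t = ((expR x - 1)^-1)%:C * ((expR x)%:C * cexp w - 1).
    rewrite /ztp_char /expcis /w; congr (_ * (_ - _)).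
    have -> : (expR x)%:C = cexp x%:C.
      by rewrite /cexp /= cos0 sin0 mulr1 mulr0.
    by rewrite -cexpD; congr cexp; ring.
  rewrite qE rmorphM !(fmorphV (real_complex R)) (rmorphB (real_complex R)) rmorph1; field.
  by rewrite -(rmorph1 (real_complex R)) -rmorphB fmorph_eq0.
have vE : v = (x * q)%:C * u + (ztp_var x)%:C * u ^+ 2 / 2.
  have -> : (ztp_var x)%:C * u ^+ 2 / 2 = (ztp_var x / 2)%:C * u ^+ 2.
    by rewrite (rmorphM (real_complex R) (ztp_var x)) (fmorphV (real_complex R)) rmorph_nat; ring.
  by apply/eqP; rewrite eq_complex /= /ztp_mean -/q; apply/andP; split; apply/eqP; ring.
have sE : sigma = rho + u ^+ 2 / 2 by rewrite /rho /sigma; ring.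
have wE : w = x%:C * (u + sigma) by rewrite /w /sigma; ring.
have VE : (ztp_var x)%:C = x%:C * q%:C * (1 + x%:C - x%:C * q%:C).
  by rewrite /ztp_var /ztp_mean -/q !rmorphM rmorphB rmorphD rmorph1 rmorphM.
rewrite phiE /gauss_char -/v [rho](_ : _ = sigma - u ^+ 2 / 2); last by rewrite sE; ring.
set W := cexp w; set V := cexp v.
rewrite [w]wE [v]vE; move: VE; set S := ztp_var x; clearbody W V sigma u S q => VE.
rewrite ?rmorphXn !rmorphM ?rmorphXn !(fmorphV (real_complex R)) !rmorph_nat /= VE.
field; by [].
Qed.

Lemma ztp_char_taylor : exists2 C : R, 0 <= C & forall x t,
  3^-1 <= x <= 1 -> - pi <= t <= pi ->
  normc (ztp_char x t - gauss_char x t) <= C * `|t| ^+ 3.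
Proof.
pose e4 : R := expR 4.
(* One constant for each term of the decomposition, from q <= 6, |w| <= 3 e^4 |t|, |v| <= 10 |t| and
   |t| <= 4. *)
pose C1 : R := 6 * (5 * expR (12 * e4) * (3 * e4) ^+ 3).
pose C2 : R := 5 * expR 40 * 10 ^+ 3.
pose C3 : R := 2 * (5 * e4).
pose C4 : R := 3 * (8 * e4 + 64 * e4 ^+ 2).
pose C5 : R := 4 + 8.
have e40 : 0 < e4 by exact: expR_gt0.
have C10 : 0 <= C1 by rewrite !mulr_ge0 ?expR_ge0 ?exprn_ge0 ?mulr_ge0// ltW.
have C20 : 0 <= C2 by rewrite !mulr_ge0 ?expR_ge0.
exists (C1 + C2 + C3 + C4 + C5).
  by rewrite /C3 /C4 /C5; have := sqr_ge0 e4; lra.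
move=> x t x12 tpi.
have /andP[m1 m2] := ztp_mean_bounds x12; have /andP[v1 v2] := ztp_var_bounds x12.
have /andP[x1 x2] := x12.
rewrite ztp_char_gauss_char; last by apply: lt0r_neq0; lra.
set u := 0 +i* t; set w := x%:C * _; set v := _ +i* _.
set q := _^-1; set sigma := cis t - 1 - u; set rho := _ - u ^+ 2 / 2.
have [h1 h2 h3] := normc_cis_taylor tpi.
set T : R := `|t| in h1 h2 h3 *.
have T0 : 0 <= T by exact: normr_ge0.
have T4 : T <= 4 by rewrite ler_norml; have := @pi_le4 R; lra.
have nu : normc u = T by rewrite normc_imag.
have q0 : 0 <= q by rewrite invr_ge0 subr_ge0 expR_le1; lra.
have mE : x * q = ztp_mean x by [].
have q6 : q <= 6 by move: m2; rewrite -mE; nra.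
have w3 : normc w <= 3 * e4 * T.
  by rewrite normcM normc_realC ger0_norm; [have := normc_ge0 (cis t - 1); rewrite -/e4 in h1; nra|lra].
have e4T : 0 <= e4 * T by rewrite mulr_ge0// ltW.
have b1 : normc (q%:C * (cexp w - 1 - w - w ^+ 2 / 2)) <= C1 * T ^+ 3.
  rewrite normcM normc_realC ger0_norm// /C1 -mulrA ler_pM ?normc_ge0//.
  apply: le_trans (@normc_cexp3_le _ _ (12 * e4) _) _; first by nra.
  rewrite [leRHS](_ : _ = 5 * expR (12 * e4) * (3 * e4 * T) ^+ 3); last by ring.
  rewrite ler_wpM2l ?mulr_ge0 ?expR_ge0//.
  by rewrite lerXn2r ?nnegrE ?normc_ge0// (le_trans (normc_ge0 _) w3).
have v10 : normc v <= 10 * T.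
  apply: le_trans (normc_le_ReIm _) _; rewrite /= normrN.
  rewrite (normrM (ztp_mean x)) (ger0_norm (_ : 0 <= ztp_mean x)) -/T; last by lra.
  rewrite ger0_norm; last by rewrite mulr_ge0 ?sqr_ge0//; lra.
  rewrite -[t ^+ 2]real_normK ?num_real// -/T.
  by have := sqr_ge0 T; nra.
have b2 : normc (cexp v - 1 - v - v ^+ 2 / 2) <= C2 * T ^+ 3.
  apply: le_trans (@normc_cexp3_le _ _ 40 _) _; first by lra.
  rewrite [leRHS](_ : _ = 5 * expR 40 * (10 * T) ^+ 3); last by rewrite /C2; ring.
  rewrite ler_wpM2l ?mulr_ge0 ?expR_ge0//.
  by rewrite lerXn2r ?nnegrE ?normc_ge0// mulr_ge0.
have b3 : normc ((x * q)%:C * rho) <= C3 * T ^+ 3.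
  rewrite normcM normc_realC mE ger0_norm; last by lra.
  by rewrite /C3 -mulrA ler_pM ?normc_ge0//; lra.
have b4 : normc ((q * x ^+ 2 / 2)%:C * (2 * u * sigma + sigma ^+ 2)) <= C4 * T ^+ 3.
  have X0 : 0 <= q * x ^+ 2 / 2 by rewrite divr_ge0// mulr_ge0// sqr_ge0.
  rewrite normcM normc_realC ger0_norm// /C4 -[leRHS]mulrA; apply: ler_pM => //; first exact: normc_ge0.
    have : x ^+ 2 <= 1 by rewrite expr2; nra.
    by have := sqr_ge0 x; nra.
  apply: le_trans (le_normcD _ _) _; rewrite (normcX sigma) !normcM nu.
  have -> : normc (2 : R[i]) = 2 by rewrite -(rmorph_nat (real_complex R)) normc_realC normr_nat.
  rewrite [leRHS]mulrDl lerD//.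
    rewrite (_ : 8 * e4 * _ = 2 * T * (4 * e4 * T ^+ 2)); last by ring.
    by rewrite ler_wpM2l// mulr_ge0.
  apply: le_trans (_ : (4 * e4 * T ^+ 2) ^+ 2 <= _).
    by rewrite lerXn2r ?nnegrE ?normc_ge0// !mulr_ge0 ?sqr_ge0// ltW.
  rewrite (_ : _ ^+ 2 = 16 * e4 ^+ 2 * T ^+ 3 * T); last by ring.
  rewrite (_ : 64 * _ * _ = 16 * e4 ^+ 2 * T ^+ 3 * 4); last by ring.
  by rewrite ler_wpM2l// mulr_ge0 ?exprn_ge0// mulr_ge0 ?sqr_ge0.
have b5 : normc ((x * q * ztp_var x / 2)%:C * u ^+ 3 + (ztp_var x ^+ 2 / 8)%:C * u ^+ 4) <= C5 * T ^+ 3.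
  apply: le_trans (le_normcD _ _) _; rewrite (normcM _ (u ^+ 3)) (normcM _ (u ^+ 4)) !normc_realC !normcX nu mE.
  rewrite (ger0_norm (_ : 0 <= ztp_mean x * ztp_var x / 2)); last first.
    by rewrite divr_ge0//; apply: mulr_ge0; lra.
  rewrite ger0_norm; last by rewrite mulr_ge0// sqr_ge0.
  rewrite /C5 [leRHS]mulrDl lerD//.
    by rewrite ler_wpM2r ?exprn_ge0//; nra.
  rewrite (_ : 8 * T ^+ 3 = 2 * (T ^+ 3 * 4)); last by ring.
  apply: ler_pM; [by rewrite divr_ge0// sqr_ge0|by rewrite exprn_ge0|by rewrite expr2; nra|].
  by rewrite exprSr ler_wpM2l ?exprn_ge0.
have tri (a b c d e : R[i]) (A B C D E : R) : normc a <= A -> normc b <= B ->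
   normc c <= C -> normc d <= D -> normc e <= E ->
   normc (a - b + c + d - e) <= A + B + C + D + E.
  clear => ? ? ? ? ?.
  have := le_normcD (a - b + c + d) (- e); have := le_normcD (a - b + c) d.
  have := le_normcD (a - b) c; have := le_normcD a (- b); rewrite !normcN; lra.
by apply: le_trans (tri _ _ _ _ _ _ _ _ _ _ b1 b2 b3 b4 b5) _; rewrite -!mulrDl.
Qed.
End CharacteristicExpansion.

(** * The local limit theorem *)

Section LocalLimitTheorem.
Context {R : realType}.
Implicit Types (t x : R) (k : nat).
Import Normc.

Lemma ccont_ztp_char x : ccont (ztp_char x).
Proof. by rewrite /ztp_char; ccont. Qed.

Lemma ccont_gauss_char x : ccont (gauss_char x).
Proof. by rewrite /gauss_char; ccont. Qed.

(** Both characteristic functions are dominated by exp(-c t^2). With K = k + 1, the cubic gap then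
    costs K times the third absolute moment of exp(-c K t^2), which is O(1/K). The factor [psi],
    there to admit shifts and one extra variable, costs a first absolute moment, again O(1/K). *)
Lemma local_limit (D L : R) : 0 <= D -> 0 <= L -> exists2 C : R, 0 <= C &
  forall x (psi : R -> R[i]) k (r : R),
  3^-1 <= x <= 1 -> ccont psi ->
  (forall t, - pi <= t <= pi -> normc (psi t - 1) <= D * `|t|) ->
  `|r| <= L * k.+1%:R ->
  `|intpi (fun t => Re (ztp_char x t ^+ k.+1 * psi t * cis (- (r * t)))) -
    Num.sqrt (pi *+ 2 / (k.+1%:R * ztp_var x)) *
    expR (- ((r - k.+1%:R * ztp_mean x) ^+ 2 / (2 * k.+1%:R * ztp_var x)))|
  <= C / k.+1%:R.
Proof.
move=> D0 L0; have [C0 C00 taylor] := @ztp_char_taylor R.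
have [c0 c300 _] := @ztp_rate_bounds R; set c : R := ztp_rate in c0 c300.
(* |tau| <= (L + 2) K, and K <= 180 b since the variance is at least 1/90. *)
pose L' : R := (L + 2) * 180.
pose C1 : R := D * (4 / c) + 4 * C0 * (16 / c ^+ 2).
exists (C1 + (L' + 1) * 180).
  have L'0 : 0 <= L' by rewrite /L'; lra.
  have C10 : 0 <= C1.
    by rewrite /C1 addr_ge0// !mulr_ge0// ?invr_ge0 ?exprn_ge0 ?(ltW c0).
  by lra.
move=> x psi k r x12 cpsi psiD rL.
have /andP[m1 m2] := ztp_mean_bounds x12; have /andP[v1 v2] := ztp_var_bounds x12.
set K : R := k.+1%:R; have K0 : 0 < K by rewrite ltr0n.
set b := K * ztp_var x / 2.
have b0 : 0 < b by rewrite /b; nra.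
have Kb : K <= 180 * b by rewrite /b; nra.
set tau := K * ztp_mean x - r.
have tauL : `|tau| <= L' * b.
  apply: le_trans (ler_normB _ _) _; rewrite ger0_norm; last by rewrite mulr_ge0//; lra.
  have h1 : K * ztp_mean x <= 2 * K by nra.
  have : (L + 2) * K <= (L + 2) * (180 * b) by rewrite ler_wpM2l// addr_ge0.
  by rewrite /L'; move: rL; rewrite -/K; lra.
have G := gauss_fourier b0 tauL.
have cz := ccont_ztp_char x; have cg := ccont_gauss_char x.
have gaussE t : gauss_char x t ^+ k.+1 * cis (- (r * t)) =
    cexp ((- (b * t ^+ 2)) +i* (tau * t)).
  rewrite cisE /gauss_char -cexpMn -cexpD; congr cexp.
  rewrite -[X in X + _ = _]mulr_natl -(rmorph_nat (real_complex R)) -/K.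
  by apply/eqP; rewrite eq_complex /= /b /tau; apply/andP; split; apply/eqP; field.
have -> : pi *+ 2 / (K * ztp_var x) = pi / b.
  by rewrite mulr2n /b; field; rewrite !lt0r_neq0//; lra.
have -> : (r - K * ztp_mean x) ^+ 2 / (2 * K * ztp_var x) = tau ^+ 2 / (4 * b).
  by rewrite /tau /b; field; rewrite !lt0r_neq0//; lra.
have main : `|intpi (fun t => Re (ztp_char x t ^+ k.+1 * psi t * cis (- (r * t)))) -
    intpi (fun t => expR (- (b * t ^+ 2)) * cos (tau * t))| <= C1 / K.
  rewrite -intpiB; [|by have [] : ccont (fun t => ztp_char x t ^+ k.+1 * psi t * cis (- (r * t))) by ccont|by cont].
  have E t : Re (ztp_char x t ^+ k.+1 * psi t * cis (- (r * t))) -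
      expR (- (b * t ^+ 2)) * cos (tau * t) =
      Re ((ztp_char x t ^+ k.+1 * psi t - gauss_char x t ^+ k.+1) * cis (- (r * t))).
    by rewrite [X in _ = Re X]mulrBl gaussE ReB.
  rewrite (eq_intpi E).
  have cK : 0 < c * K by rewrite mulr_gt0.
  have [M1 M3] := intpi_gauss_moments cK.
  apply: le_trans (_ : intpi (fun t => D * (`|t| * expR (- (c * K * t ^+ 2))) +
    (4 * C0 * K) * (`|t| ^+ 3 * expR (- (c * K * t ^+ 2)))) <= _); last first.
    rewrite intpiD ?intpiZ; [|by cont..].
    have h1 := ler_wpM2l D0 M1.
    have h2 : 4 * C0 * K * intpi (fun t => `|t| ^+ 3 * expR (- (c * K * t ^+ 2))) <=
       4 * C0 * K * (16 / (c * K) ^+ 2) by rewrite ler_wpM2l// !mulr_ge0// ltW.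
    apply: le_trans (lerD h1 h2) _; rewrite le_eqVlt; apply/orP; left; apply/eqP.
    by rewrite /C1; field; rewrite !lt0r_neq0.
  apply: normc_intpi_le; [by ccont|by cont|move=> t tpi].
  rewrite normcM normc_cis mulr1.
  set phi := ztp_char x t; set gam := gauss_char x t; set M := expR (- (c * t ^+ 2)).
  have phiM : normc phi <= M := ztp_char_le x12 tpi.
  have gamM : normc gam <= M := gauss_char_le t x12.
  have MK : M ^+ k.+1 = expR (- (c * K * t ^+ 2)).
    by rewrite /M -expRM_natl; congr expR; rewrite /K; ring.
  rewrite (_ : phi ^+ _ * psi t - _ = phi ^+ k.+1 * (psi t - 1) + (phi ^+ k.+1 - gam ^+ k.+1)); last by ring.
  apply: le_trans (le_normcD _ _) _; rewrite normcM normcX -MK; apply: lerD.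
    rewrite mulrA mulrC ler_pM ?normc_ge0 ?exprn_ge0 ?normc_ge0 ?psiD//.
    by rewrite lerXn2r ?nnegrE ?normc_ge0 ?expR_ge0.
  apply: le_trans (normc_exprB_le k phiM gamM) _.
  have T := taylor x t x12 tpi; rewrite -/phi -/gam in T.
  (* The difference of powers only leaves M^k; since M >= 1/4 for |t| <= pi, a factor 4 restores
     M^(k + 1). *)
  have M4 : 1 <= 4 * M.
    have t4 : t ^+ 2 <= 4 ^+ 2.
      rewrite -real_normK ?num_real// lerXn2r ?nnegrE// ler_norml.
      by have := @pi_le4 R; lra.
    have M1' : expR (- 1) <= M.
      by rewrite ler_expR lerN2; have := ler_pM (ltW c0) (sqr_ge0 t) c300 t4; lra.
    have := @expR1_le4 R; have := expRxMexpNx_1 (1 : R); have := expR_gt0 (- 1 : R).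
    by nra.
  have Mk : M ^+ k <= 4 * M ^+ k.+1.
    by rewrite exprS mulrA ler_peMl// exprn_ge0// expR_ge0.
  rewrite (_ : 4 * C0 * K * _ = K * (C0 * `|t| ^+ 3) * (4 * M ^+ k.+1)); last by ring.
  rewrite ler_pM ?mulr_ge0 ?normc_ge0 ?exprn_ge0 ?expR_ge0 ?(ltW K0)//.
  by rewrite ler_wpM2l// ltW.
set I1 := intpi _ in main *; set I2 := intpi _ in main G.
rewrite (_ : I1 - _ = (I1 - I2) + (I2 - Num.sqrt (pi / b) * expR (- (tau ^+ 2 / (4 * b))))); last by ring.
apply: le_trans (ler_normD _ _) _; rewrite [leRHS]mulrDl; apply: lerD => //.
apply: le_trans G _; rewrite ler_pdivrMr// mulrAC ler_pdivlMr//.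
rewrite -mulrA ler_wpM2l// /L'; lra.
Qed.

End LocalLimitTheorem.

(** * Sums of Gaussians compared with integrals *)

Section GaussSums.
Context {R : realType}.
Implicit Types (a b u v kap : R) (m n k : nat).

Lemma expRN_le_lorentz u : 0 <= u -> expR (- u) <= (1 + u)^-1.
Proof.
move=> u0; rewrite expRN lef_pV2 ?posrE ?expR_gt0//; last by lra.
exact: expR_ge1Dx.
Qed.

Lemma norm_gauss_le_lorentz v : `|v| * expR (- v ^+ 2) <= 4 / (1 + v ^+ 2).
Proof.
have v20 := sqr_ge0 v.
rewrite expRN ler_pdivrMr ?expR_gt0// mulrAC ler_pdivlMr; last by lra.
have := @expR_geD_sqr _ (v ^+ 2) ltac:(lra).
have : `|v| <= 1 + v ^+ 2.
  by rewrite -(@real_normK _ v) ?num_real//; have := normr_ge0 v; nra.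
have := normr_ge0 v; nra.
Qed.

(** A Lorentzian, unlike a Gaussian, changes by a bounded factor over a bounded step, whatever the
    distance to its peak. Sums therefore compare with integrals without a case split at the peak. *)
Lemma lorentz_shift b (s t : R) : 0 < b <= 1 -> `|s - t| <= 2 ->
  (1 + b * s ^+ 2)^-1 <= 9 / (1 + b * t ^+ 2).
Proof.
move=> /andP[b0 b1] st.
have s0 := mulr_ge0 (ltW b0) (sqr_ge0 s); have t0 := mulr_ge0 (ltW b0) (sqr_ge0 t).
rewrite -[_^-1]mul1r ler_pdivrMr; last by lra.
rewrite mulrAC ler_pdivlMr; last by lra.
have : (s - t) ^+ 2 <= 2 ^+ 2 by rewrite -real_normK ?num_real// lerXn2r ?nnegrE.
move=> h; have : b * (s - t) ^+ 2 <= 4 by have := sqr_ge0 (s - t); nra.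
have := mulr_ge0 (ltW b0) (sqr_ge0 (t - 2 * s)); rewrite !expr2; nra.
Qed.

(** Compared with a primitive by arctan, of total variation pi <= 4 before scaling; 36 = 9 * 4 with
    the 9 of [lorentz_shift]. *)
Lemma lorentz_sum b kap m n : 0 < b <= 1 ->
  \sum_(m <= k < n) (1 + b * (k%:R - kap) ^+ 2)^-1 <= 36 / Num.sqrt b.
Proof.
move=> b01; have /andP[b0 b1] := b01; have sb0 : 0 < Num.sqrt b by rewrite sqrtr_gt0.
have bsb : Num.sqrt b ^+ 2 = b by rewrite sqr_sqrtr// ltW.
set a := Num.sqrt b in sb0 bsb *.
pose F (t : R) := a^-1 * atan (a * (t - kap)).
have dF t : has_deriv F t (1 + b * (t - kap) ^+ 2)^-1.
  apply: der_eq; first by apply: derM; [der|apply: (@der_comp _ atan); [exact: is_derive1_atan|der]].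
  have Q : 1 + b * (t - kap) ^+ 2 != 0.
    by apply: lt0r_neq0; have := mulr_ge0 (ltW b0) (sqr_ge0 (t - kap)); lra.
  by rewrite /= exprMn bsb; field; rewrite Q lt0r_neq0.
have step k : (1 + b * (k%:R - kap) ^+ 2)^-1 <= 9 * (F k.+1%:R - F k%:R).
  have [|c /andP[kc ck] ->] := @mean_value _ F _ k%:R k.+1%:R _ (fun x _ => dF x).
    by rewrite ler_nat.
  have -> : k.+1%:R - k%:R = 1 :> R by rewrite -natr1; ring.
  rewrite mulr1; apply: lorentz_shift => //.
  by rewrite ler_norml; move: ck; rewrite -natr1; lra.
have [mn|/ltnW nm] := leqP m n; last first.
  by rewrite big_geq// divr_ge0 ?(ltW sb0).
apply: le_trans (ler_sum_nat (fun k _ => step k)) _.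
rewrite -mulr_sumr telescope_sumr// /F -mulrBr mulrCA mulrC ler_pM2r ?invr_gt0//.
have := atan_ltpi2 (a * (n%:R - kap)); have := atan_gtNpi2 (a * (m%:R - kap)).
by have := @pi_le4 R; lra.
Qed.

Lemma norm_gauss_sum b kap m n : 0 < b <= 1 ->
  \sum_(m <= k < n) `|k%:R - kap| * expR (- (b * (k%:R - kap) ^+ 2)) <= 144 / b.
Proof.
move=> b01; have /andP[b0 b1] := b01; have sb0 : 0 < Num.sqrt b by rewrite sqrtr_gt0.
have bsb : Num.sqrt b ^+ 2 = b by rewrite sqr_sqrtr// ltW.
apply: le_trans (_ : \sum_(m <= k < n) 4 / Num.sqrt b * (1 + b * (k%:R - kap) ^+ 2)^-1 <= _).
  apply: ler_sum_nat => k _; have := norm_gauss_le_lorentz (Num.sqrt b * (k%:R - kap)).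
  rewrite exprMn bsb normrM (ger0_norm (ltW sb0)) -[X in X <= _]mulrA -ler_pdivlMl//.
  by move=> /le_trans; apply; rewrite le_eqVlt; apply/orP; left; apply/eqP; ring.
rewrite -mulr_sumr; apply: le_trans (_ : 4 / Num.sqrt b * (36 / Num.sqrt b) <= _).
  by rewrite ler_wpM2l ?lorentz_sum// divr_ge0// ltW.
rewrite -[X in _ <= _ / X]bsb le_eqVlt; apply/orP; left; apply/eqP; field.
exact: lt0r_neq0.
Qed.

Lemma gauss_sum_le b kap m n : 0 < b <= 1 ->
  \sum_(m <= k < n) expR (- (b * (k%:R - kap) ^+ 2)) <= 36 / Num.sqrt b.
Proof.
move=> b01; have /andP[b0 _] := b01; apply: le_trans (lorentz_sum kap m n b01).
by apply: ler_sum_nat => k _; rewrite expRN_le_lorentz// mulr_ge0 ?sqr_ge0// ltW.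
Qed.

(** Each term differs from the integral over its unit interval by at most sqrt(b) times a
    Lorentzian, so the errors add up to O(1) uniformly in b. The two reciprocals bound the tails
    outside [m, n]. *)
Lemma gauss_sum b kap m n : 0 < b <= 1 -> m%:R < kap < n%:R ->
  `|\sum_(m <= k < n) expR (- (b * (k%:R - kap) ^+ 2)) - Num.sqrt (pi / b)| <=
  72 * 36 + ((kap - m%:R)^-1 + (n%:R - kap)^-1) / b.
Proof.
move=> b01 /andP[mk kn]; have /andP[b0 b1] := b01.
have sb0 : 0 < Num.sqrt b by rewrite sqrtr_gt0.
have bsb : Num.sqrt b ^+ 2 = b by rewrite sqr_sqrtr// ltW.
rewrite sqrtrM ?pi_ge0// sqrtrV ?(ltW b0)//.
set a := Num.sqrt b in sb0 bsb *.
have [E [dE oddE tailE]] := @gauss_primitive R.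
pose F (t : R) := a^-1 * E (a * (t - kap)).
have dF t : has_deriv F t (expR (- (b * (t - kap) ^+ 2))).
  apply: der_eq; first by apply: derM; [der|apply: (@der_comp _ E); [exact: dE|der]].
  by rewrite /= exprMn bsb; field; rewrite lt0r_neq0.
(* 72 = 2 * 4 * 9: the derivative is 2 sqrt(b) times v exp(-v^2) up to sign, then
   [norm_gauss_le_lorentz] and [lorentz_shift]. *)
have step k : `|expR (- (b * (k%:R - kap) ^+ 2)) - (F k.+1%:R - F k%:R)| <=
    72 * a * (1 + b * (k%:R - kap) ^+ 2)^-1.
  have [|c /andP[kc ck] ->] := @mean_value _ F _ k%:R k.+1%:R _ (fun x _ => dF x).
    by rewrite ler_nat.
  have k1 : k.+1%:R - k%:R = 1 :> R by rewrite -natr1; ring.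
  rewrite k1 mulr1.
  apply: le_trans (_ : 72 * a * (1 + b * (k%:R - kap) ^+ 2)^-1 * `|k%:R - c| <= _); last first.
    rewrite ler_piMr//; last by rewrite ler_norml; lra.
    have := mulr_ge0 (ltW b0) (sqr_ge0 (k%:R - kap)) => ?.
    by rewrite !mulr_ge0 ?invr_ge0 ?(ltW sb0)//; lra.
  apply: (@mean_value_norm _ (fun t => expR (- (b * (t - kap) ^+ 2)))
    (fun t => - 2 * b * (t - kap) * expR (- (b * (t - kap) ^+ 2)))).
    by move=> x _; der_to; ring.
  move=> x xc; have xk : `|(x - kap) - (k%:R - kap)| <= 2.
    move: xc; rewrite [`|k%:R - c|]ler0_norm ?subr_le0// !ler_norml.
    by move=> /andP[? ?]; apply/andP; split; lra.
  have := lorentz_shift b01 xk; have := norm_gauss_le_lorentz (a * (x - kap)).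
  rewrite exprMn bsb !normrM normrN normr_nat (ger0_norm (ltW b0)) (ger0_norm (ltW sb0)).
  rewrite (ger0_norm (expR_ge0 _)) => h1 h2.
  have -> : 2 * b * `|x - kap| * expR (- (b * (x - kap) ^+ 2)) =
     2 * a * (a * `|x - kap| * expR (- (b * (x - kap) ^+ 2))) by rewrite -{1}bsb; ring.
  apply: le_trans (ler_wpM2l _ h1) _; first by rewrite mulr_ge0// ltW.
  have : a * (1 + b * (x - kap) ^+ 2)^-1 <= a * (9 / (1 + b * (k%:R - kap) ^+ 2)).
    by rewrite ler_wpM2l// ltW.
  by lra.
have mn : (m <= n)%N by rewrite -(ler_nat R); lra.
have S1 : `|\sum_(m <= k < n) expR (- (b * (k%:R - kap) ^+ 2)) - (F n%:R - F m%:R)| <= 72 * 36.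
  rewrite -(telescope_sumr (fun k => F k%:R) mn) -sumrB; apply: le_trans (ler_norm_sum _ _ _) _.
  apply: le_trans (ler_sum_nat (fun k _ => step k)) _.
  rewrite -mulr_sumr; apply: le_trans (ler_wpM2l _ (lorentz_sum kap m n b01)) _.
    by rewrite mulr_ge0// ltW.
  by rewrite -/a le_eqVlt; apply/orP; left; apply/eqP; field; rewrite lt0r_neq0.
have tail (d : R) : 0 < d -> `|a^-1 * E (a * d) - a^-1 * (Num.sqrt pi / 2)| <= d^-1 / b.
  move=> d0; have /andP[t1 t2] := tailE _ (mulr_gt0 sb0 d0).
  rewrite -mulrBr normrM distrC (ger0_norm t1) ger0_norm; last by rewrite invr_ge0 ltW.
  apply: le_trans (ler_wpM2l _ t2) _; first by rewrite invr_ge0 ltW.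
  by rewrite -[X in _ <= _ / X]bsb le_eqVlt; apply/orP; left; apply/eqP; field; rewrite !lt0r_neq0.
have T1 := tail (n%:R - kap) ltac:(lra); have T2 := tail (kap - m%:R) ltac:(lra).
have Fm : F m%:R = - (a^-1 * E (a * (kap - m%:R))).
  by rewrite /F -(opprB kap) mulrN oddE mulrN.
set S := \sum_(m <= k < n) _ in S1 *.
rewrite (_ : S - _ = (S - (F n%:R - F m%:R)) +
   ((a^-1 * E (a * (n%:R - kap)) - a^-1 * (Num.sqrt pi / 2)) +
    (a^-1 * E (a * (kap - m%:R)) - a^-1 * (Num.sqrt pi / 2)))); last first.
  by rewrite Fm /F; field; rewrite lt0r_neq0.
apply: le_trans (ler_normD _ _) (lerD S1 _).
by apply: le_trans (ler_normD _ _) _; rewrite mulrDl [leRHS]addrC lerD.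
Qed.

End GaussSums.

(** * The count as a sum of products of Fourier coefficients *)

Section Coefficients.
Context {R : realType}.
Implicit Types (t x y : R) (k p q m : nat).
Import Normc.

(* With [psi = cis] and [r = p + 1] this is the probability that a sum of [k]
   zero-truncated Poisson variables equals [p]; with [psi = poisson_twist x] and
   [r = q], that such a sum plus an independent Poisson(x) variable equals [q + 1]. *)
Definition zcoef x (psi : R -> R[i]) k (r : R) : R :=
  (pi *+ 2)^-1 * intpi (fun t => Re (ztp_char x t ^+ k * psi t * cis (- (r * t)))).

(** Characteristic function of N - 1 for N Poisson(y). The unit shifts here and in [cis] turn the
    targets p and q + 1 into p + 1 = r and q = s, whose ratio is the one that defines x and y. *)
Definition poisson_twist y t : R[i] := cexp (y%:C * (cis t - 1)) * cis (- t).

Lemma expcis_twist y t : expcis y t = (expR y)%:C * cexp (y%:C * (cis t - 1)).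
Proof.
have -> : (expR y)%:C = cexp y%:C by rewrite /cexp /= cos0 sin0 mulr1 mulr0.
by rewrite -cexpD; congr cexp; ring.
Qed.

Lemma expcisB1 x t : 0 < x -> expcis x t - 1 = (expR x - 1)%:C * ztp_char x t.
Proof.
move=> x0; rewrite /ztp_char mulrA -rmorphM divff ?rmorph1 ?mul1r//.
by rewrite subr_eq0 gt_eqF// expR_gt1.
Qed.

Lemma Re_realM (a : R) (z : R[i]) : Re (a%:C * z) = a * Re z.
Proof. by rewrite ReM /= mul0r subr0. Qed.

Lemma surjn_zcoef x p k : 0 < x ->
  surjn R p k = p`!%:R / x ^+ p * (expR x - 1) ^+ k * zcoef x cis k p.+1%:R.
Proof.
move=> x0; rewrite /zcoef.
have -> : intpi (fun t => Re (ztp_char x t ^+ k * cis t * cis (- (p.+1%:R * t)))) =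
    (expR x - 1) ^- k * intpi (fun t => Re (expcis x t ^+ 0 * (expcis x t - 1) ^+ k * cis (- (p%:R * t)))).
  have cc : ccont (fun t => expcis x t ^+ 0 * (expcis x t - 1) ^+ k * cis (- (p%:R * t))) by ccont.
  rewrite -intpiZ; last by case: cc.
  apply: eq_intpi => t; rewrite expcisB1// -Re_realM; congr Re.
  rewrite -[LHS]mulrA -cisD (_ : t + - (p.+1%:R * t) = - (p%:R * t)); last first.
    by rewrite -natr1; ring.
  rewrite (fmorphV (real_complex R)) rmorphXn [(_ * ztp_char x t) ^+ k]exprMn expr0.
  set E1 := (expR x - 1)%:C.
  have E1N : E1 != 0 by rewrite fmorph_eq0 subr_eq0 gt_eqF// expR_gt1.
  by field; rewrite expf_neq0.
rewrite fourier_fdiff /surjn.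
have e0 : expR x - 1 != 0 by rewrite subr_eq0 gt_eqF// expR_gt1.
have p0 : pi *+ 2 != 0 :> R by rewrite mulrn_eq0/= gt_eqF// pi_gt0.
have f0 : p`!%:R != 0 :> R by rewrite pnatr_eq0 -lt0n fact_gt0.
set G := fdiff _ _ _; move: (pi *+ 2) p0 => P p0; field.
by rewrite f0 p0 !expf_neq0 ?(lt0r_neq0 x0).
Qed.

Lemma fdiff1_zcoef y m k : 0 < y ->
  fdiff (fun j => j%:R ^+ m.+1) k 1 =
  m.+1`!%:R / y ^+ m.+1 * expR y * (expR y - 1) ^+ k * zcoef y (poisson_twist y) k m%:R :> R.
Proof.
move=> y0; rewrite /zcoef.
have -> : intpi (fun t => Re (ztp_char y t ^+ k * poisson_twist y t * cis (- (m%:R * t)))) =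
    ((expR y - 1) ^- k / expR y) * intpi (fun t => Re (expcis y t ^+ 1 * (expcis y t - 1) ^+ k * cis (- (m.+1%:R * t)))).
  have cc : ccont (fun t => expcis y t ^+ 1 * (expcis y t - 1) ^+ k * cis (- (m.+1%:R * t))) by ccont.
  rewrite -intpiZ; last by case: cc.
  apply: eq_intpi => t; rewrite expcisB1// -Re_realM; congr Re.
  rewrite [(_ * ztp_char y t) ^+ k]exprMn expr1 expcis_twist /poisson_twist.
  have -> : - (m.+1%:R * t) = - t + - (m%:R * t) by rewrite -natr1; ring.
  rewrite cisD rmorphM !(fmorphV (real_complex R)) rmorphXn.
  set E := (expR y)%:C; set E1 := (expR y - 1)%:C.
  have EN : E != 0 by rewrite fmorph_eq0 gt_eqF// expR_gt0.
  have E1N : E1 != 0 by rewrite fmorph_eq0 subr_eq0 gt_eqF// expR_gt1.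
  by field; rewrite EN expf_neq0.
rewrite fourier_fdiff.
have e0 : expR y - 1 != 0 by rewrite subr_eq0 gt_eqF// expR_gt1.
have e1 : expR y != 0 by rewrite gt_eqF// expR_gt0.
have p0 : pi *+ 2 != 0 :> R by rewrite mulrn_eq0/= gt_eqF// pi_gt0.
have f0 : m.+1`!%:R != 0 :> R by rewrite pnatr_eq0 -lt0n fact_gt0.
set G := fdiff _ _ _; move: (pi *+ 2) p0 => P p0.
set Y := y ^+ m.+1; have Y0 : Y != 0 by rewrite expf_neq0// lt0r_neq0.
set M := m.+1`!%:R in f0 *; set W := (expR y - 1) ^+ k.
have W0 : W != 0 by rewrite expf_neq0.
by field; rewrite f0 p0 Y0 W0 e1.
Qed.

Lemma ba_count_zcoef x y p q : 0 < x -> 0 < y -> (expR x - 1) * (expR y - 1) = 1 ->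
  (ba_count p q)%:R = p`!%:R * q.+1`!%:R / (x ^+ p * y ^+ q.+1) * expR y *
  \sum_(k < p.+1) zcoef x cis k p.+1%:R * zcoef y (poisson_twist y) k q%:R :> R.
Proof.
move=> x0 y0 xy; rewrite ba_countE mulr_sumr; apply: eq_bigr => k _.
rewrite (surjn_zcoef _ _ x0) (fdiff1_zcoef _ _ y0) invfM.
transitivity (p`!%:R * q.+1`!%:R * (x ^- p * y ^- q.+1) * expR y *
  (((expR x - 1) * (expR y - 1)) ^+ k) * (zcoef x cis k p.+1%:R * zcoef y (poisson_twist y) k q%:R)).
  by rewrite exprMn; ring.
by rewrite xy expr1n mulr1.
Qed.

Lemma zcoef_le1 x psi k (r : R) : 3^-1 <= x <= 1 -> ccont psi ->
  (forall t, normc (psi t) <= 1) -> `|zcoef x psi k r| <= 1.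
Proof.
move=> x12 cpsi psi1; rewrite /zcoef normrM.
have P0 : 0 < pi *+ 2 :> R by rewrite pmulrn_lgt0// pi_gt0.
rewrite normfV (gtr0_norm P0) ler_pdivrMl// -intpi_cst.
have cz := ccont_ztp_char x.
apply: normc_intpi_le; [by ccont|by cont|move=> t tpi].
rewrite !normcM normc_cis mulr1 normcX mulr_ile1 ?exprn_ge0 ?normc_ge0//.
rewrite exprn_ile1 ?normc_ge0//; apply: le_trans (ztp_char_le x12 tpi) _.
have [r0 _ _] := @ztp_rate_bounds R.
by rewrite expR_le1 oppr_le0 mulr_ge0 ?sqr_ge0// ltW.
Qed.

Lemma ccont_poisson_twist y : ccont (poisson_twist y).
Proof. by rewrite /poisson_twist; ccont. Qed.

Lemma normc_twist_exp y t : 0 <= y -> normc (cexp (y%:C * (cis t - 1))) <= 1.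
Proof.
move=> y0; rewrite normc_cexp Re_realM ReB /= expR_le1.
by rewrite mulr_ge0_le0// subr_le0 cos_le1.
Qed.

Lemma normc_poisson_twist y t : 0 <= y -> normc (poisson_twist y t) <= 1.
Proof. by move=> y0; rewrite normcM normc_cis mulr1 normc_twist_exp. Qed.

Lemma normc_cisB1_le t : - pi <= t <= pi -> normc (cis t - 1) <= 3 * expR 4 * `|t|.
Proof. by move=> /normc_cis_taylor[]. Qed.

Lemma normc_poisson_twistB1 : exists2 D : R, 0 <= D & forall y t,
  3^-1 <= y <= 1 -> - pi <= t <= pi -> normc (poisson_twist y t - 1) <= D * `|t|.
Proof.
pose e4 : R := expR 4; have e40 : 0 < e4 by exact: expR_gt0.
have eB0 := expR_gt0 (12 * e4).
exists (3 * e4 + 3 * expR (12 * e4) * (3 * e4)).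
  by rewrite addr_ge0// ?mulr_ge0// ltW.
move=> y t /andP[y1 y2] tpi; rewrite /poisson_twist; set w := y%:C * _.
have t4 : `|t| <= 4 by rewrite ler_norml; have := @pi_le4 R; lra.
have w3 : normc w <= 3 * e4 * `|t|.
  rewrite normcM normc_realC ger0_norm; last by lra.
  have := normc_cisB1_le tpi; rewrite -/e4; have := normc_ge0 (cis t - 1); nra.
have wB : normc w <= 12 * e4.
  apply: le_trans w3 _; rewrite (_ : 12 * e4 = 3 * e4 * 4); last by ring.
  by rewrite ler_wpM2l// mulr_ge0// ltW.
rewrite (_ : _ - 1 = cexp w * (cis (- t) - 1) + (cexp w - 1)); last by ring.
apply: le_trans (le_normcD _ _) _; rewrite [leRHS]mulrDl; apply: lerD.
  rewrite normcM -[leRHS]mul1r ler_pM ?normc_ge0// ?normc_twist_exp//; first by lra.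
  by rewrite -normrN normc_cisB1_le//; lra.
apply: le_trans (normc_cexp1_le wB) _.
rewrite [leRHS](_ : _ = 3 * expR (12 * e4) * (3 * e4 * `|t|)); last by ring.
by rewrite ler_wpM2l// mulr_ge0// ltW.
Qed.

(** The same coefficient is computed on the circle of radius 2x: this gains 2^(-p) and costs at most
    a factor (1 + e^2) / (e^x - 1) <= 17 * 3 <= 64 for each of the k factors. *)
Lemma zcoef_small x p k : 3^-1 <= x <= 1 ->
  `|zcoef x cis k p.+1%:R| <= 2^-1 ^+ p * 64 ^+ k.
Proof.
move=> /andP[x1 x2]; have x0 : 0 < x by lra.
have e0 : 0 < expR x - 1 by rewrite subr_gt0 expR_gt1.
have f0 : 0 < p`!%:R :> R by rewrite ltr0n fact_gt0.
have P0 : 0 < pi *+ 2 :> R by rewrite pmulrn_lgt0// pi_gt0.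
have zE : zcoef x cis k p.+1%:R = x ^+ p / p`!%:R / (expR x - 1) ^+ k * surjn R p k.
  rewrite (surjn_zcoef p k x0); set Z := zcoef _ _ _ _; field.
  by rewrite !expf_neq0 !lt0r_neq0.
have := fourier_fdiff (2 * x) p k 0; set I := intpi _ => IE.
have sE : surjn R p k = p`!%:R / (2 * x) ^+ p * ((pi *+ 2)^-1 * I).
  rewrite IE -/(surjn R p k); move: (pi *+ 2) P0 {IE} => P P0; field.
  by rewrite expf_neq0 !lt0r_neq0//= mulr_gt0.
have Ile : `|I| <= pi *+ 2 * 17 ^+ k.
  rewrite -intpi_cst; apply: normc_intpi_le; [by ccont|by cont|move=> t _].
  rewrite expr0 mul1r normcM normc_cis mulr1 normcX lerXn2r ?nnegrE ?normc_ge0//.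
  apply: le_trans (le_normcD _ _) _; rewrite normcN normc1 normc_expcis.
  have h : expR (2 * x * cos t) <= expR 2.
    rewrite ler_expR; have := cos_le1 t; have := cos_geN1 t; nra.
  have : expR 2 <= 16 :> R.
    rewrite (_ : 2 = 1 + 1)// expRD; have := @expR1_le4 R; have := expR_gt0 (1 : R); nra.
  lra.
rewrite zE sE.
have -> : x ^+ p / p`!%:R / (expR x - 1) ^+ k * (p`!%:R / (2 * x) ^+ p * ((pi *+ 2)^-1 * I)) =
    2^-1 ^+ p * ((expR x - 1) ^- k * ((pi *+ 2)^-1 * I)).
  rewrite exprMn exprVn; move: (pi *+ 2) P0 {IE Ile sE} => P P0; field.
  by rewrite !expf_neq0 ?lt0r_neq0.
rewrite normrM ger0_norm ?exprn_ge0 ?invr_ge0// ler_wpM2l ?exprn_ge0 ?invr_ge0//.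
rewrite normrM ger0_norm ?invr_ge0 ?exprn_ge0 ?(ltW e0)//.
rewrite ler_pdivrMl ?exprn_gt0// normrM normfV (gtr0_norm P0) ler_pdivrMl//.
apply: le_trans Ile _; rewrite ler_wpM2l ?(ltW P0)// -exprMn.
rewrite lerXn2r ?nnegrE ?mulr_ge0 ?(ltW e0)//.
by have := expR_ge1Dx x; lra.
Qed.

End Coefficients.

(** * Gaussian sums whose variance depends on the index *)

Section ProfileSum.
Context {R : realType}.
Implicit Types (A kap d u : R) (m n k : nat).

(** Only points between a and b are used, unlike in [mean_value_norm]: the symmetric ball about
    [kap] could reach 0, where the profile is singular. *)
Lemma mean_value_between (f f' : R -> R) (a b M : R) :
  (forall x, Num.min a b <= x <= Num.max a b -> has_deriv f x (f' x)) ->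
  (forall x, Num.min a b <= x <= Num.max a b -> `|f' x| <= M) ->
  `|f b - f a| <= M * `|b - a|.
Proof.
move=> df fM; have [ab|/ltW ba] := leP a b.
  rewrite (min_idPl ab) (max_idPr ab) in df fM.
  have [c cab ->] := mean_value ab df.
  by rewrite normrM ler_wpM2r// fM.
rewrite (min_idPr ba) (max_idPl ba) in df fM.
have [c cab E] := mean_value ba df.
by rewrite distrC E distrC normrM ler_wpM2r// fM.
Qed.

(** With v = A d^2 / u the left side is |v - 1| e^(-v) / u^2, and (1 + v) e^(-v) <= 2 e^(-v/2). The
    bound u <= 2 kap produces the exponent, u >= kap / 12 the factor 2 * 12^2 = 288. *)
Lemma expR_profile_deriv A d kap u : 0 < A -> kap / 12 <= u <= 2 * kap -> 0 < kap ->
  `|(- u ^- 2 + A * d ^+ 2 / u ^+ 3) * expR (- (A * d ^+ 2 / u))| <=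
  288 / kap ^+ 2 * expR (- (A / (4 * kap) * d ^+ 2)).
Proof.
move=> A0 /andP[u1 u2] k0; have u0 : 0 < u by lra.
set v := A * d ^+ 2 / u.
have v0 : 0 <= v by rewrite divr_ge0 ?(ltW u0)// mulr_ge0 ?sqr_ge0// ltW.
have -> : - u ^- 2 + A * d ^+ 2 / u ^+ 3 = u ^- 2 * (v - 1).
  by rewrite /v; field; rewrite lt0r_neq0.
rewrite !normrM (ger0_norm (expR_ge0 _)) ger0_norm; last by rewrite invr_ge0 exprn_ge0 ?ltW.
have h1 : `|v - 1| * expR (- v) <= 2 * expR (- (v / 2)).
  apply: le_trans (_ : (1 + v) * expR (- v) <= _).
    by rewrite ler_wpM2r ?expR_ge0// ler_norml; lra.
  rewrite (_ : - v = - (v / 2) + - (v / 2)); last by field.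
  rewrite expRD mulrA ler_wpM2r ?expR_ge0// expRN ler_pdivrMr ?expR_gt0//.
  by have := expR_ge1Dx (v / 2); lra.
have h2 : expR (- (v / 2)) <= expR (- (A / (4 * kap) * d ^+ 2)).
  rewrite ler_expR lerN2 /v.
  rewrite (_ : A / (4 * kap) * d ^+ 2 = A * d ^+ 2 / (4 * kap)); last by field; rewrite lt0r_neq0.
  rewrite (_ : A * d ^+ 2 / u / 2 = A * d ^+ 2 / (2 * u)); last by field; rewrite lt0r_neq0.
  apply: ler_wpM2l; first by rewrite mulr_ge0 ?sqr_ge0 ?(ltW A0).
  by rewrite lef_pV2 ?posrE ?mulr_gt0//; lra.
have h3 : u ^- 2 <= 144 / kap ^+ 2.
  rewrite ler_pdivlMr ?exprn_gt0// ler_pdivrMl ?exprn_gt0//.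
  have : (kap / 12) ^+ 2 <= u ^+ 2 by rewrite lerXn2r ?nnegrE//; lra.
  by rewrite exprMn exprVn => h; have -> : 144 = 12 ^+ 2 :> R by [ring]; move: h; rewrite ler_pdivrMr ?exprn_gt0//; lra.
have x1 : 0 <= u ^- 2 by rewrite invr_ge0 exprn_ge0// ltW.
have x2 : 0 <= `|v - 1| * expR (- v) by rewrite mulr_ge0 ?expR_ge0.
have h4 : `|v - 1| * expR (- v) <= 2 * expR (- (A / (4 * kap) * d ^+ 2)) by lra.
rewrite -mulrA; apply: le_trans (ler_pM x1 x2 h3 h4) _.
by rewrite le_eqVlt; apply/orP; left; apply/eqP; ring.
Qed.

Lemma profile_diff A kap k : 0 < A -> 0 < kap -> kap / 12 <= k%:R <= 2 * kap ->
  `|k%:R^-1 * expR (- (A * (k%:R - kap) ^+ 2 / k%:R)) -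
    kap^-1 * expR (- (A * (k%:R - kap) ^+ 2 / kap))| <=
  288 / kap ^+ 2 * (`|k%:R - kap| * expR (- (A / (4 * kap) * (k%:R - kap) ^+ 2))).
Proof.
move=> A0 k0 /andP[k1 k2]; set d := k%:R - kap.
rewrite [leRHS](_ : _ = 288 / kap ^+ 2 * expR (- (A / (4 * kap) * d ^+ 2)) * `|d|); last by ring.
have k00 : 0 < k%:R :> R by lra.
apply: (@mean_value_between (fun u => u^-1 * expR (- (A * d ^+ 2 / u)))
  (fun u => (- u ^- 2 + A * d ^+ 2 / u ^+ 3) * expR (- (A * d ^+ 2 / u)))) => u /andP[u1 u2].
  have u0 : 0 < u by apply: lt_le_trans u1; rewrite lt_min k0.
  apply: der_eq.
    by apply: derM; [apply: derV; [exact: lt0r_neq0|der]|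
      apply: der_expR; apply: derN; apply: derM; [der|apply: derV; [exact: lt0r_neq0|der]]].
  by rewrite /=; field; rewrite lt0r_neq0.
apply: expR_profile_deriv => //; apply/andP; split.
  by apply: le_trans u1; rewrite le_min k1 andbT; lra.
by apply: le_trans u2 _; rewrite ge_max k2 andbT; lra.
Qed.

(** The index k is first frozen to [kap] outside the deviation, at the cost of a first moment; then
    [gauss_sum] applies. The tails give 152 = 4 * (2 + 36), with 2 and 36 from the distances of
    [kap] to m and n. *)
Lemma gauss_profile_sum A kap m n : 4^-1 <= A -> A <= kap ->
  kap / 12 <= m%:R <= kap / 2 -> kap * (1 + 36^-1) <= n%:R <= 2 * kap ->
  `|\sum_(m <= k < n) k%:R^-1 * expR (- (A * (k%:R - kap) ^+ 2 / k%:R)) -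
    kap^-1 * Num.sqrt (pi / (A / kap))| <= (288 * 144 * 16 + 72 * 36 + 152) / kap.
Proof.
move=> A4 Ak /andP[m1 m2] /andP[n1 n2].
have A0 : 0 < A by lra. have k0 : 0 < kap by lra.
have b1 : 0 < A / (4 * kap) <= 1.
  by rewrite divr_gt0 ?mulr_gt0//= ler_pdivrMr ?mulr_gt0//; lra.
have b2 : 0 < A / kap <= 1 by rewrite divr_gt0//= ler_pdivrMr// mul1r.
have S1 : `|\sum_(m <= k < n) k%:R^-1 * expR (- (A * (k%:R - kap) ^+ 2 / k%:R)) -
    \sum_(m <= k < n) kap^-1 * expR (- (A / kap * (k%:R - kap) ^+ 2))| <= 288 * 144 * 16 / kap.
  rewrite -sumrB; apply: le_trans (ler_norm_sum _ _ _) _.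
  apply: le_trans (_ : \sum_(m <= k < n) 288 / kap ^+ 2 * (`|k%:R - kap| * expR (- (A / (4 * kap) * (k%:R - kap) ^+ 2))) <= _).
    apply: ler_sum_nat => k /andP[mk kn].
    rewrite (_ : A / kap * _ = A * (k%:R - kap) ^+ 2 / kap); last by ring.
    apply: profile_diff => //.
    move: mk kn; rewrite -(ler_nat R) -(ltr_nat R) => mk kn.
    by apply/andP; split; lra.
  have q0 : 0 <= 288 / kap ^+ 2 by rewrite divr_ge0 ?ler0n ?sqr_ge0.
  rewrite -mulr_sumr; apply: le_trans (ler_wpM2l q0 (norm_gauss_sum kap m n b1)) _.
  rewrite [leLHS](_ : _ = 288 * 144 * 4 / kap * A^-1); last by field; rewrite !lt0r_neq0.
  rewrite (_ : 288 * 144 * 16 / kap = 288 * 144 * 4 / kap * 4); last by ring.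
  apply: ler_wpM2l; first by rewrite divr_ge0 ?(ltW k0) -?natrM ?ler0n.
  by rewrite invf_ple ?posrE.
have S2 : `|\sum_(m <= k < n) kap^-1 * expR (- (A / kap * (k%:R - kap) ^+ 2)) -
    kap^-1 * Num.sqrt (pi / (A / kap))| <= (72 * 36 + 152) / kap.
  rewrite -mulr_sumr -mulrBr normrM gtr0_norm ?invr_gt0// mulrC ler_wpM2r ?invr_ge0 ?(ltW k0)//.
  apply: le_trans (gauss_sum b2 _) _; first by apply/andP; split; lra.
  rewrite lerD2l invf_div.
  have h1 : (kap - m%:R)^-1 <= 2 / kap.
    by rewrite -[2 / kap]invf_div lef_pV2 ?posrE ?divr_gt0//; lra.
  have h2 : (n%:R - kap)^-1 <= 36 / kap.
    by rewrite -[36 / kap]invf_div lef_pV2 ?posrE ?divr_gt0//; lra.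
  have q0 : 0 <= kap / A by rewrite divr_ge0 ?ltW.
  apply: le_trans (ler_wpM2r q0 (lerD h1 h2)) _.
  rewrite [leLHS](_ : _ = 38 * A^-1); last by field; rewrite !lt0r_neq0.
  have : A^-1 <= 4 by rewrite invf_ple ?posrE.
  by lra.
set X := \sum_(m <= k < n) _ in S1 *; set Y := \sum_(m <= k < n) _ in S1 S2.
rewrite (_ : X - _ = (X - Y) + (Y - kap^-1 * Num.sqrt (pi / (A / kap)))); last by ring.
apply: le_trans (ler_normD _ _) _; apply: le_trans (lerD S1 S2) _.
by rewrite -mulrDl -!addrA.
Qed.

End ProfileSum.

(** * Gaussian approximation of the coefficients *)

Section GaussianCoefficients.
Context {R : realType}.
Implicit Types (x y kap : R) (k p s m n : nat).
Import Normc.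

(** The normal density at r with mean k [ztp_mean x] and variance k [ztp_var x], in the
    normalisation of [local_limit]. *)
Definition zgauss x k (r : R) : R := (pi *+ 2)^-1 *
  (Num.sqrt (pi *+ 2 / (k%:R * ztp_var x)) *
   expR (- ((r - k%:R * ztp_mean x) ^+ 2 / (2 * k%:R * ztp_var x)))).

Lemma pi2_ge1 : 1 <= pi *+ 2 :> R.
Proof. by have := pi_ge2 R; rewrite mulr2n; lra. Qed.

Lemma zcoef_limit (D L : R) : 0 <= D -> 0 <= L -> exists2 C : R, 0 <= C &
  forall x (psi : R -> R[i]) k (r : R),
  3^-1 <= x <= 1 -> ccont psi ->
  (forall t, - pi <= t <= pi -> normc (psi t - 1) <= D * `|t|) ->
  `|r| <= L * k%:R -> (0 < k)%N ->
  `|zcoef x psi k r - zgauss x k r| <= C / k%:R.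
Proof.
move=> D0 L0; have [C C0 H] := local_limit D0 L0; exists C => //.
move=> x psi [//|k] r x12 cpsi psiD rL _.
rewrite /zcoef /zgauss -mulrBr normrM ger0_norm; last first.
  by rewrite invr_ge0; have := pi2_ge1; lra.
apply: le_trans (H _ _ _ _ x12 cpsi psiD rL).
by rewrite ler_piMl// invf_le1 ?pi2_ge1//; have := pi2_ge1; lra.
Qed.

Lemma zgauss_bounds x kap k : 3^-1 <= x <= 1 -> 0 < kap -> kap / 12 <= k%:R <= 2 * kap ->
  0 <= zgauss x k (kap * ztp_mean x) <=
    100 / Num.sqrt kap * expR (- ((16 * kap)^-1 * (k%:R - kap) ^+ 2)).
Proof.
move=> x12 k0 /andP[k1 k2]; have kk0 : 0 < k%:R :> R by lra.
have /andP[m1 m2] := ztp_mean_bounds x12; have /andP[v1 v2] := ztp_var_bounds x12.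
have p1 := pi2_ge1; have pi4 := @pi_le4 R.
have ip1 : (pi *+ 2)^-1 <= 1 :> R by rewrite invf_le1//; lra.
have ip0 : 0 <= (pi *+ 2)^-1 :> R by rewrite invr_ge0; lra.
rewrite /zgauss; apply/andP; split; first by rewrite !mulr_ge0 ?sqrtr_ge0 ?expR_ge0.
have kv : 0 < k%:R * ztp_var x by rewrite mulr_gt0//; lra.
rewrite -[leRHS]mul1r; apply: ler_pM => //.
apply: ler_pM; rewrite ?sqrtr_ge0 ?expR_ge0//.
  (* 100 comes from 2 pi * 12 * 90 <= 8 * 12 * 90 <= 100^2. *)
  rewrite -[X in _ <= X / _](_ : Num.sqrt (100 ^+ 2) = 100); last by rewrite sqrtr_sqr ger0_norm.
  rewrite -sqrtrV ?(ltW k0)// -sqrtrM ?exprn_ge0// ler_sqrt; last first.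
    by rewrite mulr_ge0 ?exprn_ge0// invr_ge0 ltW.
  rewrite ler_pdivrMr// mulrAC ler_pdivlMr//.
  have h1 : pi *+ 2 * kap <= 8 * kap by rewrite ler_wpM2r ?(ltW k0)// mulr2n; lra.
  have h2 : kap / 12 * 90^-1 <= k%:R * ztp_var x by apply: ler_pM => //; lra.
  by rewrite expr2; lra.
rewrite ler_expR lerN2.
rewrite (_ : kap * _ - _ = - ((k%:R - kap) * ztp_mean x)); last by ring.
rewrite sqrrN exprMn.
rewrite [leRHS](_ : _ = (ztp_mean x ^+ 2 / (2 * k%:R * ztp_var x)) * (k%:R - kap) ^+ 2); last by ring.
rewrite ler_wpM2r ?sqr_ge0//.
rewrite ler_pdivlMr; last by rewrite -mulrA mulr_gt0.
rewrite ler_pdivrMl ?mulr_gt0//.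
have h1 : k%:R * ztp_var x <= 2 * kap * 4 by apply: ler_pM => //; lra.
have h2 : 1 <= ztp_mean x ^+ 2 by rewrite expr2; nra.
have : 16 * kap * 1 <= 16 * kap * ztp_mean x ^+ 2 by rewrite ler_wpM2l// mulr_ge0// ltW.
lra.
Qed.

Definition zprofile x y : R :=
  ztp_mean x ^+ 2 / (2 * ztp_var x) + ztp_mean y ^+ 2 / (2 * ztp_var y).

(** At r = kap [ztp_mean x] the deviation is (kap - k) [ztp_mean x], so both exponents are multiples
    of (k - kap)^2 / k and their coefficients add up to [zprofile x y]. *)
Lemma zgauss_prod x y kap k : 3^-1 <= x <= 1 -> 3^-1 <= y <= 1 -> (0 < k)%N ->
  zgauss x k (kap * ztp_mean x) * zgauss y k (kap * ztp_mean y) =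
  (pi *+ 2)^-1 / Num.sqrt (ztp_var x * ztp_var y) *
  (k%:R^-1 * expR (- (zprofile x y * (k%:R - kap) ^+ 2 / k%:R))).
Proof.
move=> x12 y12 k0; have K0 : 0 < k%:R :> R by rewrite ltr0n.
have /andP[v1 _] := ztp_var_bounds x12; have /andP[w1 _] := ztp_var_bounds y12.
have Sx : 0 < ztp_var x by lra. have Sy : 0 < ztp_var y by lra.
have P0 : 0 < pi *+ 2 :> R by have := pi2_ge1; lra.
rewrite /zgauss.
set ex := expR _; set ey := expR _; set P := pi *+ 2 in P0 *.
have -> : expR (- (zprofile x y * (k%:R - kap) ^+ 2 / k%:R)) = ex * ey.
  rewrite -expRD; congr expR; rewrite /zprofile; move: (ztp_var x) (ztp_var y) Sx Sy => vx vy Sx Sy.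
  by field; rewrite !lt0r_neq0.
have sq : Num.sqrt (P / (k%:R * ztp_var x)) * Num.sqrt (P / (k%:R * ztp_var y)) =
    P / k%:R / Num.sqrt (ztp_var x * ztp_var y).
  move: (ztp_var x) (ztp_var y) Sx Sy => vx vy Sx Sy; clearbody P.
  rewrite -sqrtrM; last by rewrite divr_ge0 ?mulr_ge0 ?ltW.
  rewrite [X in Num.sqrt X = _](_ : _ = (P / k%:R) ^+ 2 * (vx * vy)^-1); last first.
    by field; rewrite !lt0r_neq0.
  rewrite sqrtrM ?sqr_ge0// sqrtr_sqr sqrtrV ?mulr_ge0 ?ltW//.
  by rewrite ger0_norm// divr_ge0// ltW.
transitivity (P^-1 * P^-1 * (Num.sqrt (P / (k%:R * ztp_var x)) * Num.sqrt (P / (k%:R * ztp_var y))) * (ex * ey)).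
  by ring.
rewrite sq; have : Num.sqrt (ztp_var x * ztp_var y) != 0 by rewrite gt_eqF// sqrtr_gt0 mulr_gt0.
move: (Num.sqrt _) => q q0; clearbody P ex ey; field.
by rewrite q0 !lt0r_neq0.
Qed.

(** Bounded total mass in k, against which the pointwise errors O(1/kap) are later summed. *)
Lemma zgauss_sum_le x kap m n : 3^-1 <= x <= 1 -> 1 <= kap ->
  kap / 12 <= m%:R -> n%:R <= 2 * kap ->
  \sum_(m <= k < n) zgauss x k (kap * ztp_mean x) <= (100 * 144).
Proof.
move=> x12 k1 mk nk; have k0 : 0 < kap by lra.
have b01 : 0 < (16 * kap)^-1 <= 1.
  by rewrite invr_gt0 mulr_gt0//= invf_le1 ?mulr_gt0//; lra.
apply: le_trans (_ : \sum_(m <= k < n) 100 / Num.sqrt kap *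
    expR (- ((16 * kap)^-1 * (k%:R - kap) ^+ 2)) <= _).
  apply: ler_sum_nat => k /andP[]; rewrite -(ler_nat R) -(ltr_nat R) => mk' kn'.
  by have /andP[] := @zgauss_bounds x kap k x12 k0 ltac:(lra).
rewrite -mulr_sumr; apply: le_trans (ler_wpM2l _ (gauss_sum_le kap m n b01)) _.
  by rewrite divr_ge0 ?sqrtr_ge0.
have s0 : 0 < Num.sqrt kap by rewrite sqrtr_gt0.
rewrite sqrtrV ?mulr_ge0 ?(ltW k0)// sqrtrM// (_ : 16 = 4 ^+ 2); last by ring.
rewrite sqrtr_sqr ger0_norm// le_eqVlt; apply/orP; left; apply/eqP.
by field; rewrite lt0r_neq0.
Qed.

(** Origin of the cutoff 12 k <= p: then 64^k = 2^(6k) <= 2^(p/2), and 1/2 <= e^(-1/2). *)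
Lemma half_pow_le_expR p k : (12 * k <= p)%N -> 2^-1 ^+ p * 64 ^+ k <= expR (- (p%:R / 4)) :> R.
Proof.
move=> kp; rewrite -(@ler_pXn2r _ 2)// ?nnegrE ?expR_ge0 ?mulr_ge0 ?exprn_ge0 ?invr_ge0//.
have -> : expR (- (p%:R / 4)) ^+ 2 = expR (- 2^-1) ^+ p :> R.
  by rewrite -!expRM_natl; congr expR; field.
rewrite exprMn -!exprM (_ : 64 = 2 ^+ 6); last by ring.
rewrite -exprM (_ : (6 * (k * 2) = 12 * k)%N); last by rewrite (mulnC k) mulnA.
have h : 2 ^+ (12 * k) <= 2 ^+ p :> R by apply: ler_weXn2l => //; rewrite ler1n.
have q0 : 0 <= 2^-1 ^+ (p * 2) :> R by rewrite exprn_ge0// invr_ge0.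
apply: le_trans (ler_wpM2l q0 h) _.
rewrite mulnC exprM -exprMn lerXn2r ?nnegrE ?mulr_ge0 ?exprn_ge0 ?expR_ge0 ?invr_ge0//.
by have := @expR_geD_sqr R (- 2^-1) ltac:(lra); rewrite sqrrN !expr2; lra.
Qed.

Lemma poly_expRN_le p : p.+1%:R * expR (- (p%:R / 4)) <= 64 / p.+1%:R :> R.
Proof.
rewrite ler_pdivlMr ?ltr0n// expRN mulrAC ler_pdivrMr ?expR_gt0//.
have p0 : 0 <= p%:R :> R by [].
have := @expR_geD_sqr R (p%:R / 4) ltac:(lra); rewrite -[p.+1%:R]natr1 !expr2; nra.
Qed.

End GaussianCoefficients.

(** * Asymptotics of the sum of products *)

Section ProductSum.
Context {R : realType}.
Implicit Types (x y kap : R) (k p s m n : nat).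
Import Normc.

Lemma zprofile_bounds x y : 3^-1 <= x <= 1 -> 3^-1 <= y <= 1 -> 4^-1 <= zprofile x y <= 360.
Proof.
have H z : 3^-1 <= z <= 1 -> 8^-1 <= ztp_mean z ^+ 2 / (2 * ztp_var z) <= 180.
  move=> z12; have /andP[m1 m2] := ztp_mean_bounds z12.
  have /andP[v1 v2] := ztp_var_bounds z12.
  have q1 : 1 <= ztp_mean z ^+ 2 by rewrite expr2; nra.
  have q2 : ztp_mean z ^+ 2 <= 4 by rewrite expr2; nra.
  have v0 : 0 < 2 * ztp_var z by lra.
  by rewrite ler_pdivlMr// ler_pdivrMr//; apply/andP; split; lra.
move=> /H/andP[? ?] /H/andP[? ?]; rewrite /zprofile; lra.
Qed.

(** Replacing the coefficients A, B by densities G, H costs C/kap times the masses of G and H, plus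
    at most 2 kap products of errors of size (C/kap)^2: altogether O(1/kap). The bound 360 ensures
    [zprofile x y <= kap] and leaves room for rounding the cutoff. *)
Lemma zcoef_prod_sum : exists2 C : R, 0 <= C & forall x y kap p s,
  3^-1 <= x <= 1 -> 3^-1 <= y <= 1 -> 360 <= kap ->
  kap * ztp_mean x = p.+1%:R -> kap * ztp_mean y = s%:R ->
  `|\sum_(k < p.+1) zcoef x cis k p.+1%:R * zcoef y (poisson_twist y) k s%:R -
    (pi *+ 2)^-1 / Num.sqrt (ztp_var x * ztp_var y) *
    (kap^-1 * Num.sqrt (pi / (zprofile x y / kap)))| <= C / kap.
Proof.
have D10 : 0 <= 3 * expR 4 :> R by rewrite mulr_ge0 ?expR_ge0.
have [D2 D20 twistB] := @normc_poisson_twistB1 R.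
(* 24 = 2 * 12: the targets are at most 2 kap, and kap <= 12 k for the indices kept. *)
have [C1 C10 lim1] := zcoef_limit D10 (ltac:(lra) : 0 <= 24 :> R).
have [C2 C20 lim2] := zcoef_limit D20 (ltac:(lra) : 0 <= 24 :> R).
pose C : R := 12 * (C1 + C2).
have C0 : 0 <= C by rewrite /C mulr_ge0// addr_ge0.
exists (64 + (C * ((100 * 144) + (100 * 144)) + C * C * 2) + 90 * (288 * 144 * 16 + 72 * 36 + 152)).
  by have := mulr_ge0 C0 C0; lra.
move=> x y kap p s x12 y12 kap360 kx ky.
have /andP[m1 m2] := ztp_mean_bounds x12; have /andP[n1 n2] := ztp_mean_bounds y12.
have k0 : 0 < kap by lra.
have r1 : kap * (1 + 36^-1) <= p.+1%:R by rewrite -kx ler_wpM2l// ltW.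
have r2 : p.+1%:R <= 2 * kap by rewrite -kx mulrC ler_wpM2r// ltW.
have s2 : s%:R <= 2 * kap by rewrite -ky mulrC ler_wpM2r// ltW.
set A := fun k => zcoef x cis k p.+1%:R; set B := fun k => zcoef y (poisson_twist y) k s%:R.
(* The least k with 12 k > p. *)
pose n0 := (p %/ 12).+1.
have n0p : (n0 <= p.+1)%N by rewrite ltnS leq_div.
have n0l : p.+1%:R / 12 <= n0%:R :> R.
  by rewrite ler_pdivrMr// -natrM ler_nat /n0 -ltn_divLR.
have n0u : n0%:R <= (p.+1%:R + 11) / 12 :> R.
  rewrite ler_pdivlMr// -natrM -natrD ler_nat mulSn.
  rewrite (_ : (p.+1 + 11 = 12 + p)%N); last by rewrite addnC addnS -addSn.
  by rewrite leq_add2l leq_divM.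
rewrite -(big_mkord xpredT (fun k => A k * B k)) (big_cat_nat _ n0p)//=.
have small : `|\sum_(0 <= k < n0) A k * B k| <= 64 / kap.
  apply: le_trans (ler_norm_sum _ _ _) _.
  apply: le_trans (_ : \sum_(0 <= k < n0) expR (- (p%:R / 4)) <= _).
    apply: ler_sum_nat => k /andP[_ kn]; rewrite normrM.
    have kp : (12 * k <= p)%N by rewrite mulnC -leq_divRL.
    apply: le_trans (half_pow_le_expR kp); rewrite -[leRHS]mulr1.
    apply: ler_pM => //; first exact: zcoef_small.
    apply: zcoef_le1 => //; first exact: ccont_poisson_twist.
    by move=> t; apply: normc_poisson_twist; lra.
  rewrite sumr_const_nat subn0 -[X in X <= _]mulr_natl.
  apply: le_trans (_ : p.+1%:R * expR (- (p%:R / 4)) <= _).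
    by rewrite ler_wpM2r ?expR_ge0// ler_nat.
  apply: le_trans (poly_expRN_le p) _.
  rewrite ler_wpM2l// lef_pV2 ?posrE ?ltr0n//; lra.
have krange k : (n0 <= k < p.+1)%N -> [/\ (0 < k)%N, kap / 12 <= k%:R & k%:R <= 2 * kap].
  move=> /andP[nk kp]; split; first exact: leq_trans nk.
    by move: nk; rewrite -(ler_nat R); lra.
  by move: kp; rewrite -(ltr_nat R); lra.
pose G k := zgauss x k (kap * ztp_mean x); pose H k := zgauss y k (kap * ztp_mean y).
have AG k : (n0 <= k < p.+1)%N -> `|A k - G k| <= C / kap.
  move=> /krange[kp k1 k2]; have kk0 : 0 < k%:R :> R by rewrite ltr0n.
  rewrite /A /G kx; apply: le_trans (lim1 _ _ _ _ x12 _ _ _ kp) _ => //.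
  - exact: (ccont_cis (@cont_id R)).
  - by move=> t; exact: normc_cisB1_le.
  - by rewrite ger0_norm//; lra.
  rewrite ler_pdivrMr// mulrAC ler_pdivlMr// /C; have : C1 * kap <= C1 * (12 * k%:R) by rewrite ler_wpM2l//; lra.
  by have := mulr_ge0 C20 (ltW kk0); lra.
have BH k : (n0 <= k < p.+1)%N -> `|B k - H k| <= C / kap.
  move=> /krange[kp k1 k2]; have kk0 : 0 < k%:R :> R by rewrite ltr0n.
  rewrite /B /H ky; apply: le_trans (lim2 _ _ _ _ y12 _ _ _ kp) _ => //.
  - exact: ccont_poisson_twist.
  - by move=> t; exact: twistB.
  - by rewrite ger0_norm//; lra.
  rewrite ler_pdivrMr// mulrAC ler_pdivlMr// /C; have : C2 * kap <= C2 * (12 * k%:R) by rewrite ler_wpM2l//; lra.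
  by have := mulr_ge0 C10 (ltW kk0); lra.
have e0 : 0 <= C / kap by rewrite divr_ge0// ltW.
have large : `|\sum_(n0 <= k < p.+1) A k * B k - \sum_(n0 <= k < p.+1) G k * H k| <=
    (C * ((100 * 144) + (100 * 144)) + C * C * 2) / kap.
  rewrite -sumrB; apply: le_trans (ler_norm_sum _ _ _) _.
  apply: le_trans (_ : \sum_(n0 <= k < p.+1) (C / kap * H k + C / kap * G k + C / kap * (C / kap)) <= _).
    apply: ler_sum_nat => k kr; have [kp k1 k2] := krange k kr.
    have /andP[G0 _] := @zgauss_bounds _ x kap k x12 k0 ltac:(lra).
    have /andP[H0 _] := @zgauss_bounds _ y kap k y12 k0 ltac:(lra).
    rewrite -/(G k) in G0; rewrite -/(H k) in H0.
    rewrite (_ : A k * B k - G k * H k = (A k - G k) * B k + G k * (B k - H k)); last by ring.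
    apply: le_trans (ler_normD _ _) _; rewrite (normrM (A k - G k)) (normrM (G k)) (ger0_norm G0).
    have hA := AG k kr; have hB := BH k kr.
    have B1 : `|B k| <= H k + C / kap.
      have := ler_normD (B k - H k) (H k); rewrite subrK (ger0_norm H0).
      by move: hB; clear; lra.
    have h1 : `|A k - G k| * `|B k| <= C / kap * (H k + C / kap) by apply: ler_pM.
    have h2 : G k * `|B k - H k| <= G k * (C / kap) by apply: ler_wpM2l.
    by move: h1 h2; rewrite mulrDr; clear; lra.
  have E3 : \sum_(n0 <= k < p.+1) C / kap * (C / kap) = (p.+1 - n0)%:R * (C / kap * (C / kap)).
    by rewrite sumr_const_nat -[LHS]mulr_natl.
  rewrite !big_split /= E3 -[X in X + _ + _]mulr_sumr -[X in _ + X + _]mulr_sumr.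
  have nl : kap / 12 <= n0%:R by lra.
  have SG : \sum_(n0 <= k < p.+1) G k <= (100 * 144).
    by apply: zgauss_sum_le => //; clear -kap360 nl r1 r2; lra.
  have SH : \sum_(n0 <= k < p.+1) H k <= (100 * 144).
    by apply: zgauss_sum_le => //; clear -kap360 nl r1 r2; lra.
  have h1 := ler_wpM2l e0 SG; have h2 := ler_wpM2l e0 SH.
  have h3 : (p.+1 - n0)%:R * (C / kap * (C / kap)) <= C * C * 2 / kap.
    apply: le_trans (_ : 2 * kap * (C / kap * (C / kap)) <= _).
      apply: ler_wpM2r; first exact: (mulr_ge0 e0 e0).
      apply: (le_trans _ r2).
      by rewrite ler_nat leq_subr.
    by rewrite le_eqVlt; apply/orP; left; apply/eqP; field; rewrite lt0r_neq0.
  rewrite [leRHS](_ : _ = C / kap * (100 * 144) + C / kap * (100 * 144) + C * C * 2 / kap); last by ring.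
  exact: lerD (lerD h2 h1) h3.
have /andP[z1 z2] := zprofile_bounds x12 y12.
have /andP[v1 _] := ztp_var_bounds x12; have /andP[w1 _] := ztp_var_bounds y12.
set W := (pi *+ 2)^-1 / Num.sqrt (ztp_var x * ztp_var y).
(* Each variance is at least 1/90, hence so is the square root of their product. *)
have W90 : 0 <= W <= 90.
  clear -v1 w1; have p1 := @pi2_ge1 R.
  have i1 : (pi *+ 2)^-1 <= 1 :> R by rewrite invf_le1//; lra.
  have i0 : 0 <= (pi *+ 2)^-1 :> R by rewrite invr_ge0; lra.
  have q : 90^-1 <= Num.sqrt (ztp_var x * ztp_var y).
    rewrite -[leLHS]ger0_norm ?invr_ge0// -sqrtr_sqr ler_sqrt.
      by rewrite expr2; apply: ler_pM; rewrite ?invr_ge0.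
    by rewrite mulr_ge0//; lra.
  have q0 : 0 < Num.sqrt (ztp_var x * ztp_var y) by lra.
  rewrite /W divr_ge0 ?(ltW q0)//= ler_pdivrMr//; lra.
have main : `|\sum_(n0 <= k < p.+1) G k * H k - W * (kap^-1 * Num.sqrt (pi / (zprofile x y / kap)))|
   <= 90 * ((288 * 144 * 16 + 72 * 36 + 152) / kap).
  have -> : \sum_(n0 <= k < p.+1) G k * H k = W * \sum_(n0 <= k < p.+1)
      k%:R^-1 * expR (- (zprofile x y * (k%:R - kap) ^+ 2 / k%:R)).
    rewrite mulr_sumr; apply: eq_big_nat => k /krange[kp _ _].
    exact: zgauss_prod.
  have /andP[W0 W9] := W90.
  rewrite -mulrBr normrM (ger0_norm W0); apply: ler_pM => //.
  by apply: gauss_profile_sum; clear -kap360 z1 z2 n0l n0u r1 r2; lra.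
set S1 := \sum_(0 <= k < n0) _ in small *; set S2 := \sum_(n0 <= k < p.+1) _ in large *.
set S3 := \sum_(n0 <= k < p.+1) _ in large main; set V := W * _ in main *.
rewrite (_ : S1 + S2 - V = S1 + (S2 - S3) + (S3 - V)); last by ring.
apply: le_trans (ler_normD _ _) (le_trans (lerD (le_trans (ler_normD _ _) (lerD small large)) main) _).
by rewrite mulrA -!mulrDl.
Qed.

End ProductSum.

(** * The function f and its inverse *)

Section InverseOfF.
Context {R : realType}.
Implicit Types (t u v x y : R).

(** The u with e^(-t) + e^(-u) = 1. The relation is symmetric, which makes this an involution, and
    is equivalent to (e^t - 1)(e^u - 1) = 1. *)
Definition conj_root t : R := - ln (1 - expR (- t)).

Lemma conj_rootP t : 0 < t ->
  0 < conj_root t /\ expR (- conj_root t) = 1 - expR (- t).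
Proof.
move=> t0; have e1 : 0 < 1 - expR (- t) by rewrite subr_gt0 expR_lt1; lra.
rewrite /conj_root opprK lnK ?posrE//; split=> //.
by rewrite oppr_gt0 ln_lt0// e1/= gtrBl expR_gt0.
Qed.

Lemma conj_rootK t : 0 < t -> conj_root (conj_root t) = t.
Proof.
move=> t0; have [_ e] := conj_rootP t0.
by rewrite /conj_root -/(conj_root t) e opprB addrC subrK expRK opprK.
Qed.

Lemma fPE t : fP t = (expR t - 1) * conj_root t / t.
Proof. by rewrite /fP /conj_root; ring. Qed.

Lemma conj_root_exp t : 0 < t -> (expR t - 1) * (expR (conj_root t) - 1) = 1.
Proof.
move=> t0; have [u0 e] := conj_rootP t0.
have h1 := expRxMexpNx_1 t; have h2 := expRxMexpNx_1 (conj_root t).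
move: h2; rewrite e => h2.
have : expR t * (expR (conj_root t) * (1 - expR (- t))) = expR t by rewrite h2 mulr1.
have -> : expR t * (expR (conj_root t) * (1 - expR (- t))) =
  expR (conj_root t) * (expR t - expR t * expR (- t)) by ring.
by rewrite h1 => h3; rewrite mulrBr mulr1 mulrC h3; ring.
Qed.

(** Because e^u - 1 is the inverse of e^t - 1. This identifies the preimage of r/s as the conjugate
    of the preimage of s/r. *)
Lemma fP_conj_root t : 0 < t -> fP (conj_root t) = (fP t)^-1.
Proof.
move=> t0; have [u0 _] := conj_rootP t0; have h := conj_root_exp t0.
have e0 : 0 < expR t - 1 by rewrite subr_gt0 expR_gt1.
rewrite !fPE conj_rootK//; set u := conj_root t in u0 h *.
have -> : expR u - 1 = (expR t - 1)^-1.
  by apply: (mulfI (lt0r_neq0 e0)); rewrite h divff// lt0r_neq0.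
move: (expR t - 1) e0 {h} => w w0; clearbody u; field.
by rewrite !lt0r_neq0.
Qed.

Lemma fP1 : fP 1 = eps0 R.
Proof.
have e0 : 0 < expR 1 - 1 :> R by rewrite subr_gt0 expR_gt1.
rewrite /fP /eps0 divr1 expRN.
have -> : 1 - (expR 1)^-1 = (expR 1 - 1) / expR 1 :> R.
  by field; rewrite gt_eqF// expR_gt0.
by rewrite ln_div ?posrE ?expR_gt0// expRK; ring.
Qed.

(** The logarithm of f, split so that the derivative is a sum of three simple terms. *)
Definition ln_fP t : R := ln (expR t - 1) + ln (conj_root t) - ln t.

Lemma ln_fPE t : 0 < t -> ln_fP t = ln (fP t).
Proof.
move=> t0; have [u0 _] := conj_rootP t0.
have e0 : 0 < expR t - 1 by rewrite subr_gt0 expR_gt1.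
by rewrite fPE ln_div ?posrE ?mulr_gt0// lnM ?posrE.
Qed.

Lemma der_conj_root t : 0 < t -> has_deriv conj_root t (- (expR t - 1)^-1).
Proof.
move=> t0; have e1 : 0 < 1 - expR (- t) by rewrite subr_gt0 expR_lt1; lra.
rewrite /conj_root; apply: der_eq; first by apply: derN; apply: der_ln; [assumption|der].
rewrite /= expRN; field.
have e2 : 0 < expR t - 1 by rewrite subr_gt0 expR_gt1.
by rewrite !lt0r_neq0 ?expR_gt0.
Qed.

Lemma der_ln_fP t : 0 < t ->
  has_deriv ln_fP t (expR t / (expR t - 1) - (expR t - 1)^-1 / conj_root t - t^-1).
Proof.
move=> t0; have [u0 _] := conj_rootP t0.
have e0 : 0 < expR t - 1 by rewrite subr_gt0 expR_gt1.
rewrite /ln_fP; apply: der_eq.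
  apply: derD; last by apply: derN; apply: der_ln; [assumption|der].
  apply: derD; first by apply: der_ln; [assumption|der].
  by apply: der_ln; [assumption|exact: der_conj_root].
by rewrite /=; ring.
Qed.

Lemma ln_fP_deriv_lt0 t : 0 < t ->
  expR t / (expR t - 1) - (expR t - 1)^-1 / conj_root t - t^-1 < 0.
Proof.
move=> t0; have [u0 _] := conj_rootP t0; have h := conj_root_exp t0.
have e0 : 0 < expR t - 1 by rewrite subr_gt0 expR_gt1.
set u := conj_root t in u0 h *; set w := expR u - 1 in h.
have iw : (expR t - 1)^-1 = w.
  by apply: (mulfI (lt0r_neq0 e0)); rewrite h divff// lt0r_neq0.
have -> : expR t / (expR t - 1) = 1 + w.
  by rewrite -iw; field; rewrite lt0r_neq0.
rewrite iw; have uw : u < w by have := @expR_gt1Dx _ u (lt0r_neq0 u0); rewrite /w; lra.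
have tw : t * w < 1.
  have : t < expR t - 1 by have := @expR_gt1Dx _ t (lt0r_neq0 t0); lra.
  by rewrite -h => H; rewrite ltr_pM2r//; lra.
have -> : 1 + w - w / u - t^-1 = ((1 + w) * u * t - w * t - u) / (u * t).
  by field; rewrite !lt0r_neq0.
rewrite pmulr_llt0 ?invr_gt0 ?mulr_gt0//.
(* The numerator is t (u - w) + u (t w - 1), a sum of two negative terms. *)
nra.
Qed.

Lemma fP_inj : {in [pred t : R | 0 < t] &, injective (@fP R)}.
Proof.
suff H (s t : R) : 0 < s -> s < t -> fP s <> fP t.
  move=> s t; rewrite !inE => s0 t0 E; have [st|ts|//] := ltgtP s t.
    by case: (H _ _ s0 st).
  by case: (H _ _ t0 ts).
move=> s0 st E; have t0 : 0 < t by lra.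
have [x /andP[sx _]|c /andP[sc _]] := @mean_value _ ln_fP
   (fun t => expR t / (expR t - 1) - (expR t - 1)^-1 / conj_root t - t^-1) s t (ltW st).
  by apply: der_ln_fP; lra.
rewrite !ln_fPE// E subrr => /esym/eqP; rewrite mulf_eq0 [t - s == 0]subr_eq0 (gt_eqF st) orbF.
by rewrite lt_eqF// ln_fP_deriv_lt0//; lra.
Qed.

Lemma fPinv_eq t v : 0 < t -> fP t = v -> fPinv v = t.
Proof.
move=> t0 tv; rewrite /fPinv; apply: xget_unique => //= s [s0 sv].
by apply: fP_inj; rewrite ?inE// sv.
Qed.

Lemma expRN1_bounds : 3^-1 <= expR (- 1 : R) <= 2^-1.
Proof.
apply/andP; split.
  have -> : expR (-1) = expR (- 6^-1) ^+ 6 :> R by rewrite -expRM_natl; congr expR; field.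
  apply: le_trans (_ : (1 - 6^-1) ^+ 6 <= _); first by rewrite !exprS expr0; lra.
  by rewrite lerXn2r ?nnegrE ?expR_ge0//; [lra|exact: expR_ge1Dx].
rewrite expRN lef_pV2 ?posrE ?expR_gt0//.
by have := expR_ge1Dx (1 : R); lra.
Qed.

Lemma conj_root1_bounds : 3^-1 <= conj_root 1 <= 1.
Proof.
have [_ e] := @conj_rootP 1 ltr01; have /andP[h1 h2] := expRN1_bounds.
have f : 1 - 3^-1 <= expR (- 3^-1) :> R by exact: expR_ge1Dx.
by apply/andP; split; rewrite -lerN2 -ler_expR e; lra.
Qed.

(** Intermediate values: f is [eps0] at 1 and, by conjugation, its inverse at [conj_root 1]. *)
Lemma fP_surj v : eps0 R <= v <= (eps0 R)^-1 ->
  exists2 t : R, conj_root 1 <= t <= 1 & fP t = v.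
Proof.
move=> /andP[v1 v2]; have /andP[c1 c2] := conj_root1_bounds.
have [] := @IVT R (@fP R) (conj_root 1) 1 v c2.
- apply: derivable_within_continuous => t; rewrite in_itv/= => /andP[t1 _].
  have t0 : 0 < t by lra.
  have e1 : 0 < 1 - expR (- t) by rewrite subr_gt0 expR_lt1; lra.
  suff [d dP] : exists d, has_deriv (fun t => (1 - expR t) * ln (1 - expR (- t)) / t) t d.
    by case: dP.
  eexists; apply: derM; last by apply: derV; [exact: lt0r_neq0|der].
  by apply: derM; [der|apply: der_ln; [assumption|der]].
- by rewrite fP_conj_root// fP1 ge_min le_max v1 v2 !orbT.
- by move=> t; rewrite in_itv/= => tc ft; exists t.
Qed.

Lemma inS_roots (r s : nat) (x := fPinv (s%:R / r%:R : R)) (y := fPinv (r%:R / s%:R : R)) :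
  inS R r s -> [/\ 3^-1 <= x <= 1, 3^-1 <= y <= 1, expR (- x) + expR (- y) = 1 &
    s%:R / r%:R = (expR x - 1) * y / x].
Proof.
move=> [r0 [s0 [rs1 rs2]]]; have [t /andP[t1 t2] ft] := fP_surj (introT andP (conj rs1 rs2)).
have /andP[c1 c2] := conj_root1_bounds; have t0 : 0 < t by lra.
have [u0 e] := conj_rootP t0.
have xt : x = t by exact: fPinv_eq.
have yu : y = conj_root t.
  by apply: fPinv_eq => //; rewrite fP_conj_root// ft invf_div.
clearbody x y; have [_ e1] := @conj_rootP 1 ltr01.
have /andP[h1 h2] : conj_root 1 <= conj_root t <= 1.
  apply/andP; split; rewrite -lerN2 -ler_expR e.
    by rewrite e1 lerD2l lerN2 ler_expR lerN2.
  by rewrite lerBrDl -lerBrDr -e1 ler_expR lerN2.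
rewrite xt yu; split; [by rewrite (le_trans c1 t1)|by rewrite (le_trans c1 h1)|by rewrite e; ring|by rewrite -ft fPE].
Qed.

End InverseOfF.

(** * Identification of the main term *)

Section Assembly.
Context {R : realType}.
Implicit Types (x y kap : R) (r s p q : nat).

Lemma ztp_mean_conj x y : 0 < x -> expR (- x) + expR (- y) = 1 -> ztp_mean x = x * expR y.
Proof.
move=> x0 xy; rewrite /ztp_mean (_ : 1 - expR (- x) = expR (- y)); last by rewrite -xy; ring.
by rewrite expRN invrK.
Qed.

(** Reveals Q as the numerator of [zprofile x y] up to a power of e^(x + y), whence its positivity.
    The proof reduces to e^x + e^y = e^(x + y). *)
Lemma Qxy_variance x y : 0 < x -> 0 < y -> expR (- x) + expR (- y) = 1 ->
  (expR x * expR y) ^+ 3 * Qxy x y =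
  ztp_mean x ^+ 2 * ztp_var y + ztp_mean y ^+ 2 * ztp_var x.
Proof.
move=> x0 y0 xy; rewrite /ztp_var (ztp_mean_conj x0 xy).
rewrite (ztp_mean_conj y0 (_ : expR (- y) + expR (- x) = 1)); last by rewrite addrC.
rewrite /Qxy expRD !expRN; move: xy; rewrite !expRN.
have := expR_gt0 x; have := expR_gt0 y; move: (expR x) (expR y) => a b b0 a0 ab.
have ab' : a + b = a * b.
  have := congr1 (fun z => a * b * z) ab; rewrite mulr1 => <-.
  by field; rewrite !lt0r_neq0.
rewrite [b^-1 + a^-1]addrC ab mulr1.
have -> : (a * b) ^+ 3 * (x * y * (a^-1 * b^-1) * (y / b + x / a - x * y)) =
   x * y * (a * b) * (y * a + x * b - x * y * (a * b)).
  by field; rewrite !lt0r_neq0.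
have -> : (x * b) ^+ 2 * (y * a * (1 + y - y * a)) + (y * a) ^+ 2 * (x * b * (1 + x - x * b)) =
   x * y * (a * b) * (y * a + x * b + x * y * (a + b) - 2 * (x * y * (a * b))) by ring.
by rewrite ab'; ring.
Qed.

Lemma Qxy_bounds x y : 3^-1 <= x <= 1 -> 3^-1 <= y <= 1 -> expR (- x) + expR (- y) = 1 ->
  0 < Qxy x y <= 2.
Proof.
move=> x12 y12 xy; have /andP[x1 x2] := x12; have /andP[y1 y2] := y12.
have /andP[m1 m2] := ztp_mean_bounds x12; have /andP[n1 n2] := ztp_mean_bounds y12.
have /andP[v1 _] := ztp_var_bounds x12; have /andP[w1 _] := ztp_var_bounds y12.
have ex := expR_gt0 (- x); have ey := expR_gt0 (- y).
apply/andP; split.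
  have e0 : 0 < (expR x * expR y) ^+ 3 by rewrite exprn_gt0// mulr_gt0 ?expR_gt0.
  rewrite -(pmulr_rgt0 _ e0) Qxy_variance//; [|lra|lra].
  have q1 : 0 < ztp_mean x ^+ 2 by rewrite exprn_gt0//; lra.
  have q2 : 0 < ztp_mean y ^+ 2 by rewrite exprn_gt0//; lra.
  by apply: addr_gt0; apply: mulr_gt0 => //; lra.
have a1 : x * y <= 1 by nra.
have a0 : 0 <= x * y by nra.
have b1 : expR (- x - y) <= 1 by rewrite expR_le1; lra.
have b0 := expR_ge0 (- x - y).
have c1 : y * expR (- y) + x * expR (- x) - x * y * (expR (- y) + expR (- x)) <= 2.
  have : y * expR (- y) <= 1 by nra.
  have : x * expR (- x) <= 1 by nra.
  have : 0 <= x * y * (expR (- y) + expR (- x)) by apply: mulr_ge0 => //; lra.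
  lra.
have d1 : x * y * expR (- x - y) <= 1 by rewrite -[leRHS]mulr1; apply: ler_pM.
have d0 : 0 <= x * y * expR (- x - y) by apply: mulr_ge0.
rewrite /Qxy; set c := y * _ + _ - _ in c1 *.
have : x * y * expR (- x - y) * c <= x * y * expR (- x - y) * 2 by apply: ler_wpM2l.
lra.
Qed.

Lemma main_term_identity x y kap (s : R) :
  3^-1 <= x <= 1 -> 3^-1 <= y <= 1 -> expR (- x) + expR (- y) = 1 ->
  0 < kap -> kap * ztp_mean y = s ->
  expR x * ((pi *+ 2)^-1 / Num.sqrt (ztp_var x * ztp_var y) *
    (kap^-1 * Num.sqrt (pi / (zprofile x y / kap)))) =
  expR (- y) * ((Num.sqrt (2 * pi))^-1 * Num.sqrt (y * expR (- y) / (s * Qxy x y))).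
Proof.
move=> x12 y12 xy k0 ks; have /andP[x1 x2] := x12; have /andP[y1 y2] := y12.
have x0 : 0 < x by lra. have y0 : 0 < y by lra.
have QV := Qxy_variance x0 y0 xy; have /andP[Q0 _] := Qxy_bounds x12 y12 xy.
have /andP[m1 _] := ztp_mean_bounds x12; have /andP[n1 _] := ztp_mean_bounds y12.
have /andP[v1 _] := ztp_var_bounds x12; have /andP[w1 _] := ztp_var_bounds y12.
have my : ztp_mean y = y * expR x by apply: ztp_mean_conj; rewrite // addrC.
have P0 := pi_gt0 R; have a0 := expR_gt0 x; have b0 := expR_gt0 y.
have s0 : 0 < s by rewrite -ks mulr_gt0//; lra.
have /andP[z1 _] := zprofile_bounds x12 y12.
have S0 : 0 < ztp_var x by lra. have T0 : 0 < ztp_var y by lra.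
have M0 : 0 < ztp_mean x by lra. have N0 : 0 < ztp_mean y by lra.
have Z0 : 0 < zprofile x y by lra.
have P20 : 0 <= (pi *+ 2)^-1 :> R by rewrite invr_ge0; have := @pi2_ge1 R; lra.
(* Both sides are nonnegative; after squaring, only a rational identity in x, y, e^x, e^y, pi and
   kap is left. *)
apply/eqP; rewrite -(@eqrXn2 _ 2)//; last first.
  apply: mulr_ge0; first exact: expR_ge0.
  apply: mulr_ge0; first by apply: divr_ge0; rewrite ?sqrtr_ge0.
  by apply: mulr_ge0; rewrite ?sqrtr_ge0// invr_ge0 ltW.
have sqL (a p q k t : R) : (a * (p^-1 / q * (k^-1 * t))) ^+ 2 =
    a ^+ 2 * ((p ^+ 2)^-1 / q ^+ 2 * ((k ^+ 2)^-1 * t ^+ 2)) by rewrite !exprMn !exprVn.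
have sqR (a q t : R) : (a * (q^-1 * t)) ^+ 2 = a ^+ 2 * ((q ^+ 2)^-1 * t ^+ 2).
  by rewrite !exprMn exprVn.
have E1 : Num.sqrt (ztp_var x * ztp_var y) ^+ 2 = ztp_var x * ztp_var y.
  by apply: sqr_sqrtr; apply: mulr_ge0; exact: ltW.
have E2 : Num.sqrt (pi / (zprofile x y / kap)) ^+ 2 = pi / (zprofile x y / kap).
  by apply: sqr_sqrtr; apply: divr_ge0; rewrite ?pi_ge0// divr_ge0// ltW.
have E3 : Num.sqrt (2 * pi) ^+ 2 = 2 * pi :> R by rewrite sqr_sqrtr// mulr_ge0 ?pi_ge0.
have E4 : Num.sqrt (y * expR (- y) / (s * Qxy x y)) ^+ 2 = y * expR (- y) / (s * Qxy x y).
  by apply: sqr_sqrtr; apply: divr_ge0; apply: mulr_ge0; rewrite ?expR_ge0// ltW.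
rewrite sqL sqR E1 E2 E3 E4 {sqL sqR E1 E2 E3 E4}.
rewrite expRN; move: (Qxy x y) Q0 QV => Q Q0 QV.
have zE : zprofile x y = (expR x * expR y) ^+ 3 * Q / (2 * ztp_var x * ztp_var y).
  rewrite QV /zprofile; move: (ztp_var x) (ztp_var y) S0 T0 => S T S0 T0.
  by field; rewrite !lt0r_neq0.
rewrite zE -ks my mulr2n.
move: (ztp_var x) (ztp_var y) S0 T0 (expR x) (expR y) a0 b0 (@pi R) P0 => S T S0 T0 a b a0 b0 P P0.
by apply/eqP; field; rewrite !lt0r_neq0 ?addr_gt0.
Qed.

End Assembly.

Theorem theorem1p3 (R : realType) :
  exists C : R, exists N : nat,
  forall r s : nat, inS R r s -> (N <= r)%N -> (N <= s)%N ->
  let x := fPinv (s%:R / r%:R : R) in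
  let y := fPinv (r%:R / s%:R : R) in
  exists E : R, `|E| <= C / Num.sqrt (s%:R) /\
    (ba_count r.-1 s)%:R =
      (s`!)%:R * (r`!)%:R * (expR (- y) + E) * (Num.sqrt (2 * pi))^-1 *
      x ^- r * y ^- s *
      Num.sqrt (y * expR (- y) / (s%:R * Qxy x y)).
Proof.
have [C C0 sumU] := @zcoef_prod_sum R.
(* 720: kap >= r / 2 must reach 360. 16 C is 8 * 2 C, from (1 + 1/s) e^x <= 8 and 1/kap <= 2/s; 14
   comes from [Z14], and the summand 1 absorbs the 1/s in the prefactor. *)
exists (16 * C * 14 + 1), 720%N => r s rs Nr _ x y.
have [x12 y12 xy fx] := inS_roots rs; rewrite -/x -/y in x12 y12 xy fx; clearbody x y.
have /andP[x1 x2] := x12; have /andP[y1 y2] := y12.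
have x0 : 0 < x by lra. have y0 : 0 < y by lra.
have [_ [sN _]] := rs; have r0 : (0 < r)%N by exact: leq_trans Nr.
have s0 : 0 < s%:R :> R by rewrite ltr0n.
have rR0 : 0 < r%:R :> R by rewrite ltr0n.
have s1 : 1 <= s%:R :> R by rewrite ler1n.
have mx : ztp_mean x = x * expR y by exact: ztp_mean_conj.
have my : ztp_mean y = y * expR x by apply: ztp_mean_conj => //; rewrite addrC.
have a0 := expR_gt0 x; have b0 := expR_gt0 y.
have ab : expR x + expR y = expR x * expR y.
  have := congr1 (fun z => expR x * expR y * z) xy; rewrite mulr1 !expRN => <-.
  by field; rewrite !lt0r_neq0.
have ab1 : (expR x - 1) * (expR y - 1) = 1.
  by rewrite mulrBl mul1r mulrBr mulr1 -ab; ring.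
have /andP[m1 m2] := ztp_mean_bounds x12; have /andP[n1 n2] := ztp_mean_bounds y12.
pose kap : R := r%:R / ztp_mean x.
have kx : kap * ztp_mean x = r.-1.+1%:R.
  by rewrite prednK// /kap divfK// lt0r_neq0//; lra.
have sr : s%:R = r%:R * ((expR x - 1) * y / x).
  by rewrite -fx mulrCA divff ?mulr1// lt0r_neq0.
have exy : (expR x - 1) * expR y = expR x by rewrite mulrBl mul1r -ab; ring.
have ky : kap * ztp_mean y = s%:R.
  rewrite /kap mx my sr -{1}exy; field.
  by rewrite !lt0r_neq0.
have kap360 : 360 <= kap.
  have r720 : 720 <= r%:R :> R by rewrite ler_nat.
  by rewrite /kap ler_pdivlMr; [move: r720 m2; clear; lra|exact: lt_le_trans m1].
have k0 : 0 < kap by lra.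
have := sumU x y kap r.-1 s x12 y12 kap360 kx ky.
have := ba_count_zcoef r.-1 s x0 y0 ab1.
set U := \sum_(k < _) _; set V := (pi *+ 2)^-1 / _ * _ => baE UV.
have VZ := main_term_identity x12 y12 xy k0 ky; rewrite -/V in VZ.
set P := Num.sqrt (y * _ / _) in VZ *; set Z := (Num.sqrt (2 * pi))^-1 * P in VZ.
have /andP[Q0 Q2] := Qxy_bounds x12 y12 xy.
have ey0 := expR_gt0 (- y).
have ss0 : 0 < Num.sqrt s%:R :> R by rewrite sqrtr_gt0.
(* The lower bound on the main factor that turns an additive O(1/s) into a relative O(s^(-1/2)). 14
   works since 2 pi Q <= 16, y e^(-y) >= 1/12 and 16 * 12 <= 14^2. *)
have Z14 : (14 * Num.sqrt s%:R)^-1 <= Z.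
  have ey4 : 4^-1 <= expR (- y).
    apply: le_trans (_ : expR (- 1) <= _); last by rewrite ler_expR; lra.
    by have /andP[] := @expRN1_bounds R; lra.
  rewrite /Z /P; move: (Qxy x y) Q0 Q2 => q Q0 Q2.
  rewrite -[leLHS]ger0_norm ?invr_ge0 ?mulr_ge0 ?sqrtr_ge0// -sqrtr_sqr.
  rewrite -sqrtrV ?mulr_ge0 ?pi_ge0// -sqrtrM ?invr_ge0 ?mulr_ge0 ?pi_ge0//.
  have p4 := @pi_le4 R; have p0 := pi_gt0 R.
  have sQ0 : 0 < s%:R * q by exact: (mulr_gt0 s0 Q0).
  rewrite ler_sqrt; last first.
    by apply: mulr_ge0; rewrite ?invr_ge0 ?mulr_ge0 ?pi_ge0// ?divr_ge0 ?(ltW sQ0) ?mulr_ge0 ?(ltW y0) ?(ltW ey0) ?invr_ge0 ?(ltW sQ0).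
  rewrite exprVn exprMn sqr_sqrtr ?(ltW s0)// -invf_div -invfM.
  have e12 : 12^-1 <= y * expR (- y).
    by have := ler_pM (_ : 0 <= 3^-1 :> R) (_ : 0 <= 4^-1 :> R) y1 ey4; rewrite ?invr_ge0//; lra.
  have ye0 : 0 < y * expR (- y) by rewrite mulr_gt0.
  rewrite lef_pV2 ?posrE ?mulr_gt0 ?divr_gt0 ?invr_gt0 ?exprn_gt0//.
  rewrite mulrA ler_pdivrMr//.
  have h1 : 2 * pi * (s%:R * q) <= 8 * (s%:R * 2).
    apply: ler_pM; [by rewrite mulr_ge0 ?(ltW p0)|exact: (ltW sQ0)|by clear -p4; lra|].
    by apply: ler_wpM2l => //; exact: (ltW s0).
  have h2 : 14 ^+ 2 * s%:R * 12^-1 <= 14 ^+ 2 * s%:R * (y * expR (- y)).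
    by rewrite ler_wpM2l// mulr_ge0 ?exprn_ge0// ltW.
  have h3 : 8 * (s%:R * 2) <= 14 ^+ 2 * s%:R * 12^-1 :> R by rewrite expr2; clear -s0; lra.
  by apply: le_trans h1 (le_trans h3 h2).
have i14 : 0 < (14 * Num.sqrt s%:R)^-1 :> R by rewrite invr_gt0 mulr_gt0.
have Z0 : 0 < Z by exact: lt_le_trans Z14.
(* E is forced by the equation: e^x V equals e^(-y) Z, and (1 + 1/s) e^x is the quotient of the
   prefactor in [ba_count_zcoef] by the one in the claim. *)
exists (((1 + s%:R^-1) * (expR x * U) - expR x * V) / Z); split.
  have kapE : kap^-1 <= 2 / s%:R.
    have sk : s%:R / 2 <= kap.
      by rewrite ler_pdivrMr// -ky; apply: ler_wpM2l; [exact: ltW|].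
    have s20 : 0 < s%:R / 2 :> R by rewrite divr_gt0.
    by rewrite -[2 / _]invf_div (lef_pV2 k0 s20).
  have ex4 : expR x <= 4.
    by apply: le_trans (@expR1_le4 R); rewrite ler_expR.
  have is1 : s%:R^-1 <= 1 :> R by rewrite invf_le1.
  have is0 : 0 < s%:R^-1 :> R by rewrite invr_gt0.
  rewrite normrM normfV (gtr0_norm Z0) ler_pdivrMr//.
  rewrite (_ : _ - _ = (1 + s%:R^-1) * expR x * (U - V) + s%:R^-1 * (expR x * V)); last by ring.
  apply: le_trans (ler_normD _ _) _; rewrite [(_ + 1) / _]mulrDl [leRHS]mulrDl; apply: lerD.
    rewrite normrM ger0_norm; last by rewrite mulr_ge0 ?(ltW a0)//; lra.
    apply: le_trans (_ : 8 * (C * (2 / s%:R)) <= _).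
      have se0 : 0 <= (1 + s%:R^-1) * expR x by rewrite mulr_ge0 ?(ltW a0)//; lra.
      apply: (ler_pM se0 (normr_ge0 _)).
        have : s%:R^-1 * expR x <= 1 * 4 by apply: ler_pM => //; exact: ltW.
        by clear -ex4; lra.
      by apply: le_trans UV _; apply: ler_wpM2l.
    apply: le_trans (_ : 16 * C * 14 / Num.sqrt s%:R * (14 * Num.sqrt s%:R)^-1 <= _); last first.
      by apply: ler_wpM2l => //; rewrite !mulr_ge0 ?invr_ge0 ?(ltW ss0).
    rewrite le_eqVlt; apply/orP; left; apply/eqP.
    rewrite -[s%:R in LHS](sqr_sqrtr (ltW s0)); field.
    exact: lt0r_neq0.
  rewrite VZ !normrM (gtr0_norm is0) (gtr0_norm ey0) -/Z.
  rewrite -normrM -/Z (gtr0_norm Z0) mulrA; apply: ler_wpM2r; first exact: ltW.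
  rewrite div1r; apply: le_trans (_ : s%:R^-1 <= _).
    by rewrite ler_piMr ?(ltW is0)// expR_le1 oppr_le0 (ltW y0).
  rewrite lef_pV2 ?posrE// -{2}(sqr_sqrtr (ltW s0)) expr2 ler_peMl ?(ltW ss0)//.
  by rewrite -[leLHS]sqrtr1 ler_sqrt.
have -> : expR (- y) + ((1 + s%:R^-1) * (expR x * U) - expR x * V) / Z =
    (1 + s%:R^-1) * (expR x * U) / Z by rewrite mulrBl VZ mulfK ?lt0r_neq0// addrC subrK.
have x0' := lt0r_neq0 x0; have y0' := lt0r_neq0 y0.
rewrite baE.
have -> : (s`!)%:R * (r`!)%:R * ((1 + s%:R^-1) * (expR x * U) / Z) * (Num.sqrt (2 * pi))^-1 *
   x ^- r * y ^- s * P = (s`!)%:R * (r`!)%:R * ((1 + s%:R^-1) * (expR x * U)) * (x ^- r * y ^- s) * (Z / Z).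
  by rewrite /Z; ring.
rewrite divff ?mulr1; last exact: lt0r_neq0.
(* The only place where the ratio s/r enters the prefactors: it trades e^y / y for e^x / x. *)
have core : y^-1 * expR y = r%:R / s%:R * expR x / x.
  have a1 : expR x - 1 != 0 by apply: contra_eq_neq ab1 => ->; rewrite mul0r eq_sym oner_neq0.
  by rewrite -{1}exy sr; field; rewrite x0' y0' a1 lt0r_neq0.
have -> : r`!%:R = r%:R * (r.-1)`!%:R :> R by rewrite -{1}(prednK r0) factS natrM prednK.
have -> : x ^- r = x^-1 * x ^- r.-1 by rewrite -{1}(prednK r0) exprS invfM.
rewrite factS natrM -natr1 exprS !invfM.
move: core (U) (x ^- _) (y ^- _) (_`!%:R) (_`!%:R) (lt0r_neq0 s0) => core u xp ys pf sf s0'.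
transitivity (pf * sf * xp * ys * u * (s%:R + 1) * (y^-1 * expR y)); first by ring.
by rewrite core; field; rewrite x0' s0'.
Qed.
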